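(* Let $n\geq2$, let $M\subset\mathbb{R}^n$ be a manifold of finite type with Fourier decay exponent $\sigma(M)>0$, let $p\geq3$ be an integer and $D\subset\{0,\dots,p-1\}^n$, and let $K=K_{p,D}$. Suppose that $\dim_{l^1}K_{p,D}+\sigma(M)-n>0$. Then there is an integer $l\geq0$ such that $M\cap K_{p,D,l}$ is infinite. In fact, there is an integer $l\geq0$ and a constant $c>0$ such that for all sufficiently small $\delta>0$, covering $M^\delta\cap K_{p,D,l}^\delta$ requires at least $c(1/\delta)^{\dim_{\mathrm{H}}K+\dim M-n}$ balls of radius $\delta$. Moreover, for such $l$, \[ \underline{\dim}_{\mathrm{B}}(M\cap K_{p,D,l})\geq\dim_{\mathrm{H}}K-(n-\sigma(M)). \] Finally, $\bigcup_{l\geq0}(K_{p,D,l}\cap M)$ is dense in $M$.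
   Context: A smooth submanifold $M\subset\mathbb{R}^n$ is of finite type if at every point $x\in M$, $M$ has only finite order contact with affine hyperplanes through $x$; $\dim M$ is its manifold dimension and $A^\delta$ denotes the open $\delta$-neighbourhood of a set $A$. $\sigma(M)>0$ denotes a number such that for every smooth compactly supported function $\phi$ the measure $\phi\mu_M$ ($\mu_M$ the surface measure on $M$) satisfies $|\widehat{\phi\mu_M}(\xi)|=O(|\xi|^{-\sigma(M)})$. For $x\in\mathbb{R}^n$, $\{x\}\in[0,1)^n$ and $[x]=x-\{x\}\in\mathbb{Z}^n$ are the componentwise fractional and integer parts. For $l\geq0$, $K_{p,D,l}=\mathrm{cl}\{x\in\mathbb{R}^n:[p\{p^kx\}]\in D\text{ for all }k\geq l\}$ and $K_{p,D}=K_{p,D,0}$. $\lambda_{p,D}$ is the distribution of $\sum_{i\geq1}p^{-i}\mathbf d_i$ with $\mathbf d_i$ i.i.d. uniform on $D$, and $\dim_{l^1}K_{p,D}=\dim_{l^1}\lambda_{p,D}$, where for a probability measure $\mu$ with $\hat\mu(\xi)=\int e^{-2\pi i(x,\xi)}d\mu(x)$, \[ \dim_{l^1}\mu=\sup\Big\{s>0:\ \sup_{\theta\in[0,1]^n}\sum_{\xi\in\mathbb{Z}^n,|\xi|\leq R}|\hat\mu(\xi+\theta)|\ll R^{n-s}\Big\}. \] $\underline{\dim}_{\mathrm{B}}F=\liminf_{\delta\to0}\frac{\log N_\delta(F)}{-\log\delta}$ with $N_\delta(F)$ the minimal number of $\delta$-balls covering $F$.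
   Formalization: The formal statement assumes K_{p,D} nonempty (the claim fails when D is nonempty but some coordinate of all digits is p-1, since then every K_{p,D,l} is empty), M nonempty, and dim M < n (for open M the box-dimension bound fails when σ(M) > n). *)

(* Defs.v *)
From HB Require Import structures.
From mathcomp Require Import all_boot all_order all_algebra.
From mathcomp Require Import finmap.
From mathcomp Require Import all_classical all_reals all_analysis.
From mathcomp Require Import complex.

Set Implicit Arguments.
Unset Strict Implicit.
Unset Printing Implicit Defensive.

Import Order.TTheory GRing.Theory Num.Theory.
Import numFieldNormedType.Exports.
Import ComplexField.Normc.

Local Open Scope classical_set_scope.
Local Open Scope ring_scope.

(** The library norm on ['rV[R]_n] is the sup norm, so the
    Euclidean norm is introduced separately. *)

Definition dotp (R : realType) (n : nat) (x y : 'rV[R]_n) : R :=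
  \sum_(i < n) x 0 i * y 0 i.

Definition enorm (R : realType) (n : nat) (x : 'rV[R]_n) : R :=
  Num.sqrt (dotp x x).

Definition thickening (R : realType) (n : nat) (delta : R) (A : set 'rV[R]_n) :
    set 'rV[R]_n :=
  [set x | exists2 a, A a & enorm (x - a) < delta].

(** Equal to [+oo] when no finite cover exists. *)
Definition covering_number (R : realType) (n : nat) (delta : R)
    (F : set 'rV[R]_n) : \bar R :=
  ereal_inf [set ((size s)%:R)%:E | s in [set s : seq 'rV[R]_n |
    F `<=` [set x | exists2 c, c \in s & enorm (x - c) <= delta]]].

Definition lower_box_dim (R : realType) (n : nat) (F : set 'rV[R]_n) : \bar R :=
  limf_einf (fun delta : R =>
    (lne (covering_number delta F) * ((- ln delta)^-1)%:E)%E) (0^'+).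

Definition diam (R : realType) (n : nat) (A : set 'rV[R]_n) : R :=
  sup [set enorm (z.1 - z.2) | z in A `*` A].

Definition hausdorff_premeasure (R : realType) (n : nat) (s delta : R)
    (A : set 'rV[R]_n) : \bar R :=
  ereal_inf [set (\sum_(0 <= i <oo) (diam (U i) `^ s)%:E)%E |
    U in [set U : nat -> set 'rV[R]_n | A `<=` \bigcup_i U i /\
      forall i x y, U i x -> U i y -> enorm (x - y) <= delta]].

Definition hausdorff_measure (R : realType) (n : nat) (s : R)
    (A : set 'rV[R]_n) : \bar R :=
  ereal_sup [set hausdorff_premeasure s delta A | delta in [set delta | 0 < delta]].

(** The set below contains every [s > n], so this is a genuine infimum.
    Restricting to [s > 0] does not affect it and avoids the convention
    [0 `^ 0 = 1] for empty sets of a cover. *)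
Definition hausdorff_dim (R : realType) (n : nat) (A : set 'rV[R]_n) : R :=
  inf [set s | 0 < s /\ hausdorff_measure s A = 0%E].

Definition borelRn (R : realType) (n : nat) :=
  g_sigma_algebraType (@open 'rV[R]_n).

(** The Fourier transform of [phi mu],
    i.e. the integral of [phi x * exp (-2 pi i (x, xi))]. *)
Definition fourier (R : realType) (n : nat)
    (mu : {measure set (borelRn R n) -> \bar R})
    (phi : 'rV[R]_n -> R) (xi : 'rV[R]_n) : R[i] :=
  Complex (\int[mu]_(x in setT) (phi x * cos (2 * pi * dotp x xi)))
          (- \int[mu]_(x in setT) (phi x * sin (2 * pi * dotp x xi))).

Definition integer_points (R : realType) (n : nat) (r : R) : set 'rV[int]_n :=
  [set xi | enorm (map_mx intr xi : 'rV[R]_n) <= r].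

(** The supremum over [theta] in [0,1]^n of the sum of [|mu^ (xi + theta)|]
    over the integer points [xi] with [|xi| <= r]. *)
Definition fourier_l1_sum (R : realType) (n : nat)
    (mu : {measure set (borelRn R n) -> \bar R}) (r : R) : \bar R :=
  ereal_sup [set (\esum_(xi in @integer_points R n r)
      (normc (fourier mu (cst 1) (map_mx intr xi + theta)))%:E)%E |
    theta in [set theta : 'rV[R]_n | forall i, 0 <= theta 0 i <= 1]].

(** [ereal_sup] of the empty set is [-oo]; this happens only when no positive
    exponent is admissible. *)
Definition dim_l1 (R : realType) (n : nat)
    (mu : {measure set (borelRn R n) -> \bar R}) : \bar R :=
  ereal_sup [set s%:E | s in [set s : R | 0 < s /\
    exists C : R, forall r, 1 <= r ->
      (fourier_l1_sum mu r <= (C * r `^ (n%:R - s))%:E)%E]].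

Definition intpart (R : realType) (n : nat) (x : 'rV[R]_n) : 'rV[int]_n :=
  map_mx Num.floor x.

Definition fracpart (R : realType) (n : nat) (x : 'rV[R]_n) : 'rV[R]_n :=
  x - map_mx intr (intpart x).

Definition digitZ (n p : nat) (d : 'rV['I_p]_n) : 'rV[int]_n :=
  map_mx (fun i : 'I_p => (i : nat)%:Z) d.

Definition missing_digit_set (R : realType) (n p : nat) (D : {set 'rV['I_p]_n})
    (l : nat) : set 'rV[R]_n :=
  closure [set x | forall k, (l <= k)%N ->
    exists2 d, d \in D &
      intpart (p%:R *: fracpart (p%:R ^+ k *: x)) = digitZ d].
Arguments missing_digit_set R {n p} D l.

(** Digits are indexed from 0: [d i] is the digit of weight [p ^ - (i + 1)]. *)
Definition iid_uniform (R : realType) (disp : measure_display)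
    (Omega : measurableType disp) (P : probability Omega R) (T : finType)
    (D : {set T}) (d : nat -> Omega -> T) : Prop :=
  [/\ forall i a, measurable [set w | d i w = a],
      forall i a, P [set w | d i w = a] =
        (if a \in D then (#|D|%:R^-1)%:E else 0%E) &
      forall (J : {fset nat}) (a : nat -> T),
        P (\bigcap_(i in [set` J]) [set w | d i w = a i]) =
        (\prod_(i <- J) fine (P [set w | d i w = a i]))%:E].

Definition digit_series (R : realType) (n p : nat) (Omega : Type)
    (d : nat -> Omega -> 'rV['I_p]_n) (w : Omega) : 'rV[R]_n :=
  limn (series (fun i : nat => p%:R ^- i.+1 *: map_mx intr (digitZ (d i w)))).

(** [lam] is the law of the random series [\sum_(i >= 1) p ^ -i d_i] with
    [d_i] i.i.d. uniform on [D]; this determines [lam] uniquely. *)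
Definition missing_digit_law (R : realType) (n p : nat) (D : {set 'rV['I_p]_n})
    (lam : probability (borelRn R n) R) : Prop :=
  exists (disp : measure_display) (Omega : measurableType disp)
    (P : probability Omega R) (d : nat -> Omega -> 'rV['I_p]_n),
    iid_uniform P D d /\
    forall A : set (borelRn R n), measurable A ->
      lam A = P [set w | A (digit_series R d w)].

Definition iter_derive (R : realType) (V W : normedModType R) (vs : seq V)
    (f : V -> W) : V -> W :=
  foldr (fun v g => 'D_v g) f vs.

Definition smooth_on (R : realType) (V W : normedModType R) (U : set V)
    (f : V -> W) : Prop :=
  forall (vs : seq V) (x : V), U x ->
    {for x, continuous (iter_derive vs f)} /\
    forall v, derivable (iter_derive vs f) x v.

(** [f] parametrises a relatively open piece of [M]: an injective immersion of
    the open set [U] which is open onto its image in [M]. *)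
Definition local_parametrization (R : realType) (n d : nat) (M : set 'rV[R]_n)
    (U : set 'rV[R]_d) (f : 'rV[R]_d -> 'rV[R]_n) : Prop :=
  [/\ open U,
      smooth_on U f,
      set_inj U f,
      forall u, U u -> row_free ('J f u) &
      forall V, open V -> V `<=` U -> exists2 W, open W & f @` V = M `&` W].

Definition submanifold (R : realType) (n d : nat) (M : set 'rV[R]_n) : Prop :=
  forall x, M x -> exists (U : set 'rV[R]_d) (f : 'rV[R]_d -> 'rV[R]_n),
    local_parametrization M U f /\ (f @` U) x.

(** The contact of [M] at [x] with the hyperplane through [x] orthogonal to
    [eta] has finite order iff the signed distance to that hyperplane, read in
    a parametrisation, does not vanish to infinite order at [x]. *)
Definition finite_type (R : realType) (n d : nat) (M : set 'rV[R]_n) : Prop :=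
  forall (U : set 'rV[R]_d) (f : 'rV[R]_d -> 'rV[R]_n),
    local_parametrization M U f ->
    forall u eta, U u -> eta != 0 ->
    exists vs : seq 'rV[R]_d,
      iter_derive vs (fun w => dotp (f w - f u) eta : R^o) u != 0.

(** Lebesgue integral over R^d of a nonnegative function, as an iterated
    one-dimensional integral (Tonelli). *)
Fixpoint iterated_integral (R : realType) (d : nat) :
    ('rV[R]_d -> \bar R) -> \bar R :=
  match d return ('rV[R]_d -> \bar R) -> \bar R with
  | 0 => fun g => g 0
  | d'.+1 => fun g => (\int[lebesgue_measure]_(t in [set: R])
      iterated_integral (fun v : 'rV[R]_d' => g (row_mx (const_mx t : 'rV_1) v)))%E
  end.

(** [mu] is the surface (Riemannian volume) measure of [M], determined by its
    expression [sqrt (det (J J^T)) du] in every local parametrisation. The rows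
    of ['J f u] are the partial derivatives of [f]. *)
Definition surface_measure (R : realType) (n d : nat) (M : set 'rV[R]_n)
    (mu : {measure set (borelRn R n) -> \bar R}) : Prop :=
  mu (~` M) = 0%E /\
  forall (U : set 'rV[R]_d) (f : 'rV[R]_d -> 'rV[R]_n),
    local_parametrization M U f ->
    forall B : set (borelRn R n), measurable B -> B `<=` f @` U ->
      mu B = iterated_integral (fun u =>
        (\1_(U `&` f @^-1` B) u *
         Num.sqrt (\det ('J f u *m ('J f u)^T)))%:E).

Definition tsupp (R : realType) (n : nat) (phi : 'rV[R]_n -> R) :
    set 'rV[R]_n :=
  closure [set x | phi x != 0].

(** Test functions are smooth on R^n with compact support, and the support
    meets [M] in a compact set: the latter is automatic when [M] is closed and
    keeps [phi mu] finite in general. *)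
Definition fourier_decay (R : realType) (n : nat) (M : set 'rV[R]_n)
    (mu : {measure set (borelRn R n) -> \bar R}) (sigma : R) : Prop :=
  forall phi : 'rV[R]_n -> R,
    smooth_on setT (phi : 'rV[R]_n -> R^o) ->
    compact (tsupp phi) -> compact (M `&` tsupp phi) ->
    exists C r : R, forall xi, r <= enorm xi ->
      normc (fourier mu phi xi) <= C * enorm xi `^ (- sigma).

(* Main.v *)
(** Fix a bump function [phi] around a point of [M] and let [F_N] be the
    n-dimensional Fejer kernel, a [Z^n]-periodic bump of width [1/N].
    Average [F_N (p^l x - y)] and its square over the level-[m] points [y] of
    [K] and integrate in [x] against [phi mu]. Expanding in characters, the
    nonzero frequencies [z] contribute
    [|(phi mu)^ (p^l z)| |lam_m^ (z)| = O(p^(-l sigma) |z|^(-sigma) |lam_m^ (z)|)];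
    since [dim_l1 > n - sigma], the sum over dyadic shells converges, so for one
    large [l] the zero frequency dominates for all [N] and all large [m].
    As [F_N^2 <= kappa F_N] away from [A/N]-neighbourhoods of [Z^n], the mean of
    [F_N^2 - kappa F_N] is at least [c N^-n] only because points of [M] come
    within [O(1/N)] of the set with free digits before position [l].

    This positive mass is then counted. A ball of radius [r = p^(-k-l)] sees
    boundedly many of the [#|D|^k] level-[k] pieces; the same expansion for a
    single piece bounds its mass by [O(#|D|^-k p^(k (n - sigma)) N^-n)], which
    gives the box dimension, while [mu (B(x, r)) = O(r^d)] gives the count for
    thickenings. Testing against Dirac masses shows [sigma < n] and
    [n - sigma < log #|D| / log p], so these counts are unbounded; the Hausdorff
    dimension enters only through its upper bound [log #|D| / log p]. *)

Require Import Defs.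
From HB Require Import structures.
From mathcomp Require Import all_boot all_order all_algebra.
From mathcomp Require Import finmap all_classical all_reals all_analysis.
From mathcomp Require Import measurable_realfun.
From mathcomp Require Import complex polyrcf ring lra zify.

Set Implicit Arguments.
Unset Strict Implicit.
Unset Printing Implicit Defensive.

Import Order.TTheory GRing.Theory Num.Theory.
Import numFieldNormedType.Exports.
Import ComplexField.Normc.

Local Open Scope classical_set_scope.
Local Open Scope ring_scope.

(** * Fejer kernels *)

Section Kernel.
Variable R : realType.
Implicit Types (x t : R) (n N : nat).

(** The kernel [F_N] is positive almost everywhere, so positive mass of [F_N] alone locates nothing:
    its tails could carry it. Normalised to maximum 1, [F_N] and [F_N^2] both have means of order
    [N^-n], so a small multiple of [F_N] can be subtracted from [F_N^2] with a positive main term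
    left, and the difference is nonpositive away from the lattice. Trigonometric polynomials keep
    all frequency sums finite: once [N] is known, only finitely many frequencies occur, and a level
    [m] exists at which the words imitate [lam] on all of them. Hence [m] always comes last. Words
    are preferred to the limit measure because a sum over words of length [k + m] splits exactly
    into [#|D|^k] contracted copies of the sum over words of length [m], which isolates single
    pieces. The order of choices matters. [l] depends on the bump [phi] but not on [N]. In the box
    count [N] depends on the given cover through a compactness argument and is uncontrolled, so both
    bounds must carry exactly the factor [N^-n], which then cancels. Since [l] depends on the bump,
    different points of [M] may need different [l], and only the union over [l] is shown to be
    dense. *)

Definition cexp x : R[i] := Complex (cos x) (sin x).

Lemma cexpD x y : cexp (x + y) = cexp x * cexp y.
Proof. by rewrite /cexp cosD sinD; apply/eqP; rewrite eq_complex /= eqxx /= addrC (mulrC (sin x)). Qed.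

Lemma cexp0 : cexp 0 = 1.
Proof. by rewrite /cexp cos0 sin0. Qed.

Lemma normc_cexp x : normc (cexp x) = 1.
Proof. by rewrite /normc /= cos2Dsin2 sqrtr1. Qed.

Lemma cexp_sum (I : Type) (s : seq I) (P : pred I) (F : I -> R) :
  cexp (\sum_(i <- s | P i) F i) = \prod_(i <- s | P i) cexp (F i).
Proof. exact: (big_morph cexp cexpD cexp0). Qed.

Lemma Re_sum (I : Type) (s : seq I) (P : pred I) (F : I -> R[i]) :
  complex.Re (\sum_(i <- s | P i) F i) = \sum_(i <- s | P i) complex.Re (F i).
Proof. by apply: (big_morph (@complex.Re R)) => // -[a b] [c d]. Qed.

Lemma Im_sum (I : Type) (s : seq I) (P : pred I) (F : I -> R[i]) :
  complex.Im (\sum_(i <- s | P i) F i) = \sum_(i <- s | P i) complex.Im (F i).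
Proof. by apply: (big_morph (@complex.Im R)) => // -[a b] [c d]. Qed.

Lemma sqr_normc_def (z : R[i]) :
  normc z ^+ 2 = complex.Re z ^+ 2 + complex.Im z ^+ 2.
Proof. by case: z => a b; rewrite /normc /= sqr_sqrtr // addr_ge0 ?sqr_ge0. Qed.

Lemma normc_ge0 (z : R[i]) : 0 <= normc z.
Proof. by case: z => a b; rewrite /normc sqrtr_ge0. Qed.

Lemma normc_sum (I : Type) (s : seq I) (P : pred I) (F : I -> R[i]) :
  normc (\sum_(i <- s | P i) F i) <= \sum_(i <- s | P i) normc (F i).
Proof.
elim/big_rec2: _ => [|i a b _ h]; first by rewrite normc0.
by apply: le_trans (le_normcD _ _) _; rewrite lerD2l.
Qed.

Lemma normc_prod (I : Type) (s : seq I) (P : pred I) (F : I -> R[i]) :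
  normc (\prod_(i <- s | P i) F i) = \prod_(i <- s | P i) normc (F i).
Proof. exact: (big_morph _ (@normcM R) (@normc1 R)). Qed.

Definition dirichlet N t : R[i] := \sum_(j < N) cexp (2 * pi * (j%:R * t)).

Lemma normc_dirichlet_le N t : normc (dirichlet N t) <= N%:R.
Proof.
apply: le_trans (normc_sum _ _ _) _.
rewrite (eq_bigr (fun=> 1)); last by move=> i _; rewrite normc_cexp.
by rewrite sumr_const card_ord.
Qed.

(** Multiplication by [cexp (2 * pi * t) - 1], of modulus [2 * |sin (pi * t)|], telescopes the
    geometric sum to a difference of two unit numbers. *)
Lemma dirichlet_sin N t : normc (dirichlet N t) * `|sin (pi * t)| <= 1.
Proof.
have geo : dirichlet N t * (cexp (2 * pi * t) - 1) = cexp (2 * pi * (N%:R * t)) - 1.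
  rewrite /dirichlet; elim: N => [|N IH].
    by rewrite big_ord0 mul0r mul0r mulr0 cexp0 subrr.
  rewrite big_ord_recr /= mulrDl IH mulrBr mulr1 -cexpD.
  rewrite (_ : 2 * pi * (N%:R * t) + 2 * pi * t = 2 * pi * (N.+1%:R * t)); last first.
    by rewrite -natr1; ring.
  by ring.
have hs : normc (cexp (2 * pi * t) - 1) = 2 * `|sin (pi * t)|.
  apply/eqP; rewrite -(eqrXn2 (n := 2)) ?normc_ge0 ?mulr_ge0 //.
  rewrite sqr_normc_def /= exprMn real_normK ?num_real //.
  rewrite oppr0 addr0.
  have -> : 2 * pi * t = (pi * t) *+ 2 by rewrite -mulr_natl; ring.
  rewrite cos_mulr2n sin_mulr2n.
  have := cos2Dsin2 (pi * t); set c := cos _; set s := sin _ => cs.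
  apply/eqP.
  have -> : c ^+ 2 = 1 - s ^+ 2 by rewrite -cs addrK.
  have -> : (c * s *+ 2) ^+ 2 = 4 * c ^+ 2 * s ^+ 2 by ring.
  by have -> : c ^+ 2 = 1 - s ^+ 2 by [rewrite -cs addrK]; ring.
have : normc (dirichlet N t) * (2 * `|sin (pi * t)|) <= 2.
  rewrite -hs -normcM geo.
  apply: le_trans (le_normcD _ _) _; rewrite normcN normc1 normc_cexp; lra.
by rewrite mulrCA; lra.
Qed.

(** Normalised to maximum 1 instead of mean 1, so that its square is at most itself; for [N > 0] the
    mean over a period is [N^-n]. *)
Definition fejer n N (t : 'rV[R]_n) : R :=
  \prod_(i < n) (normc (dirichlet N (t 0 i)) / N%:R) ^+ 2.

Lemma fejer_factor01 N t : 0 <= (normc (dirichlet N t) / N%:R) ^+ 2 <= 1.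
Proof.
case: N => [|N]; first by rewrite invr0 mulr0 expr0n /= lexx ler01.
have h : 0 <= normc (dirichlet N.+1 t) / N.+1%:R by rewrite divr_ge0 ?normc_ge0.
rewrite exprn_ge0 //= expr_le1 // ler_pdivrMr ?ltr0n // mul1r.
exact: normc_dirichlet_le.
Qed.

Lemma fejer_ge0 n N (t : 'rV[R]_n) : 0 <= fejer N t.
Proof. by apply: prodr_ge0 => i _; case/andP: (fejer_factor01 N (t 0 i)). Qed.

Lemma fejer_le_factor n N (t : 'rV[R]_n) i :
  fejer N t <= (normc (dirichlet N (t 0 i)) / N%:R) ^+ 2.
Proof.
rewrite /fejer (bigD1 i) //= ler_piMr //.
  by case/andP: (fejer_factor01 N (t 0 i)).
suff /andP[] : 0 <= \prod_(i0 < n | i0 != i) (normc (dirichlet N (t 0 i0)) / N%:R) ^+ 2 <= 1 by [].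
apply: (big_ind (fun x : R => 0 <= x <= 1)) => [|x y /andP[x0 x1] /andP[y0 y1]|j _].
- by rewrite ler01 lexx.
- by rewrite mulr_ge0 //= mulr_ile1.
- exact: fejer_factor01.
Qed.

Lemma fejer_far n N (t : 'rV[R]_n) i (A : R) : (0 < N)%N -> 0 < A ->
  A <= N%:R * `|sin (pi * t 0 i)| -> fejer N t <= A ^- 2.
Proof.
move=> N0 A0 hA; apply: le_trans (fejer_le_factor N t i) _.
have N0R : 0 < N%:R :> R by rewrite ltr0n.
rewrite -exprVn; rewrite ler_pXn2r ?nnegrE ?divr_ge0 ?normc_ge0 ?invr_ge0 ?ler0n //; last exact: ltW.
rewrite ler_pdivrMr // mulrC ler_pdivlMr //.
apply: le_trans (_ : normc (dirichlet N (t 0 i)) * (N%:R * `|sin (pi * t 0 i)|) <= _).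
  by rewrite ler_wpM2l ?normc_ge0.
rewrite mulrCA -[leRHS]mulr1 ler_wpM2l ?ler0n //.
exact: dirichlet_sin.
Qed.

Definition frequency n N (u : {ffun 'I_n -> 'I_N}) : 'rV[int]_n :=
  \row_i ((u i : nat)%:Z).

Lemma frequency_inj n N : injective (@frequency n N).
Proof.
move=> u v /rowP e; apply/ffunP => i; have := e i; rewrite !mxE => -[e'].
exact: val_inj.
Qed.

Lemma dotpDl n (x y z : 'rV[R]_n) : dotp (x + y) z = dotp x z + dotp y z.
Proof. by rewrite /dotp -big_split; apply: eq_bigr => i _; rewrite mxE mulrDl. Qed.

Lemma dotpNl n (x z : 'rV[R]_n) : dotp (- x) z = - dotp x z.
Proof. by rewrite /dotp -sumrN; apply: eq_bigr => i _; rewrite mxE mulNr. Qed.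

Lemma dotpBl n (x y z : 'rV[R]_n) : dotp (x - y) z = dotp x z - dotp y z.
Proof. by rewrite dotpDl dotpNl. Qed.

Lemma dotpC n (x y : 'rV[R]_n) : dotp x y = dotp y x.
Proof. by apply: eq_bigr => i _; rewrite mulrC. Qed.

Lemma dotpZl n a (x y : 'rV[R]_n) : dotp (a *: x) y = a * dotp x y.
Proof. by rewrite /dotp mulr_sumr; apply: eq_bigr => i _; rewrite mxE mulrA. Qed.

Lemma dotpDr n (x y z : 'rV[R]_n) : dotp z (x + y) = dotp z x + dotp z y.
Proof. by rewrite dotpC dotpDl !(dotpC z). Qed.

Lemma dotpBr n (x y z : 'rV[R]_n) : dotp z (x - y) = dotp z x - dotp z y.
Proof. by rewrite dotpC dotpBl !(dotpC z). Qed.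

Lemma dotpZr n a (x y : 'rV[R]_n) : dotp x (a *: y) = a * dotp x y.
Proof. by rewrite dotpC dotpZl dotpC. Qed.

Lemma dotp0l n (x : 'rV[R]_n) : dotp 0 x = 0.
Proof. by rewrite /dotp big1 // => i _; rewrite mxE mul0r. Qed.

Definition ivec n (z : 'rV[int]_n) : 'rV[R]_n := map_mx intr z.

Lemma ivecD n (z w : 'rV[int]_n) : ivec (z + w) = ivec z + ivec w.
Proof. exact: map_mxD. Qed.

Lemma ivecB n (z w : 'rV[int]_n) : ivec (z - w) = ivec z - ivec w.
Proof. exact: map_mxB. Qed.

Lemma ivecN n (z : 'rV[int]_n) : ivec (- z) = - ivec z.
Proof. exact: map_mxN. Qed.

Lemma ivec0 n : ivec (0 : 'rV[int]_n) = 0.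
Proof. exact: map_mx0. Qed.

Lemma prod_dirichlet n N (t : 'rV[R]_n) :
  \prod_(i < n) dirichlet N (t 0 i) =
  \sum_(u : {ffun 'I_n -> 'I_N}) cexp (2 * pi * dotp (ivec (frequency u)) t).
Proof.
rewrite /dirichlet bigA_distr_bigA /=; apply: eq_bigr => u _.
rewrite -cexp_sum -mulr_sumr; congr (cexp (_ * _)).
by apply: eq_bigr => i _; rewrite !mxE.
Qed.

(** Exponents are listed with multiplicity. *)
Definition fejer_freqs n N : seq 'rV[int]_n :=
  [seq frequency u - frequency v | u <- enum {ffun 'I_n -> 'I_N},
                                   v <- enum {ffun 'I_n -> 'I_N}].

Definition fejer_freqs2 n N : seq 'rV[int]_n :=
  [seq z + w | z <- fejer_freqs n N, w <- fejer_freqs n N].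

Definition tcos n (z : 'rV[int]_n) (t : 'rV[R]_n) := cos (2 * pi * dotp (ivec z) t).
Definition tsin n (z : 'rV[int]_n) (t : 'rV[R]_n) := sin (2 * pi * dotp (ivec z) t).

Lemma fejer_expand n N (t : 'rV[R]_n) :
  fejer N t = (N%:R ^- (2 * n)) * \sum_(z <- fejer_freqs n N) tcos z t.
Proof.
rewrite /fejer (eq_bigr (fun i => (normc (dirichlet N (t 0 i))) ^+ 2 * N%:R ^- 2)); last first.
  by move=> i _; rewrite exprMn exprVn.
rewrite big_split /= prodr_const card_ord -exprVn -exprM mulrC exprVn; congr (_ * _).
rewrite prodrXl -normc_prod prod_dirichlet sqr_normc_def Re_sum Im_sum /=.
rewrite big_allpairs_dep /= big_enum /= ![in LHS]expr2 !mulr_suml -big_split /=.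
apply: eq_bigr => u _; rewrite big_enum /= ![_ * \sum_(i : {ffun _ -> _}) _]mulr_sumr -big_split /=.
apply: eq_bigr => v _.
by rewrite /tcos ivecB dotpBl [_ * (_ - _)]mulrBr cosB.
Qed.

Lemma fejer_freqs_sym n N (g : 'rV[int]_n -> R) :
  \sum_(z <- fejer_freqs n N) g (- z) = \sum_(z <- fejer_freqs n N) g z.
Proof.
rewrite !big_allpairs_dep /= !big_enum /= .
under eq_bigr do rewrite big_enum /=.
rewrite exchange_big /=; apply: eq_bigr => u _; rewrite big_enum /=.
by apply: eq_bigr => v _; rewrite opprB.
Qed.

(** The frequency list is symmetric, so its sine sum vanishes; subtracting the square of that sum
    from the square of the cosine sum leaves a double sum of [cos (a + b)]. *)
Lemma fejer2_expand n N (t : 'rV[R]_n) :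
  fejer N t ^+ 2 = (N%:R ^- (4 * n)) * \sum_(z <- fejer_freqs2 n N) tcos z t.
Proof.
rewrite fejer_expand exprMn.
have -> : (N%:R ^- (2 * n)) ^+ 2 = N%:R ^- (4 * n) :> R.
  by rewrite -!exprVn -exprM; congr (_ ^+ _); lia.
congr (_ * _).
have sin0 : \sum_(z <- fejer_freqs n N) tsin z t = 0.
  have : \sum_(z <- fejer_freqs n N) tsin z t = - \sum_(z <- fejer_freqs n N) tsin z t.
    rewrite -[LHS]fejer_freqs_sym -sumrN; apply: eq_bigr => z _.
    by rewrite /tsin ivecN dotpNl mulrN sinN.
  lra.
have -> : (\sum_(z <- fejer_freqs n N) tcos z t) ^+ 2 =
    (\sum_(z <- fejer_freqs n N) tcos z t) * (\sum_(z <- fejer_freqs n N) tcos z t) -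
    (\sum_(z <- fejer_freqs n N) tsin z t) * (\sum_(z <- fejer_freqs n N) tsin z t).
  by rewrite sin0 mul0r subr0 expr2.
rewrite !mulr_suml -sumrB [RHS]big_allpairs_dep /=; apply: eq_bigr => z _.
rewrite !mulr_sumr -sumrB; apply: eq_bigr => w _.
by rewrite /tcos /tsin ivecD dotpDl (mulrDr (2 * pi)) cosD.
Qed.

Lemma box_count n (a : 'rV[int]_n) K (s : seq 'rV[int]_n) : uniq s ->
  (forall z, z \in s -> forall i, a 0 i <= z 0 i < a 0 i + K%:Z) ->
  (size s <= K ^ n)%N.
Proof.
move=> us hs.
rewrite -[X in (X ^ n)%N]card_ord -[X in (_ ^ X)%N]card_ord -card_ffun.
rewrite cardE -(size_map (fun u : {ffun 'I_n -> 'I_K} => a + frequency u)).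
apply: uniq_leq_size => // z /hs hz.
have hb i : (`|(z 0 i - a 0 i)%R|%N < K)%N by have := hz i; lia.
apply/mapP; exists [ffun i => Ordinal (hb i)]; first by rewrite mem_enum.
apply/rowP => i; have /andP[h _] := hz i.
by rewrite !mxE ffunE /= gez0_abs ?subr_ge0 // addrC subrK.
Qed.

Lemma count_allpairs (S T : Type) (U : eqType) (f : S -> T -> U) (s : seq S) (t : seq T) (x : U) :
  count_mem x [seq f a b | a <- s, b <- t] = (\sum_(a <- s) count_mem x [seq f a b | b <- t])%N.
Proof. by rewrite count_flatten sumnE -map_comp big_map. Qed.

(** The vectors [u] and [z] determine [v], so [z] has at most one representation for each of the
    [N^n] choices of [u]. *)
Lemma count_fejer_freqs n N z : (count_mem z (fejer_freqs n N) <= N ^ n)%N.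
Proof.
rewrite count_allpairs big_enum /=.
apply: leq_trans (_ : \sum_(u : {ffun 'I_n -> 'I_N}) 1 <= _)%N; last first.
  by rewrite sum1_card card_ffun !card_ord.
apply: leq_sum => u _; rewrite count_uniq_mem ?leq_b1 // map_inj_uniq ?enum_uniq //.
by move=> v w /addrI /oppr_inj /frequency_inj.
Qed.

Lemma size_fejer_freqs n N : size (fejer_freqs n N) = (N ^ (2 * n))%N.
Proof. by rewrite size_allpairs -!cardE card_ffun !card_ord mul2n -addnn expnD. Qed.

Lemma count_mapDl n (z x : 'rV[int]_n) s :
  count_mem x [seq z + w | w <- s] = count_mem (x - z) s.
Proof.
rewrite count_map; apply: eq_count => w /=.
by rewrite [RHS]eq_sym subr_eq addrC eq_sym.
Qed.

Lemma count_fejer_freqs2 n N z : (count_mem z (fejer_freqs2 n N) <= N ^ (3 * n))%N.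
Proof.
rewrite count_allpairs.
apply: leq_trans (_ : \sum_(w <- fejer_freqs n N) N ^ n <= _)%N.
  by apply: leq_sum => w _; rewrite count_mapDl count_fejer_freqs.
rewrite big_const_seq count_predT iter_addn_0 size_fejer_freqs -expnD.
by rewrite (_ : n + 2 * n = 3 * n)%N //; lia.
Qed.

Lemma fejer_freqs_bound n N z i : z \in fejer_freqs n N -> - N%:Z < z 0 i < N%:Z.
Proof.
case/allpairsP => -[u v] /= [_ _ ->]; rewrite !mxE.
move: (ltn_ord (u i)) (ltn_ord (v i)); move: (nat_of_ord (u i)) (nat_of_ord (v i)) => a b.
lia.
Qed.

Lemma fejer_freqs2_bound n N z i : z \in fejer_freqs2 n N -> - (2 * N)%N%:Z < z 0 i < (2 * N)%N%:Z.
Proof.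
case/allpairsP => -[u v] /= [/fejer_freqs_bound - /(_ i) hu /fejer_freqs_bound - /(_ i) hv ->].
have -> : (u + v) 0 i = u 0 i + v 0 i by exact: mxE.
have h (a b : int) : - N%:Z < a < N%:Z -> - N%:Z < b < N%:Z ->
  - (2 * N)%N%:Z < a + b < (2 * N)%N%:Z by lia.
exact: h.
Qed.

Lemma sum_mult (n : nat) (s : seq 'rV[int]_n) (g : 'rV[int]_n -> R) :
  \sum_(z <- s) g z = \sum_(z <- undup s) (count_mem z s)%:R * g z.
Proof.
rewrite -big_undup_iterop_count; apply: eq_bigr => z _.
by rewrite Monoid.iteropE iter_addr_0 mulr_natl.
Qed.

Lemma count_fejer_freqs_opp n N z :
  count_mem (- z) (fejer_freqs n N) = count_mem z (fejer_freqs n N).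
Proof.
apply/eqP; rewrite -(eqr_nat R); apply/eqP.
rewrite -!sum1_count !natr_sum.
rewrite [LHS]big_mkcond /= [RHS]big_mkcond /= -fejer_freqs_sym.
by apply: eq_bigr => w _; rewrite eqr_opp.
Qed.

(** Up to normalisation this is the mean of [F_N^2]. By symmetry it is the sum of the squared
    multiplicities in [fejer_freqs]; these total [N^(2n)] over at most [(2N)^n] frequencies, and
    Cauchy-Schwarz gives the bound. *)
Lemma count0_fejer_freqs2 n N :
  N%:R ^+ (3 * n) / 2 ^+ n <= (count_mem 0 (fejer_freqs2 n N))%:R :> R.
Proof.
case: (posnP N) => [->|N0].
  case: n => [|n]; last by rewrite expr0n mul0r.
  rewrite muln0 !expr0 invr1 mul1r ler1n -has_count has_pred1.
  have z0 : (0 : 'rV[int]_0) \in fejer_freqs 0 0.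
    have e : (0 < #|{ffun 'I_0 -> 'I_0}|)%N by rewrite card_ffun !card_ord.
    apply/allpairsP; move/card_gt0P: e => [u _]; exists (u, u) => /=.
    by rewrite mem_enum; split => //; rewrite subrr.
  by apply/allpairsP; exists (0, 0); rewrite /= addr0.
have N0R : 0 < N%:R :> R by rewrite ltr0n.
rewrite count_allpairs natr_sum.
under eq_bigr do rewrite count_mapDl sub0r count_fejer_freqs_opp.
rewrite sum_mult; set S := undup _.
have hS : \sum_(z <- S) (count_mem z (fejer_freqs n N))%:R = N%:R ^+ (2 * n) :> R.
  rewrite -natrX -size_fejer_freqs -sum1_size natr_sum [RHS]sum_mult.
  by apply: eq_bigr => z _; rewrite mulr1.
have cS : (size S)%:R <= (2 * N%:R) ^+ n :> R.
  rewrite -natrM -natrX ler_nat; apply: (@box_count n (\row_i (- (N%:Z)))).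
    exact: undup_uniq.
  by move=> z; rewrite mem_undup => /fejer_freqs_bound h i; rewrite !mxE; have := h i; lia.
(* The multiplicity averaged over the [(2N)^n] possible frequencies; summing [c^2 >= 2mc - m^2]
   stands in for Cauchy-Schwarz. *)
pose m : R := N%:R ^+ n / 2 ^+ n.
have m0 : 0 <= m by rewrite divr_ge0 ?exprn_ge0 // ltW.
apply: le_trans (_ : \sum_(z <- S) (2 * m * (count_mem z (fejer_freqs n N))%:R - m ^+ 2) <= _); last first.
  by apply: ler_sum => z _; rewrite -subr_ge0; set c := _%:R; rewrite (_ : _ - _ = (c - m) ^+ 2) ?sqr_ge0 //; ring.
rewrite big_split /= -mulr_sumr hS big_const_seq count_predT iter_addr_0.
apply: le_trans (_ : 2 * m * N%:R ^+ (2 * n) - m ^+ 2 * (2 * N%:R) ^+ n <= _); last first.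
  rewrite lerD2l mulNrn lerN2 -[X in X <= _]mulr_natr.
  by rewrite ler_wpM2l ?sqr_ge0.
rewrite /m [(2 * _) ^+ n]exprMn (mulnC 3) (mulnC 2) ![_ ^+ (n * _)]exprM.
have : (2 : R) ^+ n != 0 by rewrite expf_neq0.
move: (N%:R ^+ n) (2 ^+ n) => a b b0.
have -> : 2 * (a / b) * a ^+ 2 - (a / b) ^+ 2 * (b * a) = a ^+ 3 / b by field.
exact: lexx.
Qed.

End Kernel.

(** * Level-m points of the missing digit set *)

Section Words.
Variables (R : realType) (n p : nat) (D : {set 'rV['I_p]_n}).
Hypothesis p2 : (1 < p)%N.
Implicit Types (z v w : 'rV[int]_n) (x y : 'rV[R]_n).

(** Words of length [m] over [D], read as integer vectors in base [p]. *)
Fixpoint words m : seq 'rV[int]_n :=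
  if m is m'.+1 then
    [seq (p ^ m')%:Z *: digitZ d + z | d <- enum D, z <- words m']
  else [:: 0].

Lemma digitZ_bound (d : 'rV['I_p]_n) i : 0 <= digitZ d 0 i < p%:Z.
Proof. by rewrite mxE; have := ltn_ord (d 0 i); lia. Qed.

Lemma digitZ_inj : injective (@digitZ n p).
Proof.
move=> d e /rowP h; apply/rowP => i; have := h i; rewrite !mxE => -[h'].
exact: val_inj.
Qed.

Lemma words_bound m z i : z \in words m -> 0 <= z 0 i < (p ^ m)%:Z.
Proof.
elim: m z => [z|m IH z /=]; first by rewrite inE => /eqP ->; rewrite mxE expn0.
case/allpairsP => -[d y] [/= _ /IH hy ->].
have -> : ((p ^ m)%:Z *: digitZ d + y) 0 i = (p ^ m)%:Z * digitZ d 0 i + y 0 i.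
  by rewrite !mxE.
have := digitZ_bound d i; move: hy; rewrite expnS.
move: (digitZ d 0 i) (y 0 i) => a b; move: (p ^ m)%N => q; nia.
Qed.

Lemma euclid_uniq (q a b c f : int) : 0 <= c < q -> 0 <= f < q ->
  q * a + c = q * b + f -> a = b /\ c = f.
Proof.
move=> hc hf e; suff ab : a = b by split => //; move: e; rewrite ab; lia.
by case: (ltgtP a b) => //; nia.
Qed.

Lemma words_uniq m : uniq (words m).
Proof.
elim: m => //= m IH; apply: allpairs_uniq => //; first exact: enum_uniq.
move=> [d y] [e w] /allpairsP[[d1 y1] [/= _ hy [-> ->]]].
move=> /allpairsP[[e1 w1] [/= _ hw [-> ->]]] /rowP h.
have h1 i : digitZ d1 0 i = digitZ e1 0 i /\ y1 0 i = w1 0 i.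
  have := h i.
  have e0 (a b : 'rV[int]_n) : ((p ^ m)%:Z *: a + b) 0 i = (p ^ m)%:Z * a 0 i + b 0 i.
    by rewrite !mxE.
  rewrite !e0; apply: euclid_uniq; exact: words_bound.
congr pair; first by apply: digitZ_inj; apply/rowP => i; case: (h1 i).
by apply/rowP => i; case: (h1 i).
Qed.

Lemma size_words m : size (words m) = (#|D| ^ m)%N.
Proof. by elim: m => //= m IH; rewrite size_allpairs IH -cardE expnS. Qed.

(** Self-similarity at finite level: the first [k] digits select a piece, the last [m] digits run
    inside it. *)
Lemma sum_wordsD k m (g : 'rV[int]_n -> R) :
  \sum_(z <- words (k + m)) g z =
  \sum_(v <- words k) \sum_(z <- words m) g ((p ^ m)%:Z *: v + z).
Proof.
elim: k g => [|k IH] g /=.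
  by rewrite big_seq1; apply: eq_bigr => z _; rewrite scaler0 add0r.
rewrite !big_allpairs_dep /=; apply: eq_bigr => d _.
rewrite (IH (fun z => g (_ + z))); apply: eq_bigr => v _; apply: eq_bigr => z _.
by rewrite scalerDr scalerA addrA -PoszM -expnD (addnC m).
Qed.

Definition wpoint m z : 'rV[R]_n := p%:R ^- m *: ivec R z.

Let p0 : p%:R != 0 :> R.
Proof. by rewrite pnatr_eq0; lia. Qed.

Let pgt0 : 0 < p%:R :> R.
Proof. by rewrite ltr0n; lia. Qed.

Lemma ivecZ (a : nat) z : ivec R (a%:Z *: z) = a%:R *: ivec R z.
Proof. by apply/rowP => i; rewrite !mxE intrM. Qed.

Lemma wpointD k m v z :
  wpoint (k + m) ((p ^ m)%:Z *: v + z) = wpoint k v + p%:R ^- k *: wpoint m z.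
Proof.
rewrite /wpoint ivecD scalerDr ivecZ !scalerA natrX; congr (_ *: _ + _ *: _).
  by rewrite exprD invfM mulfVK // expf_neq0.
by rewrite exprD invfM.
Qed.

(** [missing_digit_set R D l] is the closure of this set. *)
Definition digit_set l : set 'rV[R]_n := [set x | forall k, (l <= k)%N ->
    exists2 d, d \in D & intpart (p%:R *: fracpart (p%:R ^+ k *: x)) = digitZ d].

Lemma intpartDz x z : intpart (x + ivec R z) = intpart x + z.
Proof. by apply/rowP => i; rewrite !mxE floorDrz ?intrKfloor ?intr_int. Qed.

Lemma fracpartDz x z : fracpart (x + ivec R z) = fracpart x.
Proof.
rewrite /fracpart intpartDz -/(ivec R _) -/(ivec R _) ivecD.
by rewrite opprD addrACA subrr addr0.
Qed.

Lemma fracpart01 x i : 0 <= fracpart x 0 i < 1.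
Proof.
rewrite !mxE; have := ge_floor (x 0 i); have := floorD1_gt (x 0 i).
rewrite intrD /=; lra.
Qed.

Lemma fracpart_id x : (forall i, 0 <= x 0 i < 1) -> fracpart x = x.
Proof.
move=> h; apply/rowP => i; rewrite !mxE.
have /floor_def -> : (0 : int)%:~R <= x 0 i < (0 + 1 : int)%:~R by exact: h.
by rewrite subr0.
Qed.

Lemma digit_set_fracpart l x y : fracpart x = fracpart y ->
  digit_set l x -> digit_set l y.
Proof.
move=> h; have -> : y = x + ivec R (intpart y - intpart x).
  rewrite ivecB; move: h; rewrite /fracpart -!/(ivec R _) => h.
  by rewrite addrCA h addrC subrK.
move=> hx k lk; have [d dD hd] := hx k lk; exists d => //.
by rewrite [_ *: (x + _)]scalerDr -natrX -ivecZ fracpartDz natrX.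
Qed.

Lemma digit_setDz l x z : digit_set l x -> digit_set l (x + ivec R z).
Proof. by apply: digit_set_fracpart; rewrite fracpartDz. Qed.

Lemma digit_set_scale l x : digit_set 0 x -> digit_set l (p%:R ^- l *: x).
Proof.
move=> h k lk; have [d dD hd] := h (k - l)%N isT; exists d => //; rewrite -hd.
congr (intpart (_ *: fracpart _)); rewrite scalerA; congr (_ *: _).
by rewrite -{1}(subnK lk) exprD mulfK // expf_neq0.
Qed.

Lemma digit_set_cons d x : d \in D -> (forall i, 0 <= x 0 i < 1) -> digit_set 0 x ->
  (forall i, 0 <= (p%:R^-1 *: (ivec R (digitZ d) + x)) 0 i < 1) /\
  digit_set 0 (p%:R^-1 *: (ivec R (digitZ d) + x)).
Proof.
move=> dD x01 hx; set y := _ *: _.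
have y01 i : 0 <= y 0 i < 1.
  have /andP[a b] := digitZ_bound d i; have /andP[x0 x1] := x01 i.
  have -> : y 0 i = p%:R^-1 * ((digitZ d 0 i)%:~R + x 0 i) by rewrite !mxE.
  have a' : 0 <= (digitZ d 0 i)%:~R :> R by rewrite ler0z.
  have b' : (digitZ d 0 i)%:~R + 1 <= p%:R :> R.
    by rewrite -[1]/(1%:~R) -intrD -[p%:R]/(p%:Z%:~R) ler_int; move: b; lia.
  rewrite mulr_ge0 ?invr_ge0 ?ler0n ?addr_ge0 //= mulrC ltr_pdivrMr // mul1r; lra.
split=> //; case=> [_|k _].
  exists d => //; rewrite expr0 scale1r fracpart_id // /y scalerA divff // scale1r.
  rewrite addrC intpartDz; suff -> : intpart x = 0 by rewrite add0r.
  apply/rowP => i; rewrite !mxE.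
  by have /floor_def -> : (0 : int)%:~R <= x 0 i < (0 + 1 : int)%:~R by exact: x01.
have [e eD he] := hx k isT; exists e => //; rewrite -he.
rewrite /y [_ *: (_ *: (_ + _))]scalerA exprSr mulfK // [_ *: (_ + _)]scalerDr -natrX -ivecZ addrC fracpartDz.
by rewrite natrX.
Qed.

(** A finite word read as a point ends in zeros, and 0 need not be a digit of [D]; appending the
    expansion of a fixed point [x] of the digit set repairs this. *)
Lemma digit_set_word x m z : (forall i, 0 <= x 0 i < 1) -> digit_set 0 x ->
  z \in words m ->
  (forall i, 0 <= (wpoint m z + p%:R ^- m *: x) 0 i < 1) /\
  digit_set 0 (wpoint m z + p%:R ^- m *: x).
Proof.
move=> x01 hx; elim: m z => [z|m IH z] /=.
  rewrite inE => /eqP ->; rewrite /wpoint ivec0 scaler0 add0r expr0 invr1 scale1r.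
  by [].
case/allpairsP => -[d y] [/= dD /IH [y01 hy] ->]; rewrite mem_enum in dD.
have := digit_set_cons dD y01 hy.
suff -> : p%:R^-1 *: (ivec R (digitZ d) + (wpoint m y + p%:R ^- m *: x)) =
  wpoint m.+1 ((p ^ m)%:Z *: digitZ d + y) + p%:R ^- m.+1 *: x by [].
rewrite -[m.+1]add1n wpointD {2}/wpoint !expr1 addrA scalerDr scalerDr.
by rewrite scalerA exprD expr1 invfM.
Qed.

Lemma digit_set_unit x : digit_set 0 x -> exists y,
  (forall i, 0 <= y 0 i < 1) /\ digit_set 0 y.
Proof.
move=> hx; exists (fracpart x); split; first by move=> i; exact: fracpart01.
have -> : fracpart x = x + ivec R (- intpart x) by rewrite ivecN.
exact: digit_setDz.
Qed.

(** Digits are read off one at a time: multiplying by [p] and dropping the integer part stays in the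
    digit set. *)
Lemma digit_set_prefix x m : (forall i, 0 <= x 0 i < 1) -> digit_set 0 x ->
  exists2 z, z \in words m & forall i, 0 <= (p%:R ^+ m *: x - ivec R z) 0 i < 1.
Proof.
elim: m x => [|m IH] x x01 hx.
  by exists 0; rewrite ?inE // => i; rewrite ivec0 subr0 expr0 scale1r.
have [d dD] := hx 0%N isT; rewrite expr0 scale1r fracpart_id // => hd.
pose y := p%:R *: x - ivec R (digitZ d).
have hy : y = fracpart (p%:R *: x) by rewrite /fracpart hd.
have y01 i : 0 <= y 0 i < 1 by rewrite hy fracpart01.
have hy0 : digit_set 0 y.
  rewrite /y -ivecN; apply: digit_setDz => k _.
  have [e eD he] := hx k.+1 isT; exists e => //.
  by rewrite -he scalerA -exprSr.
have [z zm hz] := IH y y01 hy0.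
exists ((p ^ m)%:Z *: digitZ d + z).
  by apply/allpairsP; exists (d, z); rewrite mem_enum.
move=> i; have -> : p%:R ^+ m.+1 *: x - ivec R ((p ^ m)%:Z *: digitZ d + z) =
  p%:R ^+ m *: y - ivec R z.
  by rewrite ivecD ivecZ natrX /y scalerBr scalerA -exprSr opprD addrA.
exact: hz.
Qed.

(** [v] lies within [A] of [p^k c] modulo [p^k Z^n]. *)
Definition near_word k (c : 'rV[R]_n) (A : nat) v : Prop :=
  exists w : 'rV[int]_n, forall i : 'I_n,
    `|p%:R ^+ k * c 0 i - (v 0 i)%:~R - p%:R ^+ k * (w 0 i)%:~R| <= A%:R.

Lemma count_words_near k (c : 'rV[R]_n) (A : nat) :
  (size [seq v <- words k | `[< near_word k c A v >]] <= (2 * A + 2) ^ n)%N.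
Proof.
have /choice[f hf] : forall v, exists w : 'rV[int]_n, near_word k c A v -> forall i : 'I_n,
    `|p%:R ^+ k * c 0 i - (v 0 i)%:~R - p%:R ^+ k * (w 0 i)%:~R| <= A%:R.
  move=> v; case: (pselect (near_word k c A v)) => [[w hw]|]; first by exists w.
  by exists 0.
(* Adding [p^k w] moves [v] next to [p^k c]. The map stays injective because [v] is recovered as a
   residue modulo [p^k], so a box count applies. *)
pose q v := v + (p ^ k)%:Z *: f v.
rewrite -(size_map q).
apply: (@box_count _ (\row_i (Num.floor (p%:R ^+ k * c 0 i) - A%:Z))).
  rewrite map_inj_in_uniq ?filter_uniq ?words_uniq // => v v'.
  rewrite !mem_filter => /andP[_ hv] /andP[_ hv'] /rowP e.
  apply/rowP => i; have := e i; rewrite !mxE ![v _ _ + _]addrC ![v' _ _ + _]addrC.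
  by move=> /(euclid_uniq (words_bound i hv) (words_bound i hv')) [].
move=> z /mapP[v]; rewrite mem_filter => /andP[/asboolP hP _] -> i.
have := hf v hP i; rewrite /q !mxE.
set r := _ * c 0 i; have := ge_floor r; have := floorD1_gt r.
move: (f v 0 i) (v 0 i) (Num.floor r) => a b fl h1 h2; rewrite -natrX.
rewrite ler_norml => /andP[h3 h4].
have e1 : (p ^ k)%:R * a%:~R = ((p ^ k)%:Z * a)%:~R :> R by rewrite intrM.
have k1 : (b + (p ^ k)%:Z * a)%:~R < (fl + 1 + A%:Z)%:~R + 1 :> R.
  by move: h1 h3 h4; rewrite e1 !intrD /=; set X := (_ * a)%:~R; rewrite -[A%:Z%:~R]/(A%:R); lra.
have k2 : (fl - A%:Z)%:~R <= (b + (p ^ k)%:Z * a)%:~R :> R.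
  by move: h2 h3 h4; rewrite e1 !intrD intrN /=; set X := (_ * a)%:~R; rewrite -[A%:Z%:~R]/(A%:R); lra.
rewrite ler_int in k2; move: k1; rewrite -[1 in X in _ < X -> _]/(1%:~R) -intrD ltr_int.
rewrite k2 /=; move: k2; move: (_ * a) => X; lia.
Qed.

End Words.

(** * The law of the digit series *)

Section RowNorm.
Variables (R : realType) (n : nat).
Implicit Types x y : 'rV[R]_n.

Lemma coord_le_norm x i : `|x 0 i| <= `|x|.
Proof.
rewrite [leRHS]/Num.norm /= mx_normrE; apply/bigmax_geP; right => /=.
by exists (0, i).
Qed.

Lemma row_norm_le x (a : R) : 0 <= a -> (forall i, `|x 0 i| <= a) -> `|x| <= a.
Proof.
move=> a0 h; rewrite [leLHS]/Num.norm /= mx_normrE; apply/bigmax_leP; split => //.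
by move=> [i j] _ /=; rewrite ord1.
Qed.

Lemma continuous_dotpl y : continuous (fun x => dotp x y).
Proof.
apply: continuous_big; first exact: add_continuous.
move=> i _ x; apply: (@cvgMl _ _ (nbhs x)).
exact: coord_continuous.
Qed.

Lemma continuous_borel (f : 'rV[R]_n -> R) : continuous f ->
  measurable_fun setT (f : borelRn R n -> R).
Proof.
move=> /continuousP cf; apply: (measurability _ (RGenOpens.measurableE R)).
move=> _ [_ [a [b ->] <-]]; rewrite setTI.
by apply: sub_sigma_algebra; apply: cf; exact: interval_open.
Qed.

Lemma ler_norm_dotp x y : `|dotp x y| <= `|x| * \sum_(i < n) `|y 0 i|.
Proof.
apply: le_trans (ler_norm_sum _ _ _) _; rewrite mulr_sumr.
by apply: ler_sum => i _; rewrite normrM ler_wpM2r ?coord_le_norm.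
Qed.

End RowNorm.

Section Trig.
Variable R : realType.

Lemma cos_lip (a b : R) : `|cos a - cos b| <= `|a - b|.
Proof.
wlog ab : a b / b <= a.
  move=> h; case: (leP b a) => [|/ltW]; first exact: h.
  by rewrite distrC (distrC a); exact: h.
have [] := @MVT_segment R cos (fun x => - sin x) b a ab.
- by apply: continuous_subspaceT; exact: continuous_cos.
move=> c _ ->; rewrite normrM normrN -[leRHS]mul1r ler_wpM2r //.
exact: sin_max.
Qed.

Lemma sin_lip (a b : R) : `|sin a - sin b| <= `|a - b|.
Proof.
wlog ab : a b / b <= a.
  move=> h; case: (leP b a) => [|/ltW]; first exact: h.
  by rewrite distrC (distrC a); exact: h.
have [] := @MVT_segment R sin cos b a ab.
- by apply: continuous_subspaceT; exact: continuous_sin.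
move=> c _ ->; rewrite normrM -[leRHS]mul1r ler_wpM2r //.
exact: cos_max.
Qed.

Lemma normc_lip (a b c d : R) :
  normc (Complex a b) <= normc (Complex c d) + (`|a - c| + `|b - d|).
Proof.
have -> : Complex a b = Complex c d + (Complex (a - c) 0 + Complex 0 (b - d)).
  by apply/eqP; rewrite eq_complex /=; apply/andP; split; apply/eqP; ring.
apply: le_trans (le_normcD _ _) _; rewrite lerD2l.
apply: le_trans (le_normcD _ _) _.
by rewrite /normc /= !expr0n /= addr0 add0r !sqrtr_sqr.
Qed.

End Trig.

Section Law.
Variables (R : realType) (n p : nat) (D : {set 'rV['I_p]_n}).
Hypothesis p2 : (1 < p)%N.
Notation T := 'rV['I_p]_n.

Fixpoint word_val (s : seq T) : 'rV[R]_n :=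
  if s is t :: s' then p%:R^-1 *: (ivec R (digitZ t) + word_val s') else 0.

Lemma series_word_val (e : nat -> T) m :
  series (fun i => p%:R ^- i.+1 *: map_mx intr (digitZ (e i)) : 'rV[R]_n) m =
  word_val (mkseq e m).
Proof.
rewrite /series /=; elim: m e => [|m IH] e; first by rewrite big_nil.
rewrite big_nat_recl //= expr1 scalerDr /mkseq /=; congr (_ + _).
rewrite (iotaDl 1 0) -map_comp -/(mkseq _ _) -IH scaler_sumr.
by apply: eq_bigr => i _; rewrite scalerA -invfM -exprS.
Qed.

(** Digits outside [D] have probability 0 but may still occur as values, so trajectories are
    enumerated over all of [T]. *)
Fixpoint all_words m : seq (seq T) :=
  if m is m'.+1 then [seq t :: s | t <- enum {: T}, s <- all_words m'] else [:: [::]].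

Lemma mem_all_words s : s \in all_words (size s).
Proof.
elim: s => //= t s IH; apply/allpairsP; exists (t, s) => /=.
by rewrite mem_enum.
Qed.

Lemma all_words_uniq m : uniq (all_words m).
Proof.
elim: m => //= m IH; apply: allpairs_uniq => //; first exact: enum_uniq.
by move=> [a b] [c e] _ _ /= [-> ->].
Qed.

Lemma all_words_size m s : s \in all_words m -> size s = m.
Proof.
by elim: m s => [|m IH] s /=; [rewrite inE => /eqP -> | case/allpairsP => -[a b] [/= _ /IH <- ->]].
Qed.

Lemma sum_all_words m (g : 'rV[R]_n -> R) :
  \sum_(s <- all_words m | all (mem D) s) g (word_val s) =
  \sum_(z <- words D m) g (wpoint R p m z).
Proof.
elim: m g => [|m IH] g.
  by rewrite /= big_cons big_nil /= big_seq1 /wpoint ivec0 scaler0 addr0.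
rewrite /= big_mkcond big_allpairs_dep [RHS]big_allpairs_dep /= big_enum /= big_enum /=.
rewrite [RHS]big_mkcond /=; apply: eq_bigr => t _.
case: ifPn => [tD|tD]; last by rewrite big1 // => s _; rewrite (negbTE tD).
rewrite (eq_bigr (fun z => g (p%:R^-1 *: (ivec R (digitZ t) + wpoint R p m z)))).
  rewrite -(IH (fun x => g (p%:R^-1 *: (ivec R (digitZ t) + x)))).
  by rewrite [RHS]big_mkcond.
move=> z _; have := wpointD R p2 1 m (digitZ t) z; rewrite add1n => ->.
by rewrite {1}/wpoint !expr1 -scalerDr.
Qed.

Variables (disp : measure_display) (Omega : measurableType disp)
  (P : probability Omega R) (d : nat -> Omega -> T).
Hypothesis iid : iid_uniform P D d.

Let p0 : p%:R != 0 :> R.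
Proof. by rewrite pnatr_eq0; lia. Qed.

Let pgt0 : 0 < p%:R :> R.
Proof. by rewrite ltr0n; lia. Qed.

Definition traj m w := mkseq (fun i => d i w) m.

Let t0 : T := const_mx (Ordinal (ltnW p2)).

Lemma traj_eq m s : size s = m ->
  [set w | traj m w = s] =
  \bigcap_(i in [set` [fset i in iota 0 m]%fset]) [set w | d i w = nth t0 s i].
Proof.
move=> sm; apply/seteqP; split=> w /=.
  move=> <- i /=; rewrite inE mem_iota add0n => /andP[_ im].
  by rewrite nth_mkseq.
move=> h; apply: (@eq_from_nth _ t0); rewrite size_mkseq ?sm // => i im.
by rewrite nth_mkseq //; apply: h => /=; rewrite inE mem_iota.
Qed.

Lemma measurable_traj m s : measurable [set w | traj m w = s].
Proof.
have [sm|sm] := eqVneq (size s) m; last first.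
  rewrite (_ : [set w | _] = set0) //; apply/seteqP; split=> w //= h.
  by move: sm; rewrite -h size_mkseq eqxx.
rewrite traj_eq //; apply: fin_bigcap_measurable; first exact: finite_fset.
by move=> i _; case: iid => + _ _; exact.
Qed.

Lemma prob_traj m s : size s = m ->
  P [set w | traj m w = s] = (if all (mem D) s then (#|D|%:R^-1 ^+ m) else 0)%:E.
Proof.
move=> sm; rewrite traj_eq //; case: iid => _ hP hI; rewrite hI.
rewrite (eq_bigr (fun i => if nth t0 s i \in D then #|D|%:R^-1 else 0)); last first.
  by move=> i _; rewrite hP; case: ifP.
rewrite (perm_big (iota 0 m)) /=; last first.
  apply: uniq_perm; rewrite ?fset_uniq ?iota_uniq // => i.
  by rewrite inE.
congr EFin; have {hP hI} : m = size s by rewrite sm.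
move=> ->; have -> : \prod_(i <- iota 0 (size s)) (if nth t0 s i \in D then #|D|%:R^-1 else 0) =
    \prod_(t <- s) (if t \in D then #|D|%:R^-1 else 0) :> R.
  by rewrite [RHS](big_nth t0) /index_iota subn0.
elim: s {sm} => [|t s IH] /=; first by rewrite big_nil expr0.
rewrite big_cons IH; case: ifP => // _; last by rewrite mul0r.
by case: ifP => // _; [rewrite exprS|rewrite mulr0].
Qed.

(** The first [m] digits take finitely many values, so the integral is a finite sum over cylinders;
    those containing a digit outside [D] have probability 0. *)
Lemma Rintegral_traj m (g : 'rV[R]_n -> R) :
  (\int[P]_w g (word_val (traj m w)))%R =
  #|D|%:R ^- m * \sum_(z <- words D m) g (wpoint R p m z).
Proof.
have e w : g (word_val (traj m w)) =
    \sum_(s <- all_words m) g (word_val s) * \1_[set w | traj m w = s] w.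
  have h : traj m w \in all_words m.
    by have := mem_all_words (traj m w); rewrite size_mkseq.
  rewrite (bigD1_seq (traj m w)) ?all_words_uniq //= indicE mem_set //= mulr1.
  rewrite big1 ?addr0 // => s hs; rewrite indicE memNset ?mulr0 //=.
  by move=> h'; rewrite h' eqxx in hs.
rewrite /Rintegral; under eq_integral do rewrite e -sumEFin.
rewrite integral_sum //; last first.
  move=> s; apply: (@measurable_bounded_integrable _ _ _ _ (fun w => g (word_val s) * \1_[set w | traj m w = s] w)) => //.
  - exact: le_lt_trans (probability_le1 P measurableT) (ltry _).
  - apply: measurable_funM => //; apply: measurable_indic; exact: measurable_traj.
  - exists `|g (word_val s)|; split; first by rewrite num_real.
    move=> x xb w _ /=; rewrite normrM.
    apply: le_trans (ltW xb); rewrite -[leRHS]mulr1 ler_wpM2l //.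
    by rewrite indicE; case: (_ \in _); rewrite ?normr1 ?normr0.
rewrite -sum_all_words mulr_sumr [RHS]big_mkcond /= big_seq.
rewrite (eq_bigr (fun s => (if all (mem D) s then #|D|%:R ^- m * g (word_val s) else 0)%:E)).
  by rewrite sumEFin -big_seq.
move=> s hs; rewrite (eq_integral (fun w => (g (word_val s))%:E * (\1_[set w | traj m w = s] w)%:E)%E); last first.
  by move=> w _; rewrite EFinM.
rewrite integralZl //; last first.
  by apply: integrable_indic => //; exact: measurable_traj.
rewrite integral_indic // ?setIT; last exact: measurable_traj.
transitivity ((g (word_val s))%:E * (if all (mem D) s then (#|D|%:R^-1 ^+ m) else 0)%:E)%E.
  by congr (_ * _)%E; exact: (prob_traj (all_words_size hs)).
by case: ifP => _; rewrite -EFinM ?mulr0 // exprVn mulrC.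
Qed.

Lemma word_val_rcons (e : nat -> T) m :
  word_val (mkseq e m.+1) = word_val (mkseq e m) + p%:R ^- m.+1 *: ivec R (digitZ (e m)).
Proof. by rewrite -!series_word_val /series /= big_nat_recr. Qed.

Lemma word_val_cvg (e : nat -> T) : exists2 L : 'rV[R]_n,
  (fun m => word_val (mkseq e m)) @ \oo --> L &
  forall m, `|L - word_val (mkseq e m)| <= p%:R ^- m.
Proof.
pose u i m := word_val (mkseq e m) 0 i.
have pm m : 0 < p%:R ^- m :> R by rewrite invr_gt0 exprn_gt0.
(* Digits are at most [p - 1], so [u + p^-m] is nonincreasing while [u] is nondecreasing: the limit
   is trapped between them. *)
have uS i m : u i m <= u i m.+1 <= u i m + p%:R ^- m - p%:R ^- m.+1.
  have -> : u i m.+1 = u i m + p%:R ^- m.+1 * (digitZ (e m) 0 i)%:~R.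
    by rewrite /u word_val_rcons !mxE.
  have /andP[a b] := digitZ_bound p2 (e m) i.
  have a' : 0 <= (digitZ (e m) 0 i)%:~R :> R by rewrite ler0z.
  have b' : (digitZ (e m) 0 i)%:~R + 1 <= p%:R :> R.
    by rewrite -[1]/(1%:~R) -intrD -[p%:R]/(p%:Z%:~R) ler_int; move: b; lia.
  have c : p%:R ^- m = p%:R ^- m.+1 * p%:R :> R by rewrite exprSr invfM mulfVK.
  by have := pm m.+1; rewrite c; nra.
have mono i : {homo u i : n m / (n <= m)%N >-> n <= m}.
  by apply/nondecreasing_seqP => m; case/andP: (uS i m).
have up i m k : u i (m + k)%N <= u i m + p%:R ^- m - p%:R ^- (m + k).
  elim: k => [|k IH]; first by rewrite addn0; lra.
  by rewrite addnS; have /andP[_] := uS i (m + k)%N; lra.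
have up' i m k : u i k <= u i m + p%:R ^- m.
  have [h|h] := leqP m k.
    by have := up i m (k - m)%N; rewrite subnKC //; have := pm k; lra.
  by have := mono i _ _ (ltnW h); have := pm m; lra.
have cu i : cvgn (u i).
  apply: nondecreasing_is_cvgn => //; exists (u i 0%N + p%:R ^- 0) => _ [k _ <-].
  exact: up'.
pose L : 'rV[R]_n := \row_i limn (u i).
have hL m : `|L - word_val (mkseq e m)| <= p%:R ^- m.
  apply: row_norm_le => [|i]; first exact: ltW.
  rewrite !mxE -/(u i m) ler_norml; apply/andP; split.
    by have := nondecreasing_cvgn_le (@mono i) (cu i) m; have := pm m; lra.
  rewrite lerBlDl; apply: limr_le; first exact: cu.
  by apply: nearW => k; exact: up'.
exists L => //.
apply/cvgrPdist_le => eps eps0.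
have : (fun m => p%:R ^- m : R) @ \oo --> (0 : R).
  under eq_fun do rewrite -exprVn; apply: cvg_expr.
  by rewrite ger0_norm ?invr_ge0 // invf_lt1 // ltr1n.
move=> /cvgrPdist_le /(_ _ eps0); apply: filterS => m.
rewrite sub0r normrN ger0_norm; last exact: ltW.
exact: le_trans (hL m).
Qed.

Lemma digit_series_approx w m :
  `|digit_series R d w - word_val (traj m w)| <= p%:R ^- m.
Proof.
have [L cL hL] := word_val_cvg (fun i => d i w).
suff -> : digit_series R d w = L by exact: hL.
rewrite /digit_series; apply: cvg_lim; first exact: (@norm_hausdorff R 'rV[R]_n).
rewrite (_ : series _ = fun m => word_val (mkseq (fun i => d i w) m)) //.
by apply/funext => k; exact: series_word_val.
Qed.

(** The error after [m] digits is at most [p^-m], so membership in an open set is decided at a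
    finite stage: the preimage is a countable union of cylinders of words whose closed [p^-m]-ball
    lies inside. *)
Lemma measurable_digit_series :
  measurable_fun setT (digit_series R d : Omega -> borelRn R n).
Proof.
apply: (@measurability _ _ Omega (borelRn R n) setT _ (@open 'rV[R]_n)) => // _ [U oU <-]; rewrite setTI.
rewrite (_ : _ @^-1` U = \bigcup_m \bigcup_(s in [set` all_words m])
   (if `[< forall x, `|x - word_val s| <= p%:R ^- m -> U x >] then [set w | traj m w = s] else set0)).
  apply: bigcup_measurable => m _; apply: fin_bigcup_measurable => // s _.
  by case: ifP => // _; exact: measurable_traj.
apply/seteqP; split=> [w /= Uw|w [m _] [s sm]]; last first.
  case: asboolP => // h /= ws; apply: h; rewrite -ws; exact: digit_series_approx.
have := open_nbhs_nbhs (conj oU Uw) => /nbhs_ballP [e /= e0 he].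
have : (fun m => p%:R ^- m : R) @ \oo --> (0 : R).
  under eq_fun do rewrite -exprVn; apply: cvg_expr.
  by rewrite ger0_norm ?invr_ge0 // invf_lt1 // ltr1n.
have e20 : 0 < e / 3 by rewrite divr_gt0.
move=> /cvgrPdist_le /(_ _ e20) [m _ /(_ m (leqnn m)) /=].
rewrite sub0r normrN ger0_norm ?invr_ge0 ?exprn_ge0 // => pm.
exists m => //; exists (traj m w) => /=.
  by have := mem_all_words (traj m w); rewrite size_mkseq.
case: asboolP => // -[] x hx; apply: he; rewrite -ball_normE /ball_ /=.
have := digit_series_approx w m; set S := digit_series _ _ _ => hS.
rewrite (_ : S - x = (S - word_val (traj m w)) - (x - word_val (traj m w))); last first.
  by rewrite opprB addrA subrK.
by apply: le_lt_trans (ler_normB _ _) _; lra.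
Qed.

Variable lam : probability (borelRn R n) R.
Hypothesis hlam : forall A : set (borelRn R n), measurable A ->
      lam A = P [set w | A (digit_series R d w)].

Lemma Rintegral_law_approx (g : 'rV[R]_n -> R) (L B : R) m : continuous g ->
  (forall x, `|g x| <= B) -> (forall x y, `|g x - g y| <= L * `|x - y|) -> 0 <= L ->
  `|(\int[lam]_x g x)%R - #|D|%:R ^- m * \sum_(z <- words D m) g (wpoint R p m z)|
    <= L * p%:R ^- m.
Proof.
move=> cg gB gL L0.
have mg : measurable_fun setT (g : borelRn R n -> R) by exact: continuous_borel.
have mS := measurable_digit_series.
have iS : P.-integrable setT (EFin \o (fun w => g (digit_series R d w))).
  apply: measurable_bounded_integrable => //.
  - exact: le_lt_trans (probability_le1 P measurableT) (ltry _).
  - exact: measurableT_comp mg mS.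
  - by exists B; split; rewrite ?num_real // => x Bx w _ /=; exact: le_trans (gB _) (ltW Bx).
have -> : (\int[lam]_x g x)%R = (\int[P]_w g (digit_series R d w))%R.
  rewrite /Rintegral; congr fine.
  rewrite (@eq_measure_integral _ _ _ setT (pushforward P (digit_series R d : Omega -> borelRn R n))); last first.
    by move=> A mA _; exact: hlam.
  rewrite (integral_pushforward mS) //.
  by apply: measurableT_comp.
rewrite -Rintegral_traj.
have iT : P.-integrable setT (EFin \o (fun w => g (word_val (traj m w)))).
  apply: measurable_bounded_integrable => //.
  - exact: le_lt_trans (probability_le1 P measurableT) (ltry _).
  - move=> _ Y mY; rewrite setTI.
    rewrite (_ : _ @^-1` Y = \bigcup_(s in [set` all_words m])
       (if `[< Y (g (word_val s)) >] then [set w | traj m w = s] else set0)).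
      by apply: fin_bigcup_measurable => // s _; case: ifP => // _; exact: measurable_traj.
    apply/seteqP; split => [w /= h|w [s _]].
      exists (traj m w) => /=.
        by have := mem_all_words (traj m w); rewrite size_mkseq.
      by case: asboolP.
    by case: asboolP => // h /= ws; rewrite /preimage /= ws.
  - by exists B; split; rewrite ?num_real // => x Bx w _ /=; exact: le_trans (gB _) (ltW Bx).
rewrite -RintegralB //.
have iD : P.-integrable setT
    (EFin \o (fun w => g (digit_series R d w) - g (word_val (traj m w)))).
  exact: (integrableB measurableT iS iT).
apply: le_trans (le_normr_Rintegral measurableT iD) _.
have -> : L * p%:R ^- m = (\int[P]_(w in setT) (L * p%:R ^- m))%R.
  rewrite Rintegral_cst // [X in fine X](_ : _ = 1%E) ?mulr1 //.
  exact: probability_setT.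
apply: le_Rintegral => //.
- exact: (integrable_abse iD).
- apply: measurable_bounded_integrable => //.
  + exact: le_lt_trans (probability_le1 P measurableT) (ltry _).
  + exists (L * p%:R ^- m); split; rewrite ?num_real // => x Bx w _ /=.
    by rewrite ger0_norm ?mulr_ge0 ?invr_ge0 ?exprn_ge0 // ltW.
- move=> w _; apply: le_trans (gL _ _) _; rewrite ler_wpM2l //.
  exact: digit_series_approx.
Qed.

End Law.

Section LawFourier.
Variables (R : realType) (n p : nat) (D : {set 'rV['I_p]_n}).
Hypothesis p2 : (1 < p)%N.

Definition word_avg m (g : 'rV[R]_n -> R) : R :=
  #|D|%:R ^- m * \sum_(z <- words D m) g (wpoint R p m z).

Definition word_hat m (xi : 'rV[R]_n) : R :=
  normc (Complex (word_avg m (fun x => cos (2 * pi * dotp x xi)))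
                 (- word_avg m (fun x => sin (2 * pi * dotp x xi)))).

(** Transfers bounds on the transform of [lam] to the level-[m] points. The error is the Lipschitz
    constant of the phase times [p^-m], once for the cosine and once for the sine; it grows with
    [xi], which forces [m] to be chosen after the range of frequencies. *)
Lemma word_hat_law (lam : probability (borelRn R n) R) : missing_digit_law D lam ->
  forall m xi, word_hat m xi <=
    normc (fourier lam (cst 1) xi) + 4 * pi * (\sum_(i < n) `|xi 0 i|) * p%:R ^- m.
Proof.
move=> [disp [W [P [d [iid hlam]]]]] m xi.
set L := 2 * pi * \sum_(i < n) `|xi 0 i|.
have pi0 := @pi_ge0 R.
have L0 : 0 <= L by rewrite mulr_ge0 ?sumr_ge0 ?mulr_ge0.
have dl x y : `|2 * pi * dotp x xi - 2 * pi * dotp y xi| <= L * `|x - y|.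
  rewrite -mulrBr -dotpBl normrM ger0_norm ?mulr_ge0 // /L -mulrA ler_wpM2l ?mulr_ge0 //.
  by rewrite mulrC; exact: ler_norm_dotp.
have cont (f : R -> R) : continuous f -> continuous (fun x : 'rV[R]_n => f (2 * pi * dotp x xi)).
  move=> cf x; apply: continuous_comp; last exact: cf.
  apply: (@cvgMr _ _ (nbhs x)); exact: continuous_dotpl.
have lc := Rintegral_law_approx p2 iid hlam m (cont _ (@continuous_cos R))
  (fun x => cos_max _) (fun x y => le_trans (cos_lip _ _) (dl x y)) L0.
have ls := Rintegral_law_approx p2 iid hlam m (cont _ (@continuous_sin R))
  (fun x => sin_max _) (fun x y => le_trans (sin_lip _ _) (dl x y)) L0.
apply: le_trans (normc_lip _ _ (\int[lam]_(x in setT) (cst 1 x * cos (2 * pi * dotp x xi)))%R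
  (- \int[lam]_(x in setT) (cst 1 x * sin (2 * pi * dotp x xi)))%R) _.
rewrite -/(fourier lam (cst 1) xi) lerD2l.
have -> : 4 * pi * (\sum_(i < n) `|xi 0 i|) * p%:R ^- m = L * p%:R ^- m + L * p%:R ^- m.
  by rewrite /L; ring.
apply: lerD; first by rewrite distrC; under eq_Rintegral do rewrite mul1r.
rewrite opprK addrC.
by under eq_Rintegral do rewrite mul1r.
Qed.

End LawFourier.

(** * Integration against phi mu *)

Section Pairing.
Variables (R : realType) (n : nat) (mu : {measure set (borelRn R n) -> \bar R}).
Variables (M : set 'rV[R]_n) (phi : 'rV[R]_n -> R).
Hypothesis cphi : continuous phi.
Hypothesis phi0 : forall x, 0 <= phi x.
Hypothesis phiB : forall x, phi x <= 1.
Hypothesis mu_tsupp : (mu (tsupp phi) < +oo)%E.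
Hypothesis mM : measurable (M : set (borelRn R n)).
Hypothesis muM : mu (~` M) = 0%E.

Definition adm (g : 'rV[R]_n -> R) : Prop :=
  continuous g /\ exists B : R, forall x, `|g x| <= B.

Lemma closed_borel (A : set 'rV[R]_n) : closed A -> measurable (A : set (borelRn R n)).
Proof.
move=> cA; rewrite -[A]setCK; apply: measurableC.
by apply: sub_sigma_algebra; exact: closed_openC.
Qed.

Lemma open_borel (A : set 'rV[R]_n) : open A -> measurable (A : set (borelRn R n)).
Proof. by move=> oA; exact: sub_sigma_algebra. Qed.

Lemma phi_out x : ~ tsupp phi x -> phi x = 0.
Proof.
move=> h; apply/eqP/negP => /negP h'; apply: h; exact: subset_closure.
Qed.

Lemma adm_integrable g : adm g -> mu.-integrable setT (EFin \o (fun x => phi x * g x)).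
Proof.
move=> [cg [B gB]].
have mt : measurable (tsupp phi : set (borelRn R n)) by apply: closed_borel; exact: closed_closure.
have B0 : 0 <= B by apply: le_trans (gB 0).
apply: (@le_integrable _ (borelRn R n) _ mu _ measurableT _ (EFin \o (fun x : borelRn R n => B * \1_(tsupp phi) x))).
- apply/measurable_EFinP; apply: measurable_funM; exact: continuous_borel.
- move=> x _ /=; rewrite lee_fin normrM [leRHS]ger0_norm; last first.
    by rewrite mulr_ge0 // indicE.
  have [h|h] := pselect (tsupp phi x).
    rewrite indicE mem_set // mulr1 -[leRHS]mul1r ler_pM // ger0_norm //.
  by rewrite phi_out // normr0 mul0r indicE memNset // mulr0.
- rewrite (_ : _ \o _ = (fun x => B%:E * (\1_(tsupp phi) x)%:E)%E); last first.
    by apply/funext => x /=; rewrite EFinM.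
  apply: (@integrableZl _ (borelRn R n) R mu setT measurableT); apply/integrableP; split.
    by apply/measurable_EFinP; exact: measurable_indic.
  under eq_integral do rewrite gee0_abs ?lee_fin //.
  by rewrite integral_indic // setIT.
Qed.

Definition pairing g : R := (\int[mu]_(x in setT) (phi x * g x))%R.

Lemma adm_cst c : adm (fun=> c).
Proof. by split; [exact: cst_continuous|exists `|c|]. Qed.

Lemma admM f g : adm f -> adm g -> adm (fun x => f x * g x).
Proof.
move=> [cf [a fa]] [cg [b gb]]; split; first by move=> x; exact: (@cvgM _ _ (nbhs x) _ f g _ _ (cf x) (cg x)).
by exists (a * b) => x; rewrite normrM ler_pM.
Qed.

Lemma admD f g : adm f -> adm g -> adm (fun x => f x + g x).
Proof.
move=> [cf [a fa]] [cg [b gb]]; split; first by move=> x; exact: (@cvgD _ _ _ (nbhs x) _ f g _ _ (cf x) (cg x)).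
by exists (a + b) => x; apply: le_trans (ler_normD _ _) _; rewrite lerD.
Qed.

Lemma adm_sum (T : Type) (s : seq T) (P : pred T) (g : T -> 'rV[R]_n -> R) :
  (forall i, adm (g i)) -> adm (fun x => \sum_(i <- s | P i) g i x).
Proof.
move=> h; elim: s => [|i s IH].
  by under eq_fun do rewrite big_nil; exact: adm_cst.
under eq_fun do rewrite big_cons; case: (P i) => //.
exact: admD.
Qed.

(** [mu] is carried by [M] and [phi] by its support, so only points of [M] in that support need
    comparing: this is how a positive mean yields information about points of [M]. *)
Lemma pairing_le f g : adm f -> adm g -> (forall x, M x -> tsupp phi x -> f x <= g x) ->
  pairing f <= pairing g.
Proof.
move=> af ag fg; rewrite /pairing /Rintegral.
have mM' : measurable (~` M : set (borelRn R n)) by apply: measurableC.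
rewrite (negligible_integral mM' measurableT (adm_integrable af) muM).
rewrite (negligible_integral mM' measurableT (adm_integrable ag) muM).
rewrite setTD setCK; apply: le_Rintegral => //.
- by apply: integrableS (adm_integrable af).
- by apply: integrableS (adm_integrable ag).
move=> x Mx; have [h|h] := pselect (tsupp phi x).
  by rewrite ler_wpM2l // fg.
by rewrite phi_out // !mul0r.
Qed.

Lemma pairingD f g : adm f -> adm g -> pairing (fun x => f x + g x) = pairing f + pairing g.
Proof.
move=> af ag; rewrite /pairing -RintegralD //; try exact: adm_integrable.
by apply: eq_Rintegral => x _; rewrite mulrDr.
Qed.

Lemma pairingZ c f : adm f -> pairing (fun x => c * f x) = c * pairing f.
Proof.
move=> af; rewrite /pairing -RintegralZl //; last exact: adm_integrable.
by apply: eq_Rintegral => x _; rewrite mulrCA.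
Qed.

Lemma pairing_sum (T : Type) (s : seq T) (g : T -> 'rV[R]_n -> R) :
  (forall i, adm (g i)) ->
  pairing (fun x => \sum_(i <- s) g i x) = \sum_(i <- s) pairing (g i).
Proof.
move=> h; elim: s => [|i s IH].
  rewrite big_nil; under [LHS]eq_Rintegral do rewrite big_nil mulr0.
  by rewrite Rintegral_cst // mul0r.
under [LHS]eq_Rintegral do rewrite big_cons.
by rewrite -/(pairing (fun x => g i x + _)) pairingD ?IH ?big_cons //; exact: adm_sum.
Qed.

Lemma continuous_phase q (zeta : 'rV[R]_n) (y : 'rV[R]_n) :
  continuous (fun x : 'rV[R]_n => 2 * pi * dotp zeta (q *: x - y)).
Proof.
rewrite (_ : (fun x => _) = (fun x => 2 * pi * q * dotp x zeta - 2 * pi * dotp y zeta)).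
  move=> x; apply: (@cvgB _ _ _ (nbhs x)); last exact: cvg_cst.
  apply: (@cvgMr _ _ (nbhs x)); exact: continuous_dotpl.
by apply/funext => x; rewrite dotpBr dotpZr dotpC (dotpC zeta y); ring.
Qed.

Lemma adm_cos q (zeta y : 'rV[R]_n) :
  adm (fun x => cos (2 * pi * dotp zeta (q *: x - y))).
Proof.
split; last by exists 1 => x; exact: cos_max.
move=> x; apply: continuous_comp; [exact: continuous_phase|exact: continuous_cos].
Qed.

Lemma adm_sin q (zeta y : 'rV[R]_n) :
  adm (fun x => sin (2 * pi * dotp zeta (q *: x - y))).
Proof.
split; last by exists 1 => x; exact: sin_max.
move=> x; apply: continuous_comp; [exact: continuous_phase|exact: continuous_sin].
Qed.

Lemma adm_tcos q (z : 'rV[int]_n) (y : 'rV[R]_n) : adm (fun x => tcos z (q *: x - y)).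
Proof. exact: adm_cos. Qed.

Lemma adm_fejer N q (y : 'rV[R]_n) : adm (fun x => fejer N (q *: x - y)).
Proof.
under eq_fun do rewrite fejer_expand.
by apply: admM; [exact: adm_cst|apply: adm_sum => z; exact: adm_tcos].
Qed.

Lemma adm_fejer2 N q (y : 'rV[R]_n) : adm (fun x => fejer N (q *: x - y) ^+ 2).
Proof. by under eq_fun do rewrite expr2; apply: admM; exact: adm_fejer. Qed.

Variables (Y : seq 'rV[R]_n) (w : R).
Hypothesis w0 : 0 <= w.

(** Modulus of the Fourier transform of the measure with mass [w] at each entry of [Y]. *)
Definition cloud_hat (xi : 'rV[R]_n) : R :=
  normc (Complex (w * \sum_(y <- Y) cos (2 * pi * dotp y xi))
                 (- (w * \sum_(y <- Y) sin (2 * pi * dotp y xi)))).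

Lemma cauchy_schwarz2 (a b c d : R) :
  `|a * c + b * d| <= normc (Complex a b) * normc (Complex c d).
Proof.
rewrite -(@ler_pXn2r _ 2) ?nnegrE ?mulr_ge0 ?normc_ge0 //.
rewrite real_normK ?num_real // exprMn !sqr_normc_def /=.
rewrite -subr_ge0 (_ : _ - _ = (a * d - b * c) ^+ 2) ?sqr_ge0 //; ring.
Qed.

(** The addition formula separates [x] from [y]: the pairing is the real part of one transform times
    the conjugate of the other. *)
Lemma pairing_tcos q (z : 'rV[int]_n) :
  `|pairing (fun x => w * \sum_(y <- Y) tcos z (q *: x - y))| <=
  normc (fourier mu phi (q *: ivec R z)) * cloud_hat (ivec R z).
Proof.
pose c x := cos (2 * pi * dotp x (q *: ivec R z)).
pose s x := sin (2 * pi * dotp x (q *: ivec R z)).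
have ac : adm c.
  have := adm_cos q (ivec R z) 0; rewrite (_ : (fun x => _) = c) //.
  by apply/funext => x; rewrite subr0 dotpC dotpZl -dotpZr.
have as' : adm s.
  have := adm_sin q (ivec R z) 0; rewrite (_ : (fun x => _) = s) //.
  by apply/funext => x; rewrite subr0 dotpC dotpZl -dotpZr.
set C := w * \sum_(y <- Y) cos (2 * pi * dotp y (ivec R z)).
set S := w * \sum_(y <- Y) sin (2 * pi * dotp y (ivec R z)).
have -> : pairing (fun x => w * \sum_(y <- Y) tcos z (q *: x - y)) =
    pairing c * C + (- pairing s) * (- S).
  rewrite mulrNN (mulrC _ C) (mulrC _ S) -!pairingZ // -pairingD; last 2 first.
  - exact: (admM (adm_cst C) ac).
  - exact: (admM (adm_cst S) as').
  congr pairing; apply/funext => x.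
  rewrite /C /S -!mulrA -mulrDr; congr (w * _).
  rewrite !mulr_suml -big_split /=; apply: eq_bigr => y _.
  rewrite /tcos dotpBr mulrBr cosB (dotpC _ y) (dotpC _ (q *: x)) dotpZl -dotpZr.
  by rewrite mulrC (mulrC (sin _)).
exact: cauchy_schwarz2.
Qed.

Let adm_cloud q z : adm (fun x => w * \sum_(y <- Y) tcos z (q *: x - y)).
Proof.
by apply: admM; [exact: adm_cst|apply: adm_sum => y; exact: adm_tcos].
Qed.

Lemma pairing_trig q (kappa : R) (Z : seq 'rV[int]_n) :
  pairing (fun x => w * \sum_(y <- Y) (kappa * \sum_(z <- Z) tcos z (q *: x - y))) =
  kappa * \sum_(z <- Z) pairing (fun x => w * \sum_(y <- Y) tcos z (q *: x - y)).
Proof.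
rewrite -pairing_sum // -pairingZ; last by apply: adm_sum => z; exact: adm_cloud.
congr pairing; apply/funext => x.
rewrite -!mulr_sumr mulrCA; congr (kappa * (w * _)).
exact: exchange_big.
Qed.

(** Each frequency occurs at most [N^n] times and the prefactor is [N^(-2n)], so every Fourier
    coefficient of the kernel is at most [N^-n]. *)
Lemma pairing_fejer_le q N : (0 < N)%N ->
  pairing (fun x => w * \sum_(y <- Y) fejer N (q *: x - y)) <=
  N%:R ^- n * \sum_(z <- undup (fejer_freqs n N))
     normc (fourier mu phi (q *: ivec R z)) * cloud_hat (ivec R z).
Proof.
move=> N0; have N0R : 0 < N%:R :> R by rewrite ltr0n.
under [X in X <= _]eq_Rintegral do under eq_bigr do rewrite fejer_expand.
rewrite -/(pairing (fun x => w * \sum_(y <- Y) _)) pairing_trig.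
rewrite sum_mult.
have -> : N%:R ^- (2 * n) = N%:R ^- n / N%:R ^+ n :> R.
  by rewrite mul2n -addnn exprD invfM.
rewrite -mulrA ler_wpM2l ?invr_ge0 ?exprn_ge0 ?ler0n // mulrC ler_pdivrMr ?exprn_gt0 //.
rewrite mulr_suml; apply: ler_sum => z _; rewrite mulrC.
apply: le_trans (_ : `|pairing (fun x => w * \sum_(y <- Y) tcos z (q *: x - y))| * N%:R ^+ n <= _).
  apply: le_trans (_ : `|pairing (fun x => w * \sum_(y <- Y) tcos z (q *: x - y))| * (count_mem z (fejer_freqs n N))%:R <= _).
    by rewrite ler_wpM2r ?ler_norm.
  by rewrite ler_wpM2l // -natrX ler_nat count_fejer_freqs.
by rewrite ler_wpM2r ?exprn_ge0 ?ler0n // pairing_tcos.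
Qed.

(** The coefficients of [F_N^2] are at most [N^-n] and the constant one is at least [(2N)^-n]; the
    zero frequency is estimated from below, the others are counted as losses. *)
Lemma pairing_fejer2_ge q N : (0 < N)%N ->
  N%:R ^- n * (2 ^- n * pairing (cst 1) * (w * (size Y)%:R) -
    \sum_(z <- undup (fejer_freqs2 n N) | z != 0)
       normc (fourier mu phi (q *: ivec R z)) * cloud_hat (ivec R z)) <=
  pairing (fun x => w * \sum_(y <- Y) fejer N (q *: x - y) ^+ 2).
Proof.
move=> N0; have N0R : 0 < N%:R :> R by rewrite ltr0n.
under [X in _ <= X]eq_Rintegral do under eq_bigr do rewrite fejer2_expand.
rewrite -/(pairing (fun x => w * \sum_(y <- Y) _)) pairing_trig sum_mult.
have pw : 0 <= pairing (cst 1) * (w * (size Y)%:R).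
  rewrite mulr_ge0 ?mulr_ge0 ?ler0n //.
  by apply: Rintegral_ge0 => x _; rewrite mulr1.
have z0 : (0 < N%:R ^+ (3 * n) / 2 ^+ n :> R) by rewrite divr_gt0 ?exprn_gt0.
have h0 : 0 \in undup (fejer_freqs2 n N).
  rewrite mem_undup -has_pred1 has_count -(ltr_nat R).
  exact: lt_le_trans z0 (count0_fejer_freqs2 _ _ _).
have -> : N%:R ^- (4 * n) = N%:R ^- n / N%:R ^+ (3 * n) :> R.
  by rewrite -invfM -exprD; congr (_ ^- _); lia.
rewrite -[leRHS]mulrA ler_wpM2l ?invr_ge0 ?exprn_ge0 ?ler0n // [leRHS]mulrC.
rewrite ler_pdivlMr ?exprn_gt0 // [leRHS](bigD1_seq 0) ?undup_uniq // mulrBl; apply: lerD.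
  have -> : pairing (fun x => w * \sum_(y <- Y) tcos 0 (q *: x - y)) =
      pairing (cst 1) * (w * (size Y)%:R).
    rewrite mulrC -pairingZ; last exact: adm_cst.
    congr pairing; apply/funext => x; rewrite mulr1; congr (w * _).
    rewrite (eq_bigr (fun=> 1)); last by move=> y _; rewrite /tcos ivec0 dotp0l mulr0 cos0.
    by rewrite big_const_seq count_predT iter_addr_0.
  rewrite -[2 ^- n * _ * _]mulrA mulrAC ler_wpM2r // mulrC.
  exact: count0_fejer_freqs2.
rewrite -mulNr -sumrN mulr_suml; apply: ler_sum => z _.
set X := pairing _; set V := normc _ * _.
have hX : `|X| <= V by exact: pairing_tcos.
have V0 : 0 <= V by apply: le_trans hX.
rewrite mulNr -[leRHS]opprK lerN2 -mulrN.
apply: le_trans (_ : (count_mem z (fejer_freqs2 n N))%:R * V <= _).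
  by rewrite ler_wpM2l ?ler0n // (le_trans _ hX) // -normrN ler_norm.
by rewrite mulrC ler_wpM2l // -natrX ler_nat count_fejer_freqs2.
Qed.

Lemma normc_le_abs (a b : R) : normc (Complex a b) <= `|a| + `|b|.
Proof. by have := normc_lip a b 0 0; rewrite !subr0 /normc /= !expr0n /= addr0 sqrtr0 add0r. Qed.

Lemma cloud_hat_le xi : cloud_hat xi <= 2 * (w * (size Y)%:R).
Proof.
have h (f : R -> R) : (forall t, `|f t| <= 1) ->
    `|w * \sum_(y <- Y) f (2 * pi * dotp y xi)| <= w * (size Y)%:R.
  move=> f1; rewrite normrM ger0_norm // ler_wpM2l // (le_trans (ler_norm_sum _ _ _)) //.
  rewrite -sum1_size natr_sum; exact: ler_sum.
apply: le_trans (normc_le_abs _ _) _.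
rewrite normrN (_ : 2 * (w * (size Y)%:R) = w * (size Y)%:R + w * (size Y)%:R); last by ring.
by apply: lerD; apply: h; [exact: cos_max|exact: sin_max].
Qed.

Lemma normc_fourier_le xi : normc (fourier mu phi xi) <= 2 * pairing (cst 1).
Proof.
have h g : adm g -> (forall x, `|g x| <= 1) -> `|pairing g| <= pairing (cst 1).
  move=> ag g1; have c1 : adm (cst 1) by exact: adm_cst.
  rewrite ler_norml; apply/andP; split.
    rewrite -mulN1r -pairingZ //; apply: pairing_le => //.
      exact: (admM (adm_cst (-1)) c1).
    by move=> x _ _; have := g1 x; rewrite ler_norml mulN1r => /andP[].
  by apply: pairing_le => // x _ _; have := g1 x; rewrite ler_norml => /andP[].
apply: le_trans (normc_le_abs _ _) _.
rewrite normrN (_ : 2 * pairing (cst 1) = pairing (cst 1) + pairing (cst 1)); last by ring.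
have e x : 2 * pi * dotp x xi = 2 * pi * dotp xi (1 *: x - 0).
  by rewrite subr0 scale1r dotpC.
apply: lerD; (apply: h => [|x]; [under eq_fun do rewrite e|]).
- exact: adm_cos.
- exact: cos_max.
- exact: adm_sin.
- exact: sin_max.
Qed.

End Pairing.

Section WordCloud.
Variables (R : realType) (n p : nat) (D : {set 'rV['I_p]_n}).

Lemma cloud_hat_words m (xi : 'rV[R]_n) :
  cloud_hat [seq wpoint R p m z | z <- words D m] (#|D|%:R ^- m) xi = word_hat D m xi.
Proof. by rewrite /cloud_hat /word_hat /word_avg !big_map. Qed.

(** Translating the points only multiplies the transform by a unit complex number; hence bounds for
    a piece will not depend on which piece it is. *)
Lemma cloud_hat_shift (Y : seq 'rV[R]_n) (w b : R) (a xi : 'rV[R]_n) :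
  cloud_hat [seq a + b *: y | y <- Y] w xi = cloud_hat Y w (b *: xi).
Proof.
rewrite /cloud_hat !big_map.
pose t := 2 * pi * dotp a xi.
have e y : 2 * pi * dotp (a + b *: y) xi = t + 2 * pi * dotp y (b *: xi).
  by rewrite dotpDl dotpZl -dotpZr mulrDr.
have -> : \sum_(y <- Y) cos (2 * pi * dotp (a + b *: y) xi) =
    cos t * (\sum_(y <- Y) cos (2 * pi * dotp y (b *: xi))) -
    sin t * (\sum_(y <- Y) sin (2 * pi * dotp y (b *: xi))).
  by rewrite !mulr_sumr -sumrB; apply: eq_bigr => y _; rewrite e cosD.
have -> : \sum_(y <- Y) sin (2 * pi * dotp (a + b *: y) xi) =
    sin t * (\sum_(y <- Y) cos (2 * pi * dotp y (b *: xi))) +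
    cos t * (\sum_(y <- Y) sin (2 * pi * dotp y (b *: xi))).
  by rewrite !mulr_sumr -big_split; apply: eq_bigr => y _; rewrite e sinD.
set C := \sum_(y <- Y) cos _; set S := \sum_(y <- Y) sin _.
rewrite -[RHS]mul1r -(normc_cexp (- t)) -normcM /cexp cosN sinN.
move: (cos t) (sin t) => ct st.
congr normc; apply/eqP; rewrite eq_complex /=; apply/andP; split; apply/eqP; ring.
Qed.

End WordCloud.

(** * Dyadic summation *)

Section Shells.
Variable R : realType.
Implicit Types (a e sigma C Q : R).

Lemma powR_exprn a e j : 0 <= a -> (a ^+ j) `^ e = (a `^ e) ^+ j.
Proof.
move=> a0; rewrite -powR_mulrn // -powRrM mulrC powRrM powR_mulrn //.
exact: powR_ge0.
Qed.

Lemma powRV a e : 0 <= a -> a^-1 `^ e = a `^ (- e).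
Proof. by move=> a0; rewrite -(powR_inv1 a0) -powRrM mulN1r. Qed.

Lemma powR_exprV a e j : 0 <= a -> (a ^- j) `^ e = (a `^ (- e)) ^+ j.
Proof.
by move=> a0; rewrite -(powR_inv1 (exprn_ge0 j a0)) -powRrM mulN1r powR_exprn.
Qed.

Lemma powRD_gt0 a e sigma : 0 < a -> a `^ (e + sigma) = a `^ e * a `^ sigma.
Proof. by move=> a0; rewrite powRD // (gt_eqF a0) implybT. Qed.

Lemma powR2_lt1 e : e < 0 -> 2 `^ e < 1 :> R.
Proof.
move=> e0; have l2 : 0 < ln 2 :> R by rewrite ln_gt0 // ltr1n.
by rewrite /powR gt_eqF // -[X in _ < X]expR0 ltr_expR nmulr_rlt0.
Qed.

Lemma powR_ge1 a e : 1 <= a -> 0 <= e -> 1 <= a `^ e.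
Proof. by move=> a1 e0; rewrite -[X in X <= _](powRr0 a); exact: ler_powR. Qed.

Lemma powR_le1 a e : 1 <= a -> e <= 0 -> a `^ e <= 1.
Proof. by move=> a1 e0; rewrite -[X in _ <= X](powRr0 a); exact: ler_powR. Qed.

Lemma geo_sum_le (q : R) J : 0 <= q -> q < 1 -> \sum_(j < J) q ^+ j <= (1 - q)^-1.
Proof.
move=> q0 q1; have h : 0 < 1 - q by rewrite subr_gt0.
rewrite -[leRHS]mul1r ler_pdivlMr // mulrC.
by have := subrX1 q J; have := exprn_ge0 J q0; lra.
Qed.

Lemma exists_pow2 (x : R) : exists J, x < 2 ^+ J.
Proof.
exists (Num.bound `|x|); apply: le_lt_trans (ler_norm x) _.
apply: lt_le_trans (archi_boundP (normr_ge0 x)) _.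
by rewrite -natrX ler_nat ltnW // ltn_expl.
Qed.

Lemma dyadic_shell (x : R) J : 1 <= x -> x < 2 ^+ J ->
  exists2 j, (j < J)%N & 2 ^+ j <= x < 2 ^+ j.+1.
Proof.
move=> x1 xJ; have ex : exists j, x < 2 ^+ j by exists J.
case: (ex_minnP ex) => -[|j] jx jmin.
  by rewrite expr0 in jx; move: (le_lt_trans x1 jx); rewrite ltxx.
exists j; first by exact: jmin.
rewrite jx andbT leNgt; apply/negP => /jmin; by rewrite ltnn.
Qed.

Lemma powRN_le (x y sigma : R) : 0 <= sigma -> 0 < x -> x <= y ->
  y `^ (- sigma) <= x `^ (- sigma).
Proof.
move=> s0 x0 xy; have y0 := lt_le_trans x0 xy.
rewrite !powRN lef_pV2 ?posrE ?powR_gt0 //.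
by apply: ge0_ler_powR => //; rewrite nnegrE ltW.
Qed.

(** On the shell [2^j <= nu x < 2^(j+1)] the weight is at most [2^(-j sigma)] and the mass at most
    [C 2^((j+1) e)]: a geometric series of ratio [2^(e - sigma) < 1]. The cutoff [J] does not enter
    the bound. *)
Lemma shell_up (T : eqType) (S : seq T) (nu g : T -> R) C e sigma J :
  (forall x, 0 <= g x) -> 0 <= C -> 0 <= e -> e < sigma ->
  (forall x, x \in S -> nu x < 2 ^+ J) ->
  (forall j, (j <= J)%N -> \sum_(x <- S | nu x <= 2 ^+ j) g x <= C * (2 ^+ j) `^ e) ->
  \sum_(x <- S | 1 <= nu x) g x * nu x `^ (- sigma) <=
    C * (2 `^ e / (1 - 2 `^ (e - sigma))).
Proof.
move=> g0 C0 e0 es hJ hS.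
have s0 : 0 <= sigma by lra.
set b := 2 `^ (- sigma); have b0 : 0 <= b by exact: powR_ge0.
set q := 2 `^ (e - sigma); have q0 : 0 <= q by exact: powR_ge0.
have q1 : q < 1.
  by apply: powR2_lt1; lra.
(* For each [x] the term of its own shell suffices; admitting all [nu x <= 2^(j+1)] turns the inner
   sums into those of the hypothesis. *)
apply: le_trans (_ : \sum_(x <- S | 1 <= nu x) \sum_(j < J)
    (if nu x <= 2 ^+ j.+1 then g x else 0) * b ^+ j <= _).
  rewrite big_seq_cond [leRHS]big_seq_cond; apply: ler_sum => x /andP[xS x1].
  have [j jJ /andP[j1 j2]] := dyadic_shell x1 (hJ x xS).
  rewrite (bigD1 (Ordinal jJ)) //= (ltW j2) -[leLHS]addr0; apply: lerD.
    rewrite ler_wpM2l // /b -powR_exprn //; apply: powRN_le => //.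
  by apply: sumr_ge0 => i _; rewrite mulr_ge0 ?exprn_ge0 //; case: ifP.
rewrite exchange_big /=.
apply: le_trans (_ : \sum_(j < J) C * 2 `^ e * q ^+ j <= _).
  apply: ler_sum => j _; rewrite -mulr_suml.
  apply: le_trans (_ : C * (2 ^+ j.+1) `^ e * b ^+ j <= _).
    rewrite ler_wpM2r ?exprn_ge0 // -big_mkcondr /=.
    apply: le_trans (hS j.+1 (ltn_ord j)).
    rewrite big_mkcond [leRHS]big_mkcond; apply: ler_sum => x _.
    by case: (1 <= _) => //=; case: ifP.
  rewrite le_eqVlt; apply/orP; left; apply/eqP.
  rewrite powR_exprn // exprS /q powRD_gt0 // exprMn -/b; ring.
rewrite -mulr_sumr -!mulrA ler_wpM2l // ler_wpM2l ?powR_ge0 //.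
exact: geo_sum_le.
Qed.

(** The opposite regime, growth faster than decay: the outermost shell dominates, so shells are
    taken downwards from [Q] and form a geometric series of ratio [2^(sigma - e)]. *)
Lemma shell_down (T : eqType) (S : seq T) (nu : T -> R) C e sigma Q :
  0 <= C -> 0 <= sigma -> sigma < e -> 1 <= Q ->
  (forall r, 1 <= r -> \sum_(x <- S | nu x <= r) 1 <= C * r `^ e) ->
  \sum_(x <- S | 1 <= nu x <= Q) nu x `^ (- sigma) <=
    C * (2 `^ sigma / (1 - 2 `^ (sigma - e))) * Q `^ (e - sigma).
Proof.
move=> C0 s0 se Q1 hS.
have Q0 : 0 < Q by lra.
have [J QJ] := exists_pow2 Q.
set b := 2 `^ sigma; have b0 : 0 <= b by exact: powR_ge0.
set q := 2 `^ (sigma - e); have q0 : 0 <= q by exact: powR_ge0.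
have q1 : q < 1.
  by apply: powR2_lt1; lra.
apply: le_trans (_ : \sum_(x <- S | 1 <= nu x <= Q) \sum_(j < J)
    (if nu x <= Q / 2 ^+ j then 1 else 0) * (Q `^ (- sigma) * b ^+ j.+1) <= _).
  apply: ler_sum => x /andP[x1 xQ].
  have x0 : 0 < nu x by lra.
  have [||j jJ /andP[j1 j2]] := @dyadic_shell (Q / nu x) J.
  - by rewrite ler_pdivlMr // mul1r.
  - by apply: le_lt_trans QJ; rewrite ler_pdivrMr // ler_peMr // ltW.
  rewrite (bigD1 (Ordinal jJ)) //=.
  have -> : nu x <= Q / 2 ^+ j.
    by rewrite ler_pdivlMr ?exprn_gt0 // mulrC -ler_pdivlMr.
  rewrite mul1r -[leLHS]addr0; apply: lerD.
    have -> : Q `^ (- sigma) * b ^+ j.+1 = (Q / 2 ^+ j.+1) `^ (- sigma).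
      by rewrite powRM ?invr_ge0 ?exprn_ge0 // ?(ltW Q0) // powR_exprV // opprK.
    apply: powRN_le => //; first by rewrite divr_gt0 ?exprn_gt0.
    by rewrite ler_pdivrMr ?exprn_gt0 // mulrC -ler_pdivrMr // ltW.
  by apply: sumr_ge0 => i _; rewrite mulr_ge0 ?mulr_ge0 ?exprn_ge0 ?powR_ge0 //; case: ifP.
rewrite exchange_big /=.
apply: le_trans (_ : \sum_(j < J) C * b * Q `^ (e - sigma) * q ^+ j <= _).
  apply: ler_sum => j _; rewrite -mulr_suml.
  have B0 : 0 <= Q `^ (- sigma) * b ^+ j.+1 by rewrite mulr_ge0 ?exprn_ge0 ?powR_ge0.
  have [Qj|Qj] := leP 1 (Q / 2 ^+ j); last first.
    rewrite big1 ?mul0r; last first.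
      move=> x /andP[x1 _]; case: ifP => // h; have := le_lt_trans (le_trans x1 h) Qj.
      by rewrite ltxx.
    by rewrite !mulr_ge0 ?exprn_ge0 ?powR_ge0.
  apply: le_trans (_ : C * (Q / 2 ^+ j) `^ e * (Q `^ (- sigma) * b ^+ j.+1) <= _).
    rewrite ler_wpM2r // -big_mkcondr /=.
    apply: le_trans (hS _ Qj).
    rewrite big_mkcond [leRHS]big_mkcond; apply: ler_sum => x _.
    by case: (_ && _) / andP => [[_ ->]//|]; case: ifP.
  rewrite le_eqVlt; apply/orP; left; apply/eqP.
  rewrite powRM ?invr_ge0 ?exprn_ge0 // ?(ltW Q0) // powR_exprV //.
  rewrite exprS /q !powRD_gt0 // exprMn -/b.
  ring.
rewrite -mulr_sumr; have := geo_sum_le J q0 q1.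
set G := (1 - q)^-1; set W := \sum_(j < J) _ => WG.
rewrite (_ : C * (b * G) * _ = C * b * Q `^ (e - sigma) * G); last by ring.
by rewrite ler_wpM2l // !mulr_ge0 ?powR_ge0.
Qed.

End Shells.

(** * The l1-dimension of the level-m points *)

Section Enorm.
Variables (R : realType) (n : nat).
Implicit Types (x : 'rV[R]_n) (z : 'rV[int]_n).

Lemma dotp_ge0 x : 0 <= dotp x x.
Proof. by apply: sumr_ge0 => i _; rewrite -expr2 sqr_ge0. Qed.

Lemma enorm_ge0 x : 0 <= enorm x.
Proof. exact: sqrtr_ge0. Qed.

Lemma sqr_enorm x : enorm x ^+ 2 = dotp x x.
Proof. by rewrite sqr_sqrtr // dotp_ge0. Qed.

Lemma enormZ a x : enorm (a *: x) = `|a| * enorm x.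
Proof.
by rewrite /enorm dotpZl dotpZr mulrA -expr2 sqrtrM ?sqr_ge0 // sqrtr_sqr.
Qed.

Lemma coord_le_enorm x i : `|x 0 i| <= enorm x.
Proof.
rewrite -sqrtr_sqr ler_wsqrtr // /dotp (bigD1 i) //= -expr2 lerDl.
by apply: sumr_ge0 => j _; rewrite -expr2 sqr_ge0.
Qed.

Lemma enorm_le_row x : enorm x <= n%:R * `|x|.
Proof.
rewrite -(@ler_pXn2r _ 2) ?nnegrE ?mulr_ge0 ?ler0n ?enorm_ge0 // sqr_enorm.
apply: le_trans (_ : n%:R * `|x| ^+ 2 <= _).
  rewrite mulr_natl -[X in _ *+ X]card_ord -sumr_const; apply: ler_sum => i _.
  by rewrite -expr2 -real_normK ?num_real // lerXn2r ?nnegrE // coord_le_norm.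
rewrite exprMn ler_wpM2r ?sqr_ge0 // -natrX ler_nat.
by case: n => // k; rewrite expnS expn1 leq_pmulr.
Qed.

Lemma norm_le_enorm x : `|x| <= enorm x.
Proof. by apply: row_norm_le => [|i]; [exact: enorm_ge0|exact: coord_le_enorm]. Qed.

Lemma enorm_ivec_ge1 z : z != 0 -> 1 <= enorm (ivec R z).
Proof.
move=> z0; have [i zi] : exists i, z 0 i != 0.
  apply/not_existsP => h; move/eqP: z0; apply; apply/rowP => i; rewrite mxE.
  by apply/eqP; apply: contrapT => /negP; exact: h.
apply: le_trans (coord_le_enorm (ivec R z) i); rewrite mxE -intr_norm.
by rewrite -[1]/(1%:~R) ler_int -gtz0_ge1 normr_gt0.
Qed.

Lemma count_enorm (S : seq 'rV[int]_n) (r : R) : uniq S -> 1 <= r ->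
  \sum_(z <- S | enorm (ivec R z) <= r) 1 <= 4 ^+ n * r ^+ n.
Proof.
move=> uS r1.
rewrite -big_filter big_const_seq count_predT iter_addr_0.
pose S' := [seq z <- S | enorm (ivec R z) <= r]; rewrite -/S'.
have r0 : 0 <= r by lra.
pose K := Num.truncn r.
have /andP[K1 K2] : K%:R <= r < K.+1%:R by exact: truncn_itv.
apply: le_trans (_ : ((2 * K + 1) ^ n)%:R <= _).
  rewrite ler_nat; apply: (@box_count _ (\row_i (- (K%:Z)))); first exact: filter_uniq.
  move=> z; rewrite mem_filter => /andP[zr _] i; rewrite !mxE.
  have := le_lt_trans (le_trans (coord_le_enorm (ivec R z) i) zr) K2.
  rewrite mxE -intr_norm -[K.+1%:R]/(K.+1%:Z%:~R) ltr_int; move: (z 0 i) => a.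
  rewrite ltr_norml; lia.
rewrite natrX -exprMn lerXn2r ?nnegrE ?ler0n ?mulr_ge0 //.
by rewrite natrD natrM; lra.
Qed.

End Enorm.

Section L1.
Variables (R : realType) (n p : nat) (D : {set 'rV['I_p]_n}).
Hypothesis p2 : (1 < p)%N.

(** The bound defining [dim_l1], with [e] in the role of [n - dim_l1], passed
    to the level-[m] points; radii are bounded because [m] depends on them. *)
Definition l1_bound (e C : R) := forall R0 : R, exists m0, forall m, (m0 <= m)%N ->
  forall theta : 'rV[R]_n, (forall i, 0 <= theta 0 i <= 1) ->
  forall r : R, 1 <= r -> r <= R0 -> forall S : seq 'rV[int]_n, uniq S ->
  (forall z, z \in S -> enorm (ivec R z) <= r) ->
  \sum_(z <- S) word_hat D m (ivec R z + theta) <= C * r `^ e.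

Lemma expr_lt_eps (eps : R) : 0 < eps -> exists m0, forall m, (m0 <= m)%N -> p%:R ^- m <= eps.
Proof.
move=> e0; have : (fun m => p%:R ^- m : R) @ \oo --> (0 : R).
  under eq_fun do rewrite -exprVn; apply: cvg_expr.
  by rewrite ger0_norm ?invr_ge0 // invf_lt1 ?ltr1n // ltr0n; lia.
move=> /cvgrPdist_le /(_ _ e0) [m0 _ h]; exists m0 => m /h /=.
by rewrite sub0r normrN ger0_norm // invr_ge0 exprn_ge0.
Qed.

Lemma l1_words (lam : probability (borelRn R n) R) (sigma : R) :
  missing_digit_law D lam -> 0 < sigma ->
  (0 < dim_l1 lam + sigma%:E - n%:R%:E)%E ->
  exists e C : R, [/\ 0 <= e, e < sigma, 0 <= C & l1_bound e C].
Proof.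
move=> hlam s0 hdim.
have : (((n%:R - sigma)%R)%:E < dim_l1 lam)%E.
  move: hdim; case: (dim_l1 lam) => [x| |] h.
  - have h' : 0 < x + sigma - n%:R by rewrite -lte_fin; exact: h.
    by rewrite lte_fin; lra.
  - by rewrite ltry.
  - by move: h; rewrite !addNye.
move=> /ereal_sup_gt [_ [s [s1 [C hC]] <-]]; rewrite lte_fin => ns.
(* The definition of [dim_l1] does not state [s <= n]; cutting at 0 gives [0 <= e] directly, at no
   cost since [r >= 1]. *)
pose e := Num.max (n%:R - s) 0.
have e0 : 0 <= e by rewrite /e le_max lexx orbT.
have es : e < sigma by rewrite /e gt_max s0 andbT; lra.
exists e, (`|C| + 1); split; [exact: e0|exact: es|exact: addr_ge0|].
move=> R0.
pose K := Num.bound `|R0|.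
(* Bounds the number of frequencies times the Lipschitz factor of [word_hat_law]; [m0] makes
   [B p^-m] less than 1, which the extra 1 in the constant absorbs. *)
pose B : R := ((2 * K + 1) ^ n)%:R * (4 * pi * (n%:R * (K%:R + 1))).
have pi0 := @pi_ge0 R.
have B0 : 0 <= B by rewrite /B; do ?apply: mulr_ge0 => //; rewrite ?addr_ge0 ?ler0n.
have [|m0 hm0] := @expr_lt_eps (B + 1)^-1; first by rewrite invr_gt0; lra.
exists m0 => m mm theta th r r1 rR0 S uS hS.
have rK : r <= K%:R.
  exact: le_trans rR0 (le_trans (ler_norm _) (ltW (archi_boundP (normr_ge0 _)))).
have zK z i : z \in S -> `|(z 0 i)%:~R| <= K%:R :> R.
  move=> zS; apply: le_trans rK; apply: le_trans (hS z zS).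
  by have := coord_le_enorm (ivec R z) i; rewrite mxE.
have sS : (size S <= (2 * K + 1) ^ n)%N.
  apply: (@box_count _ (\row_i (- (K%:Z)))) => // z zS i; rewrite !mxE.
  have := zK z i zS; rewrite -intr_norm -[K%:R]/(K%:Z%:~R) ler_int.
  by move: (z 0 i) => a; clear; lia.
have step : \sum_(z <- S) word_hat D m (ivec R z + theta) <=
    \sum_(z <- S) (normc (fourier lam (cst 1) (ivec R z + theta)) +
      4 * pi * (n%:R * (K%:R + 1)) * p%:R ^- m).
  rewrite big_seq [leRHS]big_seq; apply: ler_sum => z zS.
  apply: le_trans (word_hat_law p2 hlam m _) _; rewrite lerD2l.
  rewrite ler_wpM2r ?invr_ge0 ?exprn_ge0 ?ler0n // ler_wpM2l ?mulr_ge0 //.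
  rewrite -[X in X%:R * _]card_ord mulr_natl -sumr_const; apply: ler_sum => i _.
  rewrite !mxE (le_trans (ler_normD _ _)) // lerD ?zK //.
  by have /andP[t0 t1] := th i; rewrite ger0_norm.
apply: le_trans step _; rewrite big_split big_const_seq count_predT iter_addr_0.
rewrite [leRHS]mulrDl mul1r; apply: lerD.
  apply: le_trans (_ : C * r `^ (n%:R - s) <= _).
    rewrite -lee_fin; apply: le_trans (hC r r1).
    apply: le_trans (ereal_sup_ubound _); last by exists theta.
    apply: esum_ge; exists [set` S].
      split; first exact: finite_seq.
      by move=> z /= zS; exact: hS.
    by rewrite -fsbig_seq // sumEFin.
  apply: le_trans (_ : `|C| * r `^ (n%:R - s) <= _).
    by rewrite ler_wpM2r ?powR_ge0 // ler_norm.
  by rewrite ler_wpM2l // ler_powR // /e le_max lexx.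
apply: le_trans (_ : 1 <= _); last first.
  by rewrite -[X in X <= _](powRr0 r) ler_powR.
rewrite -[X in X <= _]mulr_natl; apply: le_trans (_ : B * p%:R ^- m <= _).
  rewrite [X in X <= _]mulrA ler_wpM2r ?invr_ge0 ?exprn_ge0 ?ler0n // /B ler_wpM2r ?ler_nat //.
  by do ?apply: mulr_ge0 => //; rewrite ?addr_ge0 ?ler0n.
apply: le_trans (_ : B / (B + 1) <= _); first by rewrite ler_wpM2l // hm0.
by rewrite ler_pdivrMr; lra.
Qed.

(** Write [z = p^k q + t] with [t] in [[0, p^k)^n]: then [p^-k z] is [q] plus a point of the unit
    cube. This is what uniformity in [theta] is for; the bound is applied once for each of the
    [p^(kn)] residues [t]. *)
Lemma l1_rescaled (e C : R) : (0 < n)%N -> 0 <= e -> 0 <= C -> l1_bound e C ->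
  forall (k : nat) (R0 : R), exists m0, forall m, (m0 <= m)%N ->
  forall r : R, 1 <= r -> r <= R0 -> forall S : seq 'rV[int]_n, uniq S ->
  (forall z, z \in S -> enorm (ivec R z) <= p%:R ^+ k * r) ->
  \sum_(z <- S) word_hat D m (p%:R ^- k *: ivec R z) <=
    (p%:R ^+ k) ^+ n * (C * (2 * n%:R * r) `^ e).
Proof.
move=> n0 e0 C0 hl1 k R0.
have [m0 hm0] := hl1 (2 * n%:R * R0); exists m0 => m mm r r1 rR0 S uS hS.
have pk0 : (0 < p ^ k)%N by rewrite expn_gt0; lia.
have pkR : 0 < p%:R ^+ k :> R by rewrite -natrX ltr0n.
have n1 : 1 <= n%:R :> R by rewrite ler1n.
have hres (z : 'rV[int]_n) i : (`|(z 0%R i %% (p ^ k)%:Z)%Z|%N < p ^ k)%N.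
  have := ltz_pmod (z 0 i) (_ : 0 < (p ^ k)%:Z); have := modz_ge0 (z 0 i) (_ : (p ^ k)%:Z != 0).
  by move: (_ %% _)%Z => a h1 h2; have := h1 (ltac:(lia)); have := h2 (ltac:(lia)); lia.
pose res (z : 'rV[int]_n) : {ffun 'I_n -> 'I_(p ^ k)} := [ffun i => Ordinal (hres z i)].
pose quo (z : 'rV[int]_n) : 'rV[int]_n := \row_i (z 0%R i %/ (p ^ k)%:Z)%Z.
have dec z : ivec R z = p%:R ^+ k *: ivec R (quo z) + ivec R (frequency (res z)).
  rewrite -natrX -ivecZ -ivecD; congr ivec; apply/rowP => i; rewrite !mxE ffunE /=.
  rewrite gez0_abs; last by apply: modz_ge0; lia.
  by rewrite mulrC; exact: divz_eq.
rewrite (partition_big res xpredT) //=.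
apply: le_trans (_ : \sum_(t : {ffun 'I_n -> 'I_(p ^ k)}) C * (2 * n%:R * r) `^ e <= _); last first.
  by rewrite sumr_const card_ffun !card_ord -[X in X <= _]mulr_natl !natrX.
apply: ler_sum => t _.
pose theta : 'rV[R]_n := p%:R ^- k *: ivec R (frequency t).
have -> : \sum_(z <- S | res z == t) word_hat D m (p%:R ^- k *: ivec R z) =
    \sum_(q <- [seq quo z | z <- [seq z <- S | res z == t]]) word_hat D m (ivec R q + theta).
  rewrite big_map big_filter; apply: eq_bigr => z /eqP zt.
  by rewrite dec zt scalerDr scalerA mulVf ?gt_eqF // scale1r.
apply: hm0 => //.
- move=> i; rewrite !mxE; have := ltn_ord (t i); move: (nat_of_ord (t i)) => a ap.
  rewrite mulr_ge0 ?invr_ge0 ?(ltW pkR) ?ler0z //= mulrC ler_pdivrMr // mul1r.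
  by rewrite -natrX ler_nat ltnW.
- by have : 0 <= r by [lra]; nra.
- rewrite ler_wpM2l // mulr_ge0 //; lra.
- rewrite map_inj_in_uniq ?filter_uniq // => z z'.
  rewrite !mem_filter => /andP[/eqP h _] /andP[/eqP h' _] hq.
  have := dec z; rewrite hq h -h' -dec => /rowP hz; apply/rowP => i.
  by have := hz i; rewrite !mxE => /intr_inj.
move=> q' /mapP[z zin ->]; move: zin; rewrite mem_filter => /andP[/eqP zt zS].
(* In the sup norm [|q| <= r + 1 <= 2r]; the factor [n] passes to the Euclidean norm. *)
apply: le_trans (enorm_le_row _) _; rewrite [2 * _]mulrC -mulrA ler_wpM2l ?ler0n //.
apply: row_norm_le => [|i]; first by lra.
have zi : `|(z 0 i)%:~R| <= p%:R ^+ k * r :> R.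
  by apply: le_trans (hS z zS); have := coord_le_enorm (ivec R z) i; rewrite mxE.
have /rowP/(_ i) := dec z; rewrite !mxE; set q := (_ %/ _)%Z.
have := ltn_ord (res z i); move: (nat_of_ord _) => a ap e1.
have e2 : p%:R ^+ k * `|q%:~R| <= p%:R ^+ k * r + p%:R ^+ k :> R.
  rewrite -[X in X * _](gtr0_norm pkR) -normrM.
  have -> : p%:R ^+ k * q%:~R = (z 0 i)%:~R - a%:~R :> R by rewrite e1 addrK.
  rewrite (le_trans (ler_normB _ _)) // lerD // ger0_norm ?ler0z //.
  by rewrite -natrX ler_nat ltnW.
rewrite -(ler_pM2l pkR); apply: le_trans e2 _.
rewrite -[X in _ + X]mulr1 -mulrDr ler_pM2l //; lra.
Qed.

End L1.

(** * Fourier estimates *)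

Section IntegerVectors.
Variables (R : realType) (n : nat).
Implicit Types z : 'rV[int]_n.

Lemma freq_enorm z (B : nat) : (forall i, - B%:Z < z 0 i < B%:Z) ->
  enorm (ivec R z) <= n%:R * B%:R.
Proof.
move=> h; apply: le_trans (enorm_le_row _) _; rewrite ler_wpM2l ?ler0n //.
apply: row_norm_le => [|i]; first exact: ler0n.
rewrite mxE -intr_norm -[B%:R]/(B%:Z%:~R) ler_int ltW // ltr_norml; exact: h.
Qed.

Lemma ivec_neq0 z : (z != 0) = (1 <= enorm (ivec R z)).
Proof.
apply/idP/idP => [|h]; first exact: enorm_ivec_ge1.
apply/eqP => z0; move: h; rewrite z0 ivec0 /enorm dotp0l sqrtr0.
by rewrite real_leNgt ?num_real // ltr01.
Qed.

End IntegerVectors.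

Section FreqSums.
Variables (R : realType) (n p : nat) (D : {set 'rV['I_p]_n}).
Hypothesis p2 : (1 < p)%N.
Hypothesis n0 : (0 < n)%N.
Implicit Types (S : seq 'rV[int]_n) (z : 'rV[int]_n).

(** These are the geometric series of [shell_up], and of [shell_down] for lattice points, named so
    that constants are visibly independent of [k], [l] and [N]. *)
Definition up_const (e sigma : R) := 2 `^ e / (1 - 2 `^ (e - sigma)).
Definition down_const (sigma : R) := 2 `^ sigma / (1 - 2 `^ (sigma - n%:R)).

Lemma up_const_ge0 e sigma : e < sigma -> 0 <= up_const e sigma.
Proof.
move=> h; rewrite divr_ge0 ?powR_ge0 // subr_ge0 ltW // powR2_lt1 //; lra.
Qed.

Lemma down_const_ge0 sigma : sigma < n%:R -> 0 <= down_const sigma.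
Proof.
move=> h; rewrite divr_ge0 ?powR_ge0 // subr_ge0 ltW // powR2_lt1 //; lra.
Qed.

Lemma high_sum (e C sigma : R) : 0 <= e -> e < sigma -> 0 <= C -> l1_bound D e C ->
  forall (k J : nat), exists m0, forall m, (m0 <= m)%N -> forall S, uniq S ->
  (forall z, z \in S -> enorm (p%:R ^- k *: ivec R z) < 2 ^+ J) ->
  \sum_(z <- S | 1 <= enorm (p%:R ^- k *: ivec R z))
     word_hat D m (p%:R ^- k *: ivec R z) * enorm (p%:R ^- k *: ivec R z) `^ (- sigma)
  <= (p%:R ^+ k) ^+ n * (C * (2 * n%:R) `^ e) * up_const e sigma.
Proof.
move=> e0 es C0 hl1 k J.
have [m0 hm0] := l1_rescaled p2 n0 e0 C0 hl1 k (2 ^+ J).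
exists m0 => m mm S uS hS.
have pk0 : 0 < p%:R ^+ k :> R by rewrite exprn_gt0 // ltr0n; lia.
apply: (shell_up (J := J)) => //.
- by move=> z; exact: normc_ge0.
- by rewrite !mulr_ge0 ?powR_ge0 // ?exprn_ge0 ?ltW.
move=> j jJ; rewrite -big_filter.
apply: le_trans (hm0 m mm (2 ^+ j) _ _ _ _ _) _.
- by rewrite exprn_ege1 // ler1n.
- by rewrite ler_weXn2l // ler1n.
- exact: filter_uniq.
- move=> z; rewrite mem_filter => /andP[+ _].
  by rewrite enormZ ger0_norm ?invr_ge0 ?(ltW pk0) // mulrC ler_pdivrMr // mulrC.
by rewrite powRM ?mulr_ge0 ?ler0n ?exprn_ge0 // !mulrA.
Qed.

Lemma low_sum (sigma Q : R) S : 0 <= sigma -> sigma < n%:R -> 1 <= Q -> uniq S ->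
  \sum_(z <- S | 1 <= enorm (ivec R z) <= Q) enorm (ivec R z) `^ (- sigma) <=
  4 ^+ n * down_const sigma * Q `^ (n%:R - sigma).
Proof.
move=> s0 sn Q1 uS; apply: shell_down => //.
by move=> r r1; rewrite powR_mulrn; [exact: count_enorm|lra].
Qed.

End FreqSums.

Lemma ler_pM_4 (R : realDomainType) (x y m : R) :
  0 <= x -> x <= 2 * m -> 0 <= y -> y <= 2 -> x * y <= 4 * m.
Proof. by move=> x0 xm y0 y2; nra. Qed.

(** The final computation of [main_lower], with [k = N^-n], [t = 2^-n], [m] the mass of [phi mu],
    and [a1], [a2] the pairings with [F_N] and [F_N^2]. The weight [t / 8] costs about half of the
    gain [t m], and the errors [m t / 16] are small beside it. *)
Lemma lower_bound_arith (R : realFieldType) (a1 a2 k t m : R) :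
  a1 <= k * (4 * m + m * t / 16) -> k * (t * m - m * t / 16) <= a2 ->
  0 <= k -> 0 < t -> t <= 1 -> 0 < m ->
  m * t / 4 * k <= a2 - t / 8 * a1.
Proof.
move=> h1 h2 k0 t0 t1 m0.
have NM : 0 <= k * m * t by rewrite !mulr_ge0 // ltW.
have h3 : t / 8 * a1 <= t / 8 * (k * (4 * m + m * t / 16)).
  by rewrite ler_wpM2l // ltW // divr_gt0.
have h4 : k * m * t * t <= k * m * t by rewrite ler_piMr.
have -> : m * t / 4 * k = k * m * t / 4 by ring.
have e1 : t / 8 * (k * (4 * m + m * t / 16)) = k * m * t / 2 + k * m * t * t / 128 by field.
have e2 : k * (t * m - m * t / 16) = k * m * t * (15 / 16) by field.
by move: h2 h3 h4; rewrite e1 e2; lra.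
Qed.

Section Estimates.
Variables (R : realType) (n p : nat) (D : {set 'rV['I_p]_n}).
Hypothesis p2 : (1 < p)%N.
Hypothesis n0 : (0 < n)%N.
Hypothesis D0 : (0 < #|D|)%N.
Variable (mu : {measure set (borelRn R n) -> \bar R}).
Variables (M : set 'rV[R]_n) (phi : 'rV[R]_n -> R).
Hypothesis cphi : continuous phi.
Hypothesis phi0 : forall x, 0 <= phi x.
Hypothesis phiB : forall x, phi x <= 1.
Hypothesis mu_tsupp : (mu (tsupp phi) < +oo)%E.
Hypothesis mM : measurable (M : set (borelRn R n)).
Hypothesis muM : mu (~` M) = 0%E.
Variables (CF sigma : R).
Hypothesis CF0 : 0 <= CF.
Hypothesis sigma0 : 0 <= sigma.
Hypothesis decay : forall xi : 'rV[R]_n, 1 <= enorm xi ->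
  normc (fourier mu phi xi) <= CF * enorm xi `^ (- sigma).

Let mphi := pairing mu phi (cst 1).
Let pR : 0 < p%:R :> R. Proof. by rewrite ltr0n ltnW. Qed.

Let mphi0 : 0 <= mphi.
Proof. by apply: Rintegral_ge0 => x _; rewrite mulr1. Qed.

Let weight0 m : 0 <= #|D|%:R ^- m :> R.
Proof. by rewrite invr_ge0 exprn_ge0 ?ler0n. Qed.

Let weight1 m : #|D|%:R ^- m * (size (words D m))%:R = 1 :> R.
Proof.
by rewrite size_words natrX mulVf // expf_neq0 // pnatr_eq0 -lt0n.
Qed.

Lemma decay_scaled (q : R) (z : 'rV[int]_n) : 1 <= q -> z != 0 ->
  normc (fourier mu phi (q *: ivec R z)) <=
  CF * q `^ (- sigma) * enorm (ivec R z) `^ (- sigma).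
Proof.
move=> q1 z0; have e1 := enorm_ivec_ge1 R z0.
have q0 : 0 <= q by lra.
have e : enorm (q *: ivec R z) = q * enorm (ivec R z) by rewrite enormZ ger0_norm.
apply: le_trans (decay _) _; first by rewrite e; nra.
by rewrite e powRM // ?mulrA //; lra.
Qed.

Lemma word_hat_le2 m (xi : 'rV[R]_n) : word_hat D m xi <= 2.
Proof.
rewrite -cloud_hat_words; apply: le_trans (cloud_hat_le _ (weight0 m) _) _.
by rewrite size_map weight1 mulr1.
Qed.

Lemma zero_term (S : seq 'rV[int]_n) (f : 'rV[int]_n -> R) : uniq S -> 0 <= f 0 ->
  \sum_(z <- S | z == 0) f z <= f 0.
Proof.
move=> uS f0; rewrite -big_filter; have [h|h] := boolP (0 \in S).
  by rewrite filter_pred1_uniq // big_seq1.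
rewrite big_filter big_seq_cond big1 // => z /andP[zS /eqP z0].
by rewrite -z0 zS in h.
Qed.

(** At frequencies below [Q] the structure of [D] is ignored: the factor [a] is bounded trivially
    and lattice points are counted. As [sigma < n], the largest frequencies dominate. *)
Lemma low_part (q Q : R) (a : 'rV[int]_n -> R) S : sigma < n%:R -> 1 <= q -> 1 <= Q ->
  uniq S -> (forall z, 0 <= a z <= 2) ->
  \sum_(z <- S | (z != 0) && (enorm (ivec R z) <= Q))
     normc (fourier mu phi (q *: ivec R z)) * a z <=
  CF * (2 * (4 ^+ n * down_const n sigma)) * Q `^ (n%:R - sigma).
Proof.
move=> sn q1 Q1 uS a2.
apply: le_trans (_ : \sum_(z <- S | 1 <= enorm (ivec R z) <= Q)
    (CF * 2) * enorm (ivec R z) `^ (- sigma) <= _).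
  rewrite big_mkcond [leRHS]big_mkcond; apply: ler_sum => z _.
  rewrite -ivec_neq0; case: ifP => // /andP[z0 _].
  have /andP[a0 a2'] := a2 z.
  apply: le_trans (_ : CF * enorm (ivec R z) `^ (- sigma) * 2 <= _); last by rewrite mulrAC.
  apply: ler_pM => //; first exact: normc_ge0.
  apply: le_trans (decay_scaled q1 z0) _; rewrite ler_wpM2r ?powR_ge0 //.
  by rewrite -[leRHS]mulr1 ler_wpM2l // powR_le1 // oppr_le0.
rewrite -mulr_sumr; have := low_sum sigma0 sn Q1 uS.
move: (down_const n sigma) (\sum_(z <- S | _) _) => dd W hW.
have -> : CF * (2 * (4 ^+ n * dd)) * Q `^ (n%:R - sigma) =
    CF * 2 * (4 ^+ n * dd * Q `^ (n%:R - sigma)) by ring.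
by rewrite ler_wpM2l ?mulr_ge0.
Qed.

(** Beyond [p^k] the decay is summed against the l1 bound for a piece of level [k]: [p^(kn)]
    residues times [p^(-k sigma)] from decay give the power [n - sigma]. The factor [q^(-sigma)] is
    kept, since a large [l] exploits it. *)
Lemma high_part (e C : R) : 0 <= e -> e < sigma -> 0 <= C -> l1_bound D e C ->
  forall k J, exists m0, forall m, (m0 <= m)%N -> forall (q : R) S, 1 <= q -> uniq S ->
  (forall z, z \in S -> enorm (ivec R z) < 2 ^+ J) ->
  \sum_(z <- S | (z != 0) && (p%:R ^+ k <= enorm (ivec R z)))
     normc (fourier mu phi (q *: ivec R z)) * word_hat D m (p%:R ^- k *: ivec R z) <=
  CF * q `^ (- sigma) * (p%:R ^+ k) `^ (n%:R - sigma) *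
    (C * (2 * n%:R) `^ e * up_const e sigma).
Proof.
move=> e0 es C0 hl1 k J.
have [m0 hm0] := high_sum p2 n0 e0 es C0 hl1 k J.
exists m0 => m mm q S q1 uS hS.
have pk1 : 1 <= p%:R ^+ k :> R by rewrite exprn_ege1 // ler1n ltnW.
have pk0 : 0 < p%:R ^+ k :> R by lra.
have en z : enorm (ivec R z) = p%:R ^+ k * enorm (p%:R ^- k *: ivec R z).
  by rewrite enormZ ger0_norm ?invr_ge0 ?(ltW pk0) // mulVKf // gt_eqF.
apply: le_trans (_ : \sum_(z <- S | 1 <= enorm (p%:R ^- k *: ivec R z))
    (CF * q `^ (- sigma) * (p%:R ^+ k) `^ (- sigma)) *
    (word_hat D m (p%:R ^- k *: ivec R z) *
     enorm (p%:R ^- k *: ivec R z) `^ (- sigma)) <= _).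
  rewrite big_mkcond [leRHS]big_mkcond; apply: ler_sum => z _.
  have w0 : 0 <= word_hat D m (p%:R ^- k *: ivec R z) by exact: normc_ge0.
  have [h1|h1] := leP 1 (enorm (p%:R ^- k *: ivec R z)); last first.
    rewrite ifF // en; apply/negP => /andP[_]; rewrite -[X in X <= _]mulr1 ler_pM2l //.
    by rewrite real_leNgt ?num_real // h1.
  case: ifP => [/andP[z0 _]|_]; last by rewrite !mulr_ge0 ?powR_ge0.
  rewrite [word_hat _ _ _ * _]mulrC mulrA ler_wpM2r //.
  apply: le_trans (decay_scaled q1 z0) _.
  by rewrite [in X in X <= _]en powRM ?enorm_ge0 ?(ltW pk0) // mulrA.
rewrite -mulr_sumr.
have := hm0 m mm S uS; set W := \sum_(z <- S | _) _ => hW.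
apply: le_trans (_ : CF * q `^ (- sigma) * (p%:R ^+ k) `^ (- sigma) *
    ((p%:R ^+ k) ^+ n * (C * (2 * n%:R) `^ e) * up_const e sigma) <= _).
  rewrite ler_wpM2l ?mulr_ge0 ?powR_ge0 //; apply: hW => z zS.
  by apply: le_lt_trans (hS z zS); rewrite en ler_peMl ?enorm_ge0.
rewrite addrC powRD_gt0 // powR_mulrn ?(ltW pk0) // le_eqVlt; apply/orP; left; apply/eqP.
by ring.
Qed.

Definition piece_cloud k v m : seq 'rV[R]_n :=
  [seq wpoint R p k v + p%:R ^- k *: wpoint R p m z | z <- words D m].

Lemma cloud_hat_piece k v m (xi : 'rV[R]_n) :
  cloud_hat (piece_cloud k v m) (#|D|%:R ^- m) xi = word_hat D m (p%:R ^- k *: xi).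
Proof.
rewrite -cloud_hat_words -(cloud_hat_shift _ _ _ (wpoint R p k v)).
by rewrite /piece_cloud -map_comp.
Qed.

(** A piece of size [p^-k] has at frequency [z] the transform of the whole at [p^-k z], which need
    not be small for [|z|] below [p^k]. Splitting there, both ranges give [p^(k (n - sigma))]; [CB]
    is uniform in [l], [k], [N] and [v]. *)
Lemma piece_upper (e C : R) : 0 <= e -> e < sigma -> 0 <= C -> l1_bound D e C ->
  sigma < n%:R -> exists2 CB, 0 <= CB & forall l k N, (0 < N)%N -> exists m0,
  forall m v, (m0 <= m)%N ->
  pairing mu phi (fun x => #|D|%:R ^- m *
     \sum_(y <- piece_cloud k v m) fejer N (p%:R ^+ l *: x - y)) <=
  CB * N%:R ^- n * (p%:R ^+ k) `^ (n%:R - sigma).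
Proof.
move=> e0 es C0 hl1 sn.
pose C1 := CF * (2 * (4 ^+ n * down_const n sigma)).
pose C2 := C * (2 * n%:R) `^ e * up_const e sigma.
have dc := @down_const_ge0 R n sigma sn.
have uc := @up_const_ge0 R e sigma es.
have C10 : 0 <= C1 by rewrite /C1; do ?apply: mulr_ge0 => //; rewrite exprn_ge0.
have C20 : 0 <= C2 by rewrite /C2; do ?apply: mulr_ge0 => //; rewrite powR_ge0.
exists (4 * mphi + C1 + CF * C2); first by rewrite !addr_ge0 // mulr_ge0.
move=> l k N N0; have [J hJ] := exists_pow2 (n%:R * N%:R : R).
have [m0 hm0] := high_part e0 es C0 hl1 k J.
exists m0 => m v mm.
apply: le_trans (pairing_fejer_le cphi phi0 phiB mu_tsupp (piece_cloud k v m) _ _ N0) _.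
rewrite [(_ + _ + _) * _]mulrC -mulrA ler_wpM2l ?invr_ge0 ?exprn_ge0 ?ler0n //.
set S := undup _.
have uS : uniq S by exact: undup_uniq.
have pk1 : 1 <= p%:R ^+ k :> R by rewrite exprn_ege1 // ler1n ltnW.
have pk0 : 0 < p%:R ^+ k :> R by lra.
have pl1 : 1 <= p%:R ^+ l :> R by rewrite exprn_ege1 // ler1n ltnW.
set P := (p%:R ^+ k) `^ _.
have P1 : 1 <= P by apply: powR_ge1 => //; lra.
have Sb z : z \in S -> enorm (ivec R z) < 2 ^+ J.
  rewrite mem_undup => h; apply: le_lt_trans hJ; apply: freq_enorm => i.
  exact: fejer_freqs_bound h.
have a2 z : 0 <= word_hat D m (p%:R ^- k *: ivec R z) <= 2.
  by rewrite word_hat_le2 andbT; exact: normc_ge0.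
under eq_bigr do rewrite cloud_hat_piece.
rewrite (bigID (fun z => z == 0)) [X in _ + X <= _](bigID (fun z => enorm (ivec R z) <= p%:R ^+ k)).
rewrite [leRHS]mulrDl [X in _ <= X + _]mulrDl -[leRHS]addrA; apply: lerD.
  apply: le_trans (zero_term uS _) _.
    by apply: mulr_ge0; [exact: normc_ge0|case/andP: (a2 0)].
  apply: le_trans (_ : 4 * mphi * 1 <= _); last by rewrite ler_wpM2l ?mulr_ge0.
  have /andP[a0 a2'] := a2 0; rewrite mulr1; apply: ler_pM_4 => //; first exact: normc_ge0.
  exact: (normc_fourier_le cphi phi0 phiB mu_tsupp mM muM).
apply: lerD; first exact: low_part.
apply: le_trans (le_trans _ (hm0 m mm (p%:R ^+ l) S pl1 uS Sb)) _.
  rewrite big_mkcond [leRHS]big_mkcond; apply: ler_sum => z _.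
  have f0 : 0 <= normc (fourier mu phi (p%:R ^+ l *: ivec R z)) *
      word_hat D m (p%:R ^- k *: ivec R z).
    by apply: mulr_ge0; [exact: normc_ge0|case/andP: (a2 z)].
  case: (z != 0) => //=; have [h|h] := leP (enorm (ivec R z)) (p%:R ^+ k).
    by case: ifP.
  by rewrite (ltW h).
rewrite -/P -/C2 mulrAC ler_wpM2r ?(le_trans ler01 P1) // ler_wpM2r //.
by rewrite -[leRHS]mulr1 ler_wpM2l // powR_le1 // oppr_le0.
Qed.

(** Decay makes the nonzero frequencies negligible for large [l], uniformly in [N]. *)
Lemma main_lower (e C : R) : 0 <= e -> e < sigma -> 0 <= C -> l1_bound D e C -> 0 < mphi ->
  exists l0, forall l, (l0 <= l)%N -> forall N, (0 < N)%N -> exists m0, forall m, (m0 <= m)%N ->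
  mphi * 2 ^- n / 4 * N%:R ^- n <=
  pairing mu phi (fun x => #|D|%:R ^- m * \sum_(z <- words D m)
    fejer N (p%:R ^+ l *: x - wpoint R p m z) ^+ 2) -
  2 ^- n / 8 * pairing mu phi (fun x => #|D|%:R ^- m * \sum_(z <- words D m)
    fejer N (p%:R ^+ l *: x - wpoint R p m z)).
Proof.
move=> e0 es C0 hl1 mphi_gt0.
pose C2 := C * (2 * n%:R) `^ e * up_const e sigma.
have uc := @up_const_ge0 R e sigma es.
have C20 : 0 <= C2 by rewrite /C2; do ?apply: mulr_ge0 => //; rewrite powR_ge0.
have t0 : 0 < 2 ^- n :> R by rewrite invr_gt0 exprn_gt0.
have t1 : 2 ^- n <= 1 :> R by rewrite invf_le1 ?exprn_gt0 // exprn_ege1 // ler1n.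
have [l0 hl0] : exists l0, forall l, (l0 <= l)%N ->
    CF * (p%:R ^+ l) `^ (- sigma) * C2 <= mphi * 2 ^- n / 16.
  have sp : 0 < sigma by lra.
  (* [p^-l <= b^(1/sigma)] turns into [p^(-l sigma) <= b]; the added 1 keeps the denominator
     positive. *)
  pose b := (mphi * 2 ^- n / 16) / (CF * C2 + 1).
  have CC : 0 <= CF * C2 by rewrite mulr_ge0.
  have b0 : 0 < b by rewrite !divr_gt0 ?mulr_gt0 //; lra.
  have [l0 h] := @expr_lt_eps R p p2 (b `^ sigma^-1) (powR_gt0 _ b0).
  exists l0 => l /h hl.
  apply: le_trans (_ : CF * C2 * b <= _).
    rewrite mulrAC ler_wpM2l //.
    have -> : b = (b `^ sigma^-1) `^ sigma by rewrite -powRrM mulVf ?gt_eqF // powRr1 // ltW.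
    rewrite -powRV ?exprn_ge0 ?(ltW pR) //; apply: ge0_ler_powR => //.
      by rewrite nnegrE invr_ge0 exprn_ge0 ?(ltW pR).
    by rewrite nnegrE powR_ge0.
  rewrite /b mulrA ler_pdivrMr; last by lra.
  have : 0 < mphi * 2 ^- n / 16 by rewrite !divr_gt0 ?mulr_gt0.
  move=> hy; rewrite [X in X <= _]mulrC mulrDr mulr1 lerDl; exact: ltW.
exists l0 => l /hl0 hl N N0.
have [J hJ] := exists_pow2 (n%:R * (2 * N)%:R : R).
(* With [k = 0] every nonzero integer frequency is a high one, hence carries the factor
   [p^(-l sigma)]. *)
have [m0 hm0] := high_part e0 es C0 hl1 0 J.
exists m0 => m mm.
have pl1 : 1 <= p%:R ^+ l :> R by rewrite exprn_ege1 // ler1n ltnW.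
set Y := [seq wpoint R p m z | z <- words D m].
have tail S : uniq S -> (forall z, z \in S -> enorm (ivec R z) <= n%:R * (2 * N)%:R) ->
    \sum_(z <- S | z != 0) normc (fourier mu phi (p%:R ^+ l *: ivec R z)) *
      cloud_hat Y (#|D|%:R ^- m) (ivec R z) <= mphi * 2 ^- n / 16.
  move=> uS Sb; apply: le_trans hl.
  have := hm0 m mm (p%:R ^+ l) S pl1 uS (fun z zS => le_lt_trans (Sb z zS) hJ).
  rewrite expr0 powR1 mulr1 -/C2; apply: le_trans.
  rewrite le_eqVlt; apply/orP; left; apply/eqP; apply: eq_big => z.
    by rewrite -ivec_neq0 andbb.
  by move=> _; rewrite cloud_hat_words invr1 scale1r.
have I2 := pairing_fejer2_ge cphi phi0 phiB mu_tsupp Y (weight0 m) (p%:R ^+ l) N0.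
have I1 := pairing_fejer_le cphi phi0 phiB mu_tsupp Y (#|D|%:R ^- m) (p%:R ^+ l) N0.
have eY (g : 'rV[R]_n -> R) : \sum_(y <- Y) g y = \sum_(z <- words D m) g (wpoint R p m z).
  by rewrite big_map.
rewrite (_ : (fun x => _ * \sum_(y <- Y) fejer N (p%:R ^+ l *: x - y) ^+ 2) =
  (fun x => #|D|%:R ^- m * \sum_(z <- words D m)
    fejer N (p%:R ^+ l *: x - wpoint R p m z) ^+ 2)) in I2; last first.
  by apply/funext => x; rewrite (eY (fun y => fejer N (_ - y) ^+ 2)).
rewrite (_ : (fun x => _ * \sum_(y <- Y) fejer N (p%:R ^+ l *: x - y)) =
  (fun x => #|D|%:R ^- m * \sum_(z <- words D m)
    fejer N (p%:R ^+ l *: x - wpoint R p m z))) in I1; last first.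
  by apply/funext => x; rewrite (eY (fun y => fejer N (_ - y))).
have Ninv : 0 <= N%:R ^- n :> R by rewrite invr_ge0 exprn_ge0 ?ler0n.
have T2 := tail _ (undup_uniq (fejer_freqs2 n N)).
have {}T2 := T2 (ltac:(by move=> z; rewrite mem_undup => h; apply: freq_enorm => i; exact: fejer_freqs2_bound h)).
have T1 := tail _ (undup_uniq (fejer_freqs n N)).
have {}T1 := T1 (ltac:(by move=> z; rewrite mem_undup => h; apply: freq_enorm => i; have := fejer_freqs_bound i h; move: (z 0 i) => a; clear; lia)).
rewrite size_map weight1 mulr1 -/mphi in I2.
have Z : \sum_(z <- undup (fejer_freqs n N))
    normc (fourier mu phi (p%:R ^+ l *: ivec R z)) * cloud_hat Y (#|D|%:R ^- m) (ivec R z) <=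
    4 * mphi + mphi * 2 ^- n / 16.
  rewrite (bigID (fun z => z == 0)); apply: lerD; last exact: T1.
  apply: le_trans (zero_term (undup_uniq _) _) _.
    by apply: mulr_ge0; exact: normc_ge0.
  apply: ler_pM_4; try exact: normc_ge0.
    exact: (normc_fourier_le cphi phi0 phiB mu_tsupp mM muM).
  by have := cloud_hat_le Y (weight0 m) (ivec R 0); rewrite size_map weight1 mulr1.
set A2 := pairing mu phi _ in I2 *; set A1 := pairing mu phi _ in I1 *.
have {}I1 : A1 <= N%:R ^- n * (4 * mphi + mphi * 2 ^- n / 16).
  by apply: le_trans I1 _; rewrite ler_wpM2l.
have {}I2 : N%:R ^- n * (2 ^- n * mphi - mphi * 2 ^- n / 16) <= A2.
  by apply: le_trans I2; rewrite ler_wpM2l // lerB.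
exact: lower_bound_arith I1 I2 Ninv t0 t1 mphi_gt0.
Qed.

(** A single point [x0] replaces the words, at scale 1. All frequencies of the kernel have norm at
    most [n N], so the whole sum is in the low range: decay alone bounds the mass of [phi mu] near
    [x0]. *)
Lemma point_upper : sigma < n%:R -> exists2 CP, 0 <= CP & forall N, (0 < N)%N -> forall x0,
  pairing mu phi (fun x => fejer N (x - x0)) <=
    CP * N%:R ^- n * (n%:R * N%:R) `^ (n%:R - sigma).
Proof.
move=> sn.
pose C1 := CF * (2 * (4 ^+ n * down_const n sigma)).
have dc := @down_const_ge0 R n sigma sn.
have C10 : 0 <= C1 by rewrite /C1; do ?apply: mulr_ge0 => //; rewrite exprn_ge0.
exists (4 * mphi + C1); first by rewrite addr_ge0 // mulr_ge0.
move=> N N0 x0.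
have := pairing_fejer_le cphi phi0 phiB mu_tsupp [:: x0] 1 1 N0.
rewrite (_ : (fun x => _) = (fun x => fejer N (x - x0))); last first.
  by apply/funext => x; rewrite big_seq1 mul1r scale1r.
move=> h; apply: le_trans h _.
rewrite [(_ + _) * _]mulrC -mulrA ler_wpM2l ?invr_ge0 ?exprn_ge0 ?ler0n //.
set S := undup _.
have uS : uniq S by exact: undup_uniq.
have Q1 : 1 <= n%:R * N%:R :> R by rewrite -natrM ler1n muln_gt0 n0.
set P := _ `^ _.
have P1 : 1 <= P by apply: powR_ge1 => //; lra.
have a2 z : 0 <= cloud_hat [:: x0] 1 (ivec R z) <= 2.
  apply/andP; split; first exact: normc_ge0.
  by have := cloud_hat_le [:: x0] ler01 (ivec R z); rewrite /= !mulr1.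
rewrite (bigID (fun z => z == 0)) [leRHS]mulrDl; apply: lerD.
  apply: le_trans (zero_term uS _) _.
    by apply: mulr_ge0; [exact: normc_ge0|case/andP: (a2 0)].
  apply: le_trans (_ : 4 * mphi * 1 <= _); last by rewrite ler_wpM2l ?mulr_ge0.
  have /andP[a0 a2'] := a2 0; rewrite mulr1; apply: ler_pM_4 => //; first exact: normc_ge0.
  exact: (normc_fourier_le cphi phi0 phiB mu_tsupp mM muM).
have := low_part sn (lexx 1) Q1 uS a2; apply: le_trans.
rewrite big_seq_cond [leRHS]big_seq_cond le_eqVlt; apply/orP; left; apply/eqP.
apply: eq_bigl => z; case zS: (z \in S) => //=; case: (z != 0) => //=.
apply/esym; move: zS; rewrite mem_undup => h; apply: freq_enorm => i.
exact: fejer_freqs_bound h.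
Qed.

End Estimates.

(** * Share of words near a point *)

Section WordsLocal.
Variables (R : realType) (n p : nat) (D : {set 'rV['I_p]_n}).
Hypothesis p2 : (1 < p)%N.
Hypothesis n0 : (0 < n)%N.

Lemma pairing_dirac (a : 'rV[R]_n) (g : 'rV[R]_n -> R) : continuous g ->
  pairing (\d_(a : borelRn R n)) (cst 1) g = g a.
Proof.
move=> cg; rewrite /pairing /Rintegral integral_dirac //.
  by rewrite diracT mul1e /= mul1r.
apply/measurable_EFinP; apply: continuous_borel.
by under eq_fun do rewrite mul1r.
Qed.

(** Here [phi mu] is the Dirac mass at [a], whose transform is at most 2, so only the l1 bound at
    [theta = 0] acts. It limits the share of words near any point, which will force [D] to be
    large. *)
Lemma words_local (e C : R) : 0 <= e -> 0 <= C -> l1_bound D e C ->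
  forall N, (0 < N)%N -> exists m0, forall m, (m0 <= m)%N -> forall a : 'rV[R]_n,
  #|D|%:R ^- m * \sum_(z <- words D m) fejer N (a - wpoint R p m z) <=
  N%:R ^- n * (2 * C * (n%:R * N%:R) `^ e).
Proof.
move=> e0 C0 hl1 N N0.
have [m0 hm0] := hl1 (n%:R * N%:R).
exists m0 => m mm a; pose mu : {measure set (borelRn R n) -> \bar R} := \d_(a : borelRn R n).
pose phi : 'rV[R]_n -> R := cst 1.
have cphi : continuous phi by exact: cst_continuous.
have phi0 x : 0 <= phi x by rewrite ler01.
have phiB x : phi x <= 1 by [].
have mt : (mu (tsupp phi) < +oo)%E by rewrite /mu /= diracE ltry.
have mT : measurable ([set: 'rV[R]_n] : set (borelRn R n)) by exact: measurableT.
have muT : mu (~` [set: 'rV[R]_n]) = 0%E by rewrite setCT measure0.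
pose Y := [seq wpoint R p m z | z <- words D m].
have := pairing_fejer_le cphi phi0 phiB mt Y (#|D|%:R ^- m) 1 N0.
have aY : adm (fun x => #|D|%:R ^- m * \sum_(y <- Y) fejer N (1 *: x - y)).
  by apply: admM; [exact: adm_cst|apply: adm_sum => y; exact: adm_fejer].
rewrite /mu pairing_dirac; last by case: aY.
rewrite big_map scale1r => /le_trans; apply.
rewrite ler_wpM2l ?invr_ge0 ?exprn_ge0 ?ler0n //.
set S := undup _.
apply: le_trans (_ : \sum_(z <- S) 2 * word_hat D m (ivec R z + 0) <= _).
  apply: ler_sum => z _; rewrite cloud_hat_words addr0 ler_wpM2r ?normc_ge0 //.
  apply: le_trans (normc_fourier_le cphi phi0 phiB mt mT muT _) _.
  by rewrite /mu pairing_dirac ?mulr1 //; exact: cst_continuous.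
rewrite -mulr_sumr -mulrA ler_wpM2l //; apply: (hm0 m mm) => //.
- by move=> i; rewrite mxE lexx ler01.
- by rewrite -natrM ler1n muln_gt0 n0.
- exact: undup_uniq.
- move=> z; rewrite mem_undup => h; apply: freq_enorm => i; exact: fejer_freqs_bound h.
Qed.

End WordsLocal.

(** * A smooth bump function *)

Section Bump.
Variable R : realType.

(** The derivatives of [exp (-1/t)] extended by [0] are combinations of these. *)
Definition flat k (t : R) : R := if 0 < t then t ^- k * expR (- t^-1) else 0.

Lemma expR_ge_coeff (x : R) m : 0 <= x -> x ^+ m / m`!%:R <= expR x.
Proof.
move=> x0; apply: le_trans (_ : series (exp_coeff x) m.+1 <= _).
  rewrite /series /= big_nat_recr //= lerDr.
  by apply: sumr_ge0 => i _; exact: exp_coeff_ge0.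
apply: nondecreasing_cvgn_le; last exact: is_cvg_series_exp_coeff.
apply/nondecreasing_seqP => i; rewrite /series /= big_nat_recr //= lerDl.
exact: exp_coeff_ge0.
Qed.

Lemma flat_ge0 k t : 0 <= flat k t.
Proof.
by rewrite /flat; case: ifP => // t0; rewrite mulr_ge0 ?expR_ge0 // invr_ge0 exprn_ge0 // ltW.
Qed.

(** One term of the exponential series gives [exp (1/t) >= t^-(k+2) / (k+2)!]. The quadratic bound
    makes the difference quotient at 0 tend to 0. *)
Lemma flat_le_sqr k t : flat k t <= (k.+2)`!%:R * t ^+ 2.
Proof.
rewrite /flat; case: ifPn => [t0|_]; last by rewrite mulr_ge0 ?sqr_ge0 ?ler0n.
have F0 : 0 < (k.+2)`!%:R :> R by rewrite ltr0n fact_gt0.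
have V0 : 0 <= t^-1 by rewrite invr_ge0 ltW.
have := expR_ge_coeff k.+2 V0; rewrite exprVn ler_pdivrMr // => h.
rewrite expRN ler_pdivrMr ?expR_gt0 // mulrAC.
have -> : t ^- k = t ^- k.+2 * t ^+ 2.
  by rewrite -addn2 exprD invfM -mulrA mulVf ?mulr1 // expf_neq0 // gt_eqF.
by rewrite ler_wpM2r ?sqr_ge0 // mulrC.
Qed.

Lemma is_derive_flat (k : nat) (t : R) :
  is_derive (t : R) (1 : R) (flat k) (- k%:R * flat k.+1 t + flat k.+2 t).
Proof.
have [t0|t0|->] := ltgtP t 0.
- have e : \near t, cst 0 t = flat k t.
    near=> s; rewrite /flat ifF //; apply/negbTE; rewrite -leNgt ltW //.
    near: s; exact: lt_nbhsl.
  apply: (near_eq_is_derive e).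
  rewrite /flat !ifF ?mulr0 ?addr0; try by apply/negbTE; rewrite -leNgt ltW.
  exact: is_derive_cst.
- have e : \near t, (fun s => s ^- k * expR (- s^-1)) t = flat k t.
    near=> s; rewrite /flat ifT //; near: s; exact: lt_nbhsr.
  apply: (near_eq_is_derive e).
  rewrite /flat !t0.
  have tn : t != 0 by rewrite gt_eqF.
  have d1 : is_derive t 1 (fun s : R => s^-1) (- t ^- 2).
    have := @is_deriveV R id t 1 1 tn (is_derive_id _ _).
    by rewrite /= [_ *: _]mulr1.
  have d2 : is_derive t 1 (fun s => expR (- s^-1)) (expR (- t^-1) * t ^- 2).
    apply: (@is_derive1_comp R expR (fun s => - s^-1)).
    by rewrite -[t ^- 2]opprK; exact: is_deriveN.
  have d3 : is_derive t 1 (fun s => (s ^+ k)^-1) (- k%:R * t ^- k.+1).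
    have tk : t ^+ k != 0 by rewrite expf_neq0.
    have dX : is_derive (t : R) (1 : R) (fun s : R => s ^+ k) ((k%:R * t ^+ k.-1) *: (1 : R)).
      have -> : (fun s : R => s ^+ k) = (id : R -> R) ^+ k by rewrite exprfctE.
      exact: (@is_deriveX R R id k t 1 1 (is_derive_id _ _)).
    apply: (is_derive_eq (is_deriveV (f := fun s : R => s ^+ k) tk dX)).
    case: (k) tk => [|j] tk; first by rewrite mul0r mulr0n scale0r scaler0 oppr0 mul0r.
    rewrite [_%:A]mulr1 [_ *: _]mulrC /= !exprS.
    have : t ^+ j != 0 by rewrite expf_neq0.
    by move: (t ^+ j) => u un; field; rewrite tn un.
  apply: (is_derive_eq (is_deriveM d3 d2)).
  rewrite /GRing.scale /= !exprS.
  have : t ^+ k != 0 by rewrite expf_neq0.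
  by move: (t ^+ k) (expR _) => u w un; field; rewrite tn un.
have f0 j : flat j 0 = 0 by rewrite /flat ltxx.
rewrite !f0 mulr0 addr0.
have lim : (fun h : R => h^-1 *: (flat k (h *: 1 + 0) - flat k 0)) @ 0^' --> (0 : R).
  apply/cvgr0Pnorm_lt => e e0.
  have F0 : 0 < (k.+2)`!%:R :> R by rewrite ltr0n fact_gt0.
  near=> h.
  have hn : h != 0 by near: h; exact: nbhs_dnbhs_neq.
  have hn0 : 0 < `|h| by rewrite normr_gt0.
  rewrite f0 subr0 addr0 [_ *: 1]mulr1 [_ *: _]mulrC normrM normfV ger0_norm ?flat_ge0 //.
  rewrite ltr_pdivrMr //; apply: le_lt_trans (flat_le_sqr _ _) _.
  rewrite -real_normK ?num_real // expr2 mulrA ltr_pM2r // mulrC -ltr_pdivlMr //.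
  near: h; apply: dnbhs0_lt; exact: divr_gt0.
apply: DeriveDef; first by apply/cvg_ex; exists 0.
exact/cvg_lim.
Unshelve. all: by end_near. Qed.

(** A directional derivative is an ordinary derivative along a line, which brings in the
    one-variable rules. *)
Lemma is_derive_line (V : normedModType R) (f : V -> R) (x v : V) df :
  is_derive (0 : R) (1 : R) (fun t => f (t *: v + x)) df -> is_derive x v f df.
Proof.
case=> d1 d2.
have e : (fun h : R => h^-1 *: (f (h *: v + x) - f x)) =
  (fun h : R => h^-1 *: ((fun t => f (t *: v + x)) (h *: (1 : R) + 0) -
     (fun t => f (t *: v + x)) 0)).
  by apply/funext => h /=; rewrite addr0 [h *: 1]mulr1 scale0r add0r.
by split; [rewrite /derivable e | rewrite /derive e].
Qed.

Lemma continuous_flat k : continuous (flat k).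
Proof.
by move=> t; apply/differentiable_continuous/derivable1_diffP; case: (is_derive_flat k t).
Qed.

Variables (n : nat) (c : 'rV[R]_n) (r : R).
Let q (x : 'rV[R]_n) := r ^+ 2 - dotp (x - c) (x - c).

(** Closed under directional derivatives, whence smoothness. *)
Inductive bump_alg : ('rV[R]_n -> R) -> Prop :=
| BumpFlat k : bump_alg (fun x => flat k (q x))
| BumpMul w f : bump_alg f -> bump_alg (fun x => dotp (x - c) w * f x)
| BumpScale a f : bump_alg f -> bump_alg (fun x => a * f x)
| BumpAdd f g : bump_alg f -> bump_alg g -> bump_alg (fun x => f x + g x).

Lemma is_derive_q x v : is_derive x v q (- (2 * dotp (x - c) v)).
Proof.
apply: is_derive_line.
have -> : (fun t : R => q (t *: v + x)) =
   (fun t => q x - 2 * dotp (x - c) v * t - dotp v v * t ^+ 2).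
  apply/funext => t; rewrite /q -addrA; move: (x - c) => y.
  rewrite dotpDl !dotpDr !dotpZl (dotpC y) !dotpZl (dotpC v (t *: v)) dotpZl (dotpC v y); ring.
set A := 2 * _; set B := dotp v v.
have d1 : is_derive (0 : R) (1 : R) (fun t : R => A * t) A.
  apply: (is_derive_eq (is_deriveZ A (is_derive_id _ _))).
  by rewrite /GRing.scale /= mulr1.
have d2 : is_derive (0 : R) (1 : R) (fun t : R => B * t ^+ 2) 0.
  have dX : is_derive (0 : R) (1 : R) (fun t : R => t ^+ 2) 0.
    have -> : (fun s : R => s ^+ 2) = (id : R -> R) ^+ 2 by rewrite exprfctE.
    apply: (is_derive_eq (@is_deriveX R R id 2 0 1 1 (is_derive_id _ _))).
    by rewrite expr1 mulr0 scale0r.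
  by apply: (is_derive_eq (is_deriveZ B dX)); rewrite scaler0.
apply: (is_derive_eq (is_deriveB (is_deriveB (is_derive_cst (q x) _ _) d1) d2)).
by rewrite subr0 sub0r.
Qed.

Lemma continuous_q : continuous q.
Proof.
move=> x; apply: (@cvgB _ _ _ (nbhs x)); first exact: cvg_cst.
move: x; apply: continuous_big; first exact: add_continuous.
move=> i _ x; have h : {for x, continuous (fun y : 'rV[R]_n => (y - c) 0 i)}.
  have -> : (fun y : 'rV[R]_n => (y - c) 0 i) = (fun y => y 0 i - c 0 i).
    by apply/funext => y; rewrite !mxE.
  by apply: (@cvgB _ _ _ (nbhs x)); [exact: coord_continuous | exact: cvg_cst].
exact: (@cvgM _ _ (nbhs x) _ _ _ _ _ h h).
Qed.

Lemma is_derive_dotpc x v w : is_derive x v (fun x => dotp (x - c) w) (dotp v w).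
Proof.
apply: is_derive_line.
have -> : (fun t : R => dotp (t *: v + x - c) w) =
   (fun t => dotp (x - c) w + dotp v w * t).
  by apply/funext => t; rewrite -addrA dotpDl dotpZl [LHS]addrC [t * _]mulrC.
apply: (is_derive_eq (is_deriveD (is_derive_cst _ _ _) (is_deriveZ _ (is_derive_id _ _)))).
by rewrite add0r [_ *: _]mulr1.
Qed.

Lemma continuous_dotpc w : continuous (fun x : 'rV[R]_n => dotp (x - c) w).
Proof.
have -> : (fun x : 'rV[R]_n => dotp (x - c) w) = (fun x => dotp x w - dotp c w).
  by apply/funext => x; rewrite dotpBl.
by move=> x; apply: (@cvgB _ _ _ (nbhs x)); [exact: continuous_dotpl | exact: cvg_cst].
Qed.

Lemma bump_alg_continuous f : bump_alg f -> continuous f.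
Proof.
elim=> [k|w g _ IH|a g _ IH|g h _ IHg _ IHh] x.
- apply: (@continuous_comp _ _ _ q (flat k)); [exact: continuous_q | exact: continuous_flat].
- exact: (@cvgM _ _ (nbhs x) _ _ _ _ _ (@continuous_dotpc w x) (IH x)).
- exact: (@cvgM _ _ (nbhs x) _ _ _ _ _ (@cvg_cst _ _ _ _ _) (IH x)).
- exact: (@cvgD _ _ _ (nbhs x) _ _ _ _ _ (IHg x) (IHh x)).
Qed.

Lemma bump_alg_derive f v : bump_alg f ->
  exists2 g, bump_alg g & forall x, is_derive x v f (g x : R).
Proof.
elim=> [k|w g ag [g' ag' dg]|a g _ [g' ag' dg]|g h _ [g' ag' dg] _ [h' ah' dh]].
- exists (fun x => (-2) * (dotp (x - c) v * (- k%:R * flat k.+1 (q x) + flat k.+2 (q x)))).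
    by apply/BumpScale/BumpMul/BumpAdd; [apply: BumpScale|]; exact: BumpFlat.
  move=> x; apply: is_derive_line.
  have dl : is_derive (0 : R) (1 : R) (fun t => q (t *: v + x)) (- (2 * dotp (x - c) v)).
    have [d1 d2] := is_derive_q x v.
    have e : (fun h : R => h^-1 *: (q (h *: v + x) - q x)) =
      (fun h : R => h^-1 *: ((fun t => q (t *: v + x)) (h *: (1 : R) + 0) -
         (fun t => q (t *: v + x)) 0)).
      by apply/funext => h /=; rewrite addr0 [h *: 1]mulr1 scale0r add0r.
    by split; [rewrite /derivable -e | rewrite /derive -e].
  have q0 : q (0 *: v + x) = q x by rewrite scale0r add0r.
  have := is_derive_flat k (q (0 *: v + x)); rewrite {2 3}q0 => df.
  apply: (is_derive_eq (@is_derive1_comp R (flat k) (fun t => q (t *: v + x)) _ _ _ df dl)).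
  ring.
- exists (fun x => dotp (x - c) w * g' x + dotp v w * g x).
    by apply: BumpAdd; [exact: BumpMul | exact: BumpScale].
  move=> x; apply: (is_derive_eq (is_deriveM (is_derive_dotpc x v w) (dg x))).
  by rewrite /GRing.scale /= (mulrC (g x)).
- exists (fun x => a * g' x); first exact: BumpScale.
  by move=> x; exact: (is_deriveZ a (dg x)).
- exists (fun x => g' x + h' x); first exact: BumpAdd.
  by move=> x; exact: (is_deriveD (dg x) (dh x)).
Qed.

Lemma bump_alg_iter f vs : bump_alg f -> bump_alg (iter_derive vs (f : _ -> R^o)).
Proof.
elim: vs => //= v vs IH /IH af.
have [g ag dg] := bump_alg_derive v af.
suff -> : 'D_v (iter_derive vs (f : _ -> R^o)) = g by [].
by apply/funext => x; case: (dg x).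
Qed.

Lemma bump_alg_smooth f : bump_alg f -> smooth_on setT (f : _ -> R^o).
Proof.
move=> af vs x _; have ag := bump_alg_iter vs af; split.
  exact: (bump_alg_continuous ag).
by move=> v; have [g _ /(_ x)[]] := bump_alg_derive v ag.
Qed.

(** That is [exp (- 1 / (r^2 - |x - c|^2))] where [|x - c| < r], for [r > 0], and 0 elsewhere. *)
Definition smooth_bump (x : 'rV[R]_n) : R := flat 0 (q x).

Lemma bump_smooth : smooth_on setT (smooth_bump : _ -> R^o).
Proof. exact/bump_alg_smooth/BumpFlat. Qed.

Lemma bump_continuous : continuous smooth_bump.
Proof. exact/bump_alg_continuous/BumpFlat. Qed.

Lemma bump_ge0 x : 0 <= smooth_bump x. Proof. exact: flat_ge0. Qed.

Lemma bump_le1 x : smooth_bump x <= 1.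
Proof.
rewrite /smooth_bump /flat; case: ifP => [t0|_]; last exact: ler01.
by rewrite expr0 invr1 mul1r -expR0 ler_expR oppr_le0 invr_ge0 ltW.
Qed.

Hypothesis r0 : 0 < r.

Lemma bump_supp x : smooth_bump x != 0 -> enorm (x - c) < r.
Proof.
rewrite /smooth_bump /flat; case: ifP => [t0 _|_]; last by rewrite eqxx.
rewrite -(ltr_pXn2r (_ : 0 < 2)%N) ?nnegrE ?enorm_ge0 ?(ltW r0) //.
by rewrite sqr_enorm -subr_gt0.
Qed.

Lemma bump_lb x : enorm (x - c) <= r / 2 -> expR (- (2 / r ^+ 2)) <= smooth_bump x.
Proof.
move=> h; have h2 : r ^+ 2 / 2 <= q x.
  have : enorm (x - c) ^+ 2 <= (r / 2) ^+ 2.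
    by rewrite ler_pXn2r // nnegrE ?enorm_ge0 // divr_ge0 ?(ltW r0).
  rewrite sqr_enorm /q; nra.
have p0 : 0 < r ^+ 2 / 2 by rewrite divr_gt0 // exprn_gt0.
have q0 : 0 < q x := lt_le_trans p0 h2.
rewrite /smooth_bump /flat q0 expr0 invr1 mul1r ler_expR lerN2.
by rewrite -[leRHS]invf_div lef_pV2 // posrE.
Qed.

End Bump.

(** * Immersions *)

Lemma mulmx_bound (R : realType) (d n : nat) (A : 'M[R]_(d, n)) (x : 'rV[R]_d) :
  `|x *m A| <= (\sum_i \sum_j `|A i j|) * `|x|.
Proof.
apply: row_norm_le => [|j]; first by apply/mulr_ge0/normr_ge0/sumr_ge0 => i _; exact: sumr_ge0.
rewrite mxE; apply: le_trans (ler_norm_sum _ _ _) _; rewrite mulr_suml.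
apply: ler_sum => i _; rewrite normrM mulrC.
apply: ler_pM => //; last exact: coord_le_norm.
by rewrite (bigD1 j) //= lerDl sumr_ge0.
Qed.

Section StrictDiff.
Variables (R : realType) (d n : nat) (U : set 'rV[R]_d) (f : 'rV[R]_d -> 'rV[R]_n).
Hypotheses (oU : open U) (sf : smooth_on U f).

Let e (i : 'I_d) : 'rV[R]_d := delta_mx 0 i.

Definition partials (u : 'rV[R]_d) : 'M[R]_(d, n) :=
  \matrix_(i, j) ('D_(e i) f u) 0 j.

Lemma partials_entry_continuous u i j : U u ->
  {for u, continuous (fun v => partials v i j)}.
Proof.
move=> Uu; have -> : (fun v => partials v i j) =
    (fun M : 'rV[R]_n => M 0 j) \o (iter_derive [:: e i] f).
  by apply/funext => v; rewrite mxE.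
apply: continuous_comp; first by case: (sf [:: e i] Uu).
exact: coord_continuous.
Qed.

Lemma partials_near u0 eps : U u0 -> 0 < eps ->
  exists2 s, 0 < s & forall u, `|u - u0| <= s ->
    U u /\ forall i j, `|partials u i j - partials u0 i j| <= eps.
Proof.
move=> Uu0 eps0.
have nP : \forall u \near u0, forall ij : 'I_d * 'I_n,
    `|partials u ij.1 ij.2 - partials u0 ij.1 ij.2| <= eps.
  apply: (@filter_forall _ _ (fun (ij : 'I_d * 'I_n) u =>
    `|partials u ij.1 ij.2 - partials u0 ij.1 ij.2| <= eps) (nbhs u0)) => -[i j] /=.
  move/cvgrPdistC_le: (@partials_entry_continuous u0 i j Uu0); exact.
have nU : \forall u \near u0, U u by exact: open_nbhs_nbhs.
have [s /= s0 sB] := (nbhs_ballP _ _).1 (filterI nU nP).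
exists (s / 2); first exact: divr_gt0.
move=> u us; have [] := sB u.
  by rewrite -ball_normE /ball_ /= distrC (le_lt_trans us) // gtr_pMr // invf_lt1 // ltr1n.
by move=> ? h; split=> // i j; exact: (h (i, j)).
Qed.

Lemma is_derive_axis v i j (t : R) : U (t *: e i + v) ->
  is_derive t (1 : R) (fun s => f (s *: e i + v) 0 j) (partials (t *: e i + v) i j).
Proof.
move=> Uv; set x := t *: e i + v.
have [_ df] := sf nil Uv.
have eq : (fun h : R => h^-1 *: (f (h *: e i + x) 0 j - f x 0 j)) =
  (fun h : R => h^-1 *: ((fun s => f (s *: e i + v) 0 j) (h *: (1 : R) + t) -
     (fun s => f (s *: e i + v) 0 j) t)) :> (R -> R).
  by apply/funext => h /=; rewrite [h *: 1]mulr1 scalerDl -addrA.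
have dj := (derivable_mxP _ _ _).1 (df (e i)) 0 j.
rewrite /partials mxE (derive_mx (df (e i))) mxE.
by split; [rewrite /derivable -eq | rewrite /derive -eq].
Qed.

Lemma axis_mean_value v i j (h : R) : 0 <= h ->
  (forall t, 0 <= t <= h -> U (t *: e i + v)) ->
  exists2 t, 0 <= t <= h &
    f (h *: e i + v) 0 j - f v 0 j = partials (t *: e i + v) i j * h.
Proof.
move=> h0 Uh; pose g (s : R) := f (s *: e i + v) 0 j.
have dg (t : R) : 0 <= t <= h -> is_derive t (1 : R) g (partials (t *: e i + v) i j).
  by move=> th; apply: is_derive_axis; exact: Uh.
have [||t] := @MVT_segment R g (fun t => partials (t *: e i + v) i j) 0 h h0.
- by move=> t /[!in_itv] /= /andP[t0 th]; apply: dg; rewrite !ltW.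
- apply: derivable_within_continuous => t /[!in_itv] /= th.
  by case: (dg _ th).
rewrite in_itv /= => th; rewrite /g scale0r add0r subr0 => ->.
by exists t.
Qed.

Lemma axis_bound u0 s i j eps v w (h : R) :
  (forall u, `|u - u0| <= s -> U u) ->
  (forall u, `|u - u0| <= s -> `|partials u i j - partials u0 i j| <= eps) ->
  `|v - u0| <= s -> `|w - u0| <= s -> w = h *: e i + v ->
  `|f w 0 j - f v 0 j - h * partials u0 i j| <= eps * `|h|.
Proof.
move=> sU sP; wlog h0 : v w h / 0 <= h.
  move=> W vs ws E; have [h0|h0] := leP 0 h; first exact: W.
  have := W w v (- h) _ ws vs; rewrite normrN mulNr opprK => W'.
  have -> : f w 0 j - f v 0 j - h * partials u0 i j =
    - (f v 0 j - f w 0 j + h * partials u0 i j) by ring.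
  rewrite normrN.
  apply: W'; first by rewrite oppr_ge0 ltW.
  by rewrite E scaleNr addKr.
move=> vs ws E; rewrite {}E in ws *.
(* Sup-norm balls are convex: a point of the segment is a convex combination of its endpoints. *)
have inC t : 0 <= t <= h -> `|t *: e i + v - u0| <= s.
  move=> /andP[t0 th]; have [hz|hn] := eqVneq h 0.
    have -> : t = 0 by apply/le_anti; rewrite t0 andbT -hz.
    by rewrite scale0r add0r.
  have hp : 0 < h by rewrite lt_neqAle eq_sym hn.
  have -> : t *: e i + v - u0 = (1 - t / h) *: (v - u0) + (t / h) *: (h *: e i + v - u0).
    apply/rowP => k; rewrite !mxE; field; exact: hn.
  have a0 : 0 <= t / h by rewrite divr_ge0.
  have b0 : 0 <= 1 - t / h by rewrite subr_ge0 ler_pdivrMr // mul1r.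
  apply: le_trans (ler_normD _ _) _.
  apply: (le_trans (y := (1 - t / h) * s + t / h * s)).
    apply: lerD; rewrite normrZ ger0_norm //; [exact: (ler_wpM2l b0 vs)|exact: (ler_wpM2l a0 ws)].
  by rewrite -mulrDl subrK mul1r.
have [t th ->] := @axis_mean_value v i j h h0 (fun t th => sU _ (inC t th)).
rewrite [partials _ _ _ * _]mulrC -mulrBr normrM mulrC ler_wpM2r //; exact/sP/inC.
Qed.

Lemma strict_bound u0 s eps u v j : 0 <= eps -> 0 <= s ->
  (forall u, `|u - u0| <= s -> U u) ->
  (forall u i, `|u - u0| <= s -> `|partials u i j - partials u0 i j| <= eps) ->
  `|u - u0| <= s -> `|v - u0| <= s ->
  `|f u 0 j - f v 0 j - ((u - v) *m partials u0) 0 j| <= d%:R * eps * `|u - v|.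
Proof.
move=> eps0 s0 sU sP us vs.
(* Move from [v] to [u] one coordinate at a time. *)
pose w (k : nat) : 'rV[R]_d := \row_i (if (i < k)%N then u 0 i else v 0 i).
have ws k : `|w k - u0| <= s.
  apply: row_norm_le => // i; rewrite !mxE; case: ifP => _.
    by have := coord_le_norm (u - u0) i; rewrite !mxE => /le_trans -> .
  by have := coord_le_norm (v - u0) i; rewrite !mxE => /le_trans -> .
suff H k : (k <= d)%N -> `|f (w k) 0 j - f v 0 j - ((w k - v) *m partials u0) 0 j| <= k%:R * (eps * `|u - v|).
  have := H d (leqnn d); have -> : w d = u by apply/rowP => i; rewrite mxE ltn_ord.
  by rewrite mulrA.
elim: k => [_|k IH kd].
  have -> : w 0 = v by apply/rowP => i; rewrite mxE.
  by rewrite !subrr mul0mx mxE subr0 normr0 mul0r.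
pose i := Ordinal kd.
have E : w k.+1 = (u - v) 0 i *: e i + w k.
  apply/rowP => a; rewrite !mxE eqxx /= ltnS leq_eqVlt.
  have [->|ai] := eqVneq a i; first by rewrite /= eqxx ltnn mulr1 subrK.
  rewrite mulr0 add0r; suff -> : (a == k :> nat) = false by [].
  by apply/negbTE; apply: contra ai => /eqP ak; apply/eqP/val_inj.
have := axis_bound sU (fun u us => sP u i us) (ws k) (ws k.+1) E.
have := IH (ltnW kd).
have -> : (w k.+1 - v) *m partials u0 = (w k - v) *m partials u0 + (u - v) 0 i *: row i (partials u0).
  by rewrite E -addrA mulmxDl [LHS]addrC -scalemxAl /e -rowE.
rewrite [(_ + _ : 'rV__) 0 j]mxE [(_ *: _ : 'rV__) 0 j]mxE [row _ _ 0 j]mxE => B1 B2.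
set a := _ *m _ in B1 *; set c := _ * partials _ _ _ in B2 *.
have -> : f (w k.+1) 0 j - f v 0 j - (a 0 j + c) =
  (f (w k) 0 j - f v 0 j - a 0 j) + (f (w k.+1) 0 j - f (w k) 0 j - c) by ring.
apply: le_trans (ler_normD _ _) _.
rewrite -natr1 mulrDl mul1r lerD //; apply: le_trans B2 _.
by rewrite ler_wpM2l // coord_le_norm.
Qed.

(** Both points vary: differentiability at [u0] compares with [f u0] only and would not give
    two-sided Lipschitz bounds. Continuity of the partial derivatives supplies the uniformity. *)
Lemma strict_diff u0 eps : U u0 -> 0 < eps ->
  exists2 s, 0 < s & forall u v, `|u - u0| <= s -> `|v - u0| <= s ->
    U u /\ `|f u - f v - (u - v) *m partials u0| <= eps * `|u - v|.
Proof.
move=> Uu0 eps0; have e0 : 0 < eps / d.+1%:R by rewrite divr_gt0.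
have [s s0 h] := partials_near Uu0 e0.
exists s => // u v us vs; split; first by case: (h u us).
apply: row_norm_le => [|j]; first by rewrite mulr_ge0 // ltW.
have := strict_bound (j := j) (ltW e0) (ltW s0) (fun u us => (h u us).1)
  (fun u i us => (h u us).2 i j) us vs.
rewrite !mxE => /le_trans -> //; rewrite ler_wpM2r //.
by rewrite mulrCA ger_pMr // ler_pdivrMr // mul1r ler_nat.
Qed.

Lemma jacobian_partials u0 : U u0 -> 'J f u0 = partials u0.
Proof.
move=> Uu0.
suff H : 'd f u0 = mulmxr (partials u0) :> ('rV[R]_d -> 'rV[R]_n).
  rewrite /jacobian; apply/row_matrixP => i.
  by rewrite !rowE mul_rV_lin1 H.
apply: diff_unique.
  apply: (@bounded_linear_continuous _ _ _
    (mulmxr (partials u0) : {linear 'rV[R]_d -> 'rV[R]_n})); apply/linear_boundedP.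
  near=> r => x /=; apply: le_trans (mulmx_bound _ _) _.
  rewrite ler_wpM2r //; near: r; apply: nbhs_pinfty_ge; exact: num_real.
apply/eqaddoP => eps eps0.
have [s s0 h] := strict_diff Uu0 eps0.
apply: (filterS _ (nbhs0_le s0)) => x xs.
have := h (x + u0) u0; rewrite addrK subrr normr0 => /(_ xs (ltW s0)) [_].
by rewrite /= opprD addrA.
Unshelve. all: by end_near. Qed.

(** A right inverse [B] of the Jacobian gives [|x| <= K |x J|]; strict differentiability with
    [eps = 1 / (2K)] loses only half of this lower bound. *)
Lemma immersion_bilipschitz u0 : U u0 -> row_free ('J f u0) ->
  exists s c C : R, [/\ 0 < s, 0 < c, 0 < C &
    forall u v, `|u - u0| <= s -> `|v - u0| <= s ->
    [/\ U u, c * `|u - v| <= `|f u - f v| & `|f u - f v| <= C * `|u - v|]].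
Proof.
move=> Uu0; rewrite jacobian_partials //; set J := partials u0 => /row_freeP[B JB].
pose K := \sum_i \sum_j `|B i j| + 1; pose L := \sum_i \sum_j `|J i j|.
have B0 : 0 <= \sum_i \sum_j `|B i j| by apply: sumr_ge0 => i _; exact: sumr_ge0.
have K0 : 0 < K by rewrite /K ltr_wpDl.
have L0 : 0 <= L by apply: sumr_ge0 => i _; exact: sumr_ge0.
have e0 : 0 < (2 * K)^-1 by rewrite invr_gt0 mulr_gt0.
have [s s0 h] := strict_diff Uu0 e0.
exists s, (2 * K)^-1, (L + (2 * K)^-1); split => //; first by rewrite ltr_wpDl.
move=> u v us vs; have [Uu] := h u v us vs; split => //.
  have : `|u - v| <= K * `|(u - v) *m J|.
    rewrite -{1}[u - v]mulmx1 -JB mulmxA.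
    apply: le_trans (mulmx_bound _ _) _; rewrite ler_wpM2r // /K lerDl //.
  rewrite -ler_pdivrMl // => h1.
  have -> : f u - f v = (u - v) *m J + (f u - f v - (u - v) *m J) by rewrite [RHS]addrC subrK.
  apply: le_trans (lerB_normD _ _).
  have -> : (2 * K)^-1 * `|u - v| = K^-1 * `|u - v| - (2 * K)^-1 * `|u - v|.
    by field; exact: lt0r_neq0.
  exact: lerB.
rewrite -[f u - f v](subrK ((u - v) *m J)) addrC mulrDl.
apply: le_trans (ler_normD _ _) _; apply: lerD => //; exact: mulmx_bound.
Qed.

End StrictDiff.

Lemma dist_le_half (R : realType) (x y : R) : `|x - y| <= y / 2 ->
  y / 2 <= x /\ x <= y / 2 * 3.
Proof. by rewrite ler_norml => /andP[]; lra. Qed.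

(** * Positivity and continuity of the Gram density *)

Section Gram.
Variables (R : realType) (d n : nat).

Lemma gram_det_gt0 (A : 'M[R]_(d, n)) : row_free A -> 0 < \det (A *m A^T).
Proof.
move=> fA; set G := A *m A^T.
(* [- G] has no nonnegative eigenvalue, because [x G x^T] is the squared norm of [x A]. *)
have pos (x : 'rV[R]_d) t : 0 <= t -> x *m - G = t *: x -> x = 0.
  move=> t0 xG; have : dotp (x *m A) (x *m A) = - t * dotp x x.
    have e (m : nat) (y : 'rV[R]_m) : dotp y y = (y *m y^T) 0 0.
      by rewrite mxE; apply: eq_bigr => i _; rewrite mxE.
    rewrite !e trmx_mul mulmxA -(mulmxA x) -/G -[G]opprK mulmxN xG.
    by rewrite mulNmx -scalemxAl -scaleNr mxE.
  move=> E; have /eqP : dotp (x *m A) (x *m A) = 0.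
    by apply/le_anti; rewrite dotp_ge0 andbT E mulNr oppr_le0 mulr_ge0 // dotp_ge0.
  rewrite /dotp psumr_eq0 => [/allP h|i _]; last by rewrite -expr2 sqr_ge0.
  have : x *m A = 0.
    by apply/rowP => i; have := h i; rewrite mem_index_enum /= mulf_eq0 orbb [RHS]mxE => /(_ isT)/eqP.
  by move/row_free_inj : fA => inj; rewrite -[RHS](mul0mx _ A) => /inj.
(* The characteristic polynomial of [- G] has no root in [0, +oo[. *)
have -> : \det G = (char_poly (- G)).[0].
  have -> : - G = (-1) *: G by rewrite scaleN1r.
  rewrite horner_coef0 char_poly_det detZ mulrA -exprD addnn.
  by rewrite -mul2n exprM sqrrN expr1n expr1n mul1r.
have mon : char_poly (- G) \is monic by exact: char_poly_monic.
have [|N hN] := @poly_pinfty_gt_lc R (char_poly (- G)).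
  by rewrite (monicP mon).
have pb : 0 < (char_poly (- G)).[Num.max N 0].
  by apply: lt_le_trans (hN _ _); rewrite ?(monicP mon) // le_max lexx.
rewrite ltNge; apply/negP => p0.
have [||x /andP[x0 _]] := @poly_ivt R (char_poly (- G)) 0 (Num.max N 0).
- by rewrite le_max lexx orbT.
- by rewrite p0 ltW.
rewrite -eigenvalue_root_char => /eigenvalueP[v vG].
by rewrite (pos v x x0 vG) eqxx.
Qed.

Variables (U : set 'rV[R]_d) (f : 'rV[R]_d -> 'rV[R]_n).
Hypotheses (oU : open U) (sf : smooth_on U f).

Lemma gram_near u0 : U u0 -> row_free ('J f u0) ->
  exists s g1 g2 : R, [/\ 0 < s, 0 < g1, 0 < g2 & forall u, `|u - u0| <= s ->
    U u /\ g1 <= Num.sqrt (\det ('J f u *m ('J f u)^T)) <= g2].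
Proof.
move=> Uu0 fJ; pose g u : R := \det (partials f u *m (partials f u)^T).
have cg : {for u0, continuous g}.
  have sumc (I : finType) (F : I -> 'rV[R]_d -> R) :
      (forall i, {for u0, continuous (F i)}) -> {for u0, continuous (fun u => \sum_i F i u)}.
    by move=> cF; apply: (@cvg_big R I _ _ _ _ _ (nbhs u0)) => [|i _]; [exact: add_continuous | exact: cF].
  have prodc (I : finType) (F : I -> 'rV[R]_d -> R) :
      (forall i, {for u0, continuous (F i)}) -> {for u0, continuous (fun u => \prod_i F i u)}.
    by move=> cF; apply: (@cvg_big R I _ _ _ _ _ (nbhs u0)) => [|i _]; [exact: mul_continuous | exact: cF].
  have entry i k : {for u0, continuous (fun u => (partials f u *m (partials f u)^T) i k)}.
    have -> : (fun u => (partials f u *m (partials f u)^T) i k) =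
        (fun u => \sum_j partials f u i j * partials f u k j).
      by apply/funext => u; rewrite mxE; apply: eq_bigr => j _; rewrite [_^T _ _]mxE.
    apply: sumc => j.
    have ce a := @partials_entry_continuous R d n U f sf u0 a j Uu0.
    exact: (@cvgM _ _ (nbhs u0) _ _ _ _ _ (ce i) (ce k)).
  apply: sumc => s; apply: (@cvgM _ _ (nbhs u0)); first exact: cvg_cst.
  by apply: prodc => i; exact: entry.
have g0 : 0 < g u0 by rewrite /g -(jacobian_partials oU sf Uu0); exact: gram_det_gt0.
have e0 : 0 < g u0 / 2 by rewrite divr_gt0.
move/cvgrPdistC_le: (cg) => /(_ _ e0) ng.
have nU : nbhs u0 U by exact: open_nbhs_nbhs.
have [s s0 sB] := (nbhs_ballP u0 (U `&` [set u | `|g u - g u0| <= g u0 / 2])).1 (filterI nU ng).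
exists (s / 2), (Num.sqrt (g u0 / 2)), (Num.sqrt (g u0 / 2 * 3)); split.
- exact: divr_gt0.
- by rewrite sqrtr_gt0.
- by rewrite sqrtr_gt0 mulr_gt0.
move=> u us; have [|Uu] := sB u.
  by rewrite -ball_normE /ball_ /= distrC (le_lt_trans us) // gtr_pMr // invf_lt1 // ltr1n.
move=> gu0; split=> //; rewrite (jacobian_partials oU sf Uu) -/(g u).
have [gu gu2] := dist_le_half gu0.
by apply/andP; split; exact: ler_wsqrtr.
Qed.

End Gram.

(** * Surface measure *)

Section Iterated.
Variable R : realType.
Implicit Types (d : nat).

(** The integral of a nonnegative function is a supremum over the simple functions below it, so
    monotonicity holds without measurability; the inner integrals of [iterated_integral] are never
    shown to be measurable. *)
Lemma le_integralT (g h : R -> \bar R) : (forall t, 0 <= g t)%E ->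
  (forall t, g t <= h t)%E ->
  (\int[lebesgue_measure]_(t in [set: R]) g t <=
   \int[lebesgue_measure]_(t in [set: R]) h t)%E.
Proof.
move=> g0 gh; have h0 t : (0 <= h t)%E by exact: le_trans (g0 t) (gh t).
rewrite !ge0_integralTE //; apply: ereal_sup_le => _ [k kg <-].
by exists k => // t; exact: le_trans (kg t) (gh t).
Qed.

Lemma iterated_integral_ge0 d (g : 'rV[R]_d -> \bar R) :
  (forall u, 0 <= g u)%E -> (0 <= iterated_integral g)%E.
Proof.
by elim: d g => [|d IH] g g0 //=; apply: integral_ge0 => t _; exact: IH.
Qed.

Lemma le_iterated_integral d (g h : 'rV[R]_d -> \bar R) : (forall u, 0 <= g u)%E ->
  (forall u, g u <= h u)%E -> (iterated_integral g <= iterated_integral h)%E.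
Proof.
elim: d g h => [|d IH] g h g0 gh /=; first exact: gh.
by apply: le_integralT => t; [exact: iterated_integral_ge0 | exact: IH].
Qed.

Lemma iterated_integral0 d : iterated_integral (fun _ : 'rV[R]_d => 0%E) = 0%E.
Proof.
elim: d => [|d IH] //=; under eq_integral do rewrite IH.
exact: integral0.
Qed.

Lemma norm_row_mx_le d (t : R) (w : 'rV[R]_d) (v : 'rV[R]_(1 + d)) s : 0 <= s ->
  (`|row_mx (const_mx t) w - v| <= s) =
  (`|t - v 0 (lshift d 0)| <= s) && (`|w - rsubmx v| <= s).
Proof.
move=> s0; set u := row_mx _ _ - v.
have ul : u 0 (lshift d 0) = t - v 0 (lshift d 0) by rewrite !mxE (unsplitK (inl _)) mxE.
have ur i : u 0 (rshift 1 i) = (w - rsubmx v) 0 i by rewrite !mxE (unsplitK (inr _)).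
apply/idP/andP => [us|[ts ws]].
  split; first by rewrite -ul (le_trans (coord_le_norm _ _)).
  by apply: row_norm_le => // i; rewrite -ur (le_trans (coord_le_norm _ _)).
apply: row_norm_le => // i; case: (split_ordP i) => j ->.
  by rewrite (ord1 j) ul.
by rewrite ur (le_trans (coord_le_norm _ _)).
Qed.

(** Sup-norm balls are cubes and slice into cubes, so induction computes the integral. Two-sided
    bounds on the density of [mu] in a chart reduce everything to this case. *)
Lemma iterated_integral_cube d (v : 'rV[R]_d) (s C : R) : 0 <= s -> 0 <= C ->
  iterated_integral (fun u => (if `|u - v| <= s then C else 0)%:E) =
  (C * (2 * s) ^+ d)%:E.
Proof.
move=> s0 C0; elim: d v => [|d IH] v.
  rewrite /= mulr1 ifT //; apply: le_trans s0.
  by apply: row_norm_le => // -[].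
rewrite /=; pose a := (v : 'rV_(1 + d)) 0 (lshift d 0).
transitivity (\int[lebesgue_measure]_(t in [set: R])
    ((fun=> (C * (2 * s) ^+ d)%:E) \_ `[(a - s)%R, (a + s)%R]) t)%E.
  apply: eq_integral => t _; rewrite patchE.
  have -> : (t \in `[a - s, a + s]%classic) = (`|t - a| <= s).
    by rewrite mem_setE in_itv /= ler_distl.
  under eq_fun do rewrite (@norm_row_mx_le d t _ v) //.
  have [ta|ta] := boolP (`|t - a| <= s); last exact: iterated_integral0.
  by rewrite -(IH (rsubmx (v : 'rV_(1 + d)))).
rewrite -integral_mkcond integral_cst //= lebesgue_measure_itv /= lte_fin.
case: ifPn => h.
  by rewrite -EFinD -EFinM exprSr mulrA; congr (_ * _)%:E; ring.
have -> : s = 0 by apply/le_anti; rewrite s0 andbT; move: h; rewrite -leNgt; lra.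
by rewrite mule0 mulr0 expr0n mulr0.
Qed.

End Iterated.

Section Cubes.
Variables (R : realType) (n : nat).

Lemma closed_norm_ball (x0 : 'rV[R]_n) s : closed [set x | `|x - x0| <= s].
Proof.
have -> : [set x | `|x - x0| <= s] = (fun x => `|x - x0|) @^-1` [set t | t <= s] by [].
apply: closed_comp; last exact: closed_le.
move=> x _; apply: (@cvg_norm _ _ _ (nbhs x)).
by apply: (@cvgB _ _ _ (nbhs x)); [exact: cvg_id | exact: cvg_cst].
Qed.

Lemma compact_norm_ball (x0 : 'rV[R]_n) s : compact [set x | `|x - x0| <= s].
Proof.
apply: bounded_closed_compact; last exact: closed_norm_ball.
exists (`|x0| + s); split=> [|M' hM x /= xs]; first exact: num_real.
rewrite -[x](subrK x0) (le_trans (ler_normD _ _)) // addrC (le_trans _ (ltW hM)) //.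
by rewrite lerD2l.
Qed.

Lemma compact_borel (A : set 'rV[R]_n) : compact A -> measurable (A : set (borelRn R n)).
Proof. by move=> /(compact_closed (@norm_hausdorff _ _)); exact: closed_borel. Qed.

End Cubes.

(** * Mass of small pieces of a submanifold *)

Section LocalGeometry.
Variables (R : realType) (n d : nat) (M : set 'rV[R]_n).
Variable mu : {measure set (borelRn R n) -> \bar R}.
Hypotheses (hM : submanifold d M) (hmu : surface_measure d M mu).

Lemma chart_at x0 : M x0 -> exists (U : set 'rV[R]_d) (f : 'rV[R]_d -> 'rV[R]_n) u0 (s c C g1 g2 : R),
  [/\ local_parametrization M U f, f u0 = x0,
      [/\ 0 < s, 0 < c, 0 < C, 0 < g1 & 0 < g2],
      forall u v, `|u - u0| <= s -> `|v - u0| <= s ->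
        c * `|u - v| <= `|f u - f v| /\ `|f u - f v| <= C * `|u - v| &
      forall u, `|u - u0| <= s ->
        U u /\ g1 <= Num.sqrt (\det ('J f u *m ('J f u)^T)) <= g2].
Proof.
move=> /hM[U [f [lp [u0 Uu0 fu0]]]]; have [oU sf inj fr op] := lp.
have [s1 [c [C [s10 c0 C0 h1]]]] := immersion_bilipschitz oU sf Uu0 (fr _ Uu0).
have [s2 [g1 [g2 [s20 g10 g20 h2]]]] := gram_near oU sf Uu0 (fr _ Uu0).
exists U, f, u0, (Num.min s1 s2), c, C, g1, g2; split => //.
- by split=> //; rewrite lt_min s10.
- move=> u v; rewrite !le_min => /andP[us _] /andP[vs _].
  by have [] := h1 u v us vs.
- by move=> u; rewrite le_min => /andP[_ us]; exact: h2.
Qed.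

(** Collects what the argument uses of the geometry of [M] near a point: local compactness, mass
    [O(delta^d)] in small sets, and mass at least of order [t^d] near [x0]. The chart is
    bi-Lipschitz with density between [g1] and [g2], so everything is compared with cubes. *)
Lemma local_geometry x0 : M x0 -> exists (rho r1 C c : R),
  [/\ [/\ 0 < rho, 0 < r1, 0 <= C & 0 < c],
      compact (M `&` [set x | `|x - x0| <= rho]),
      forall B : set (borelRn R n), measurable B -> B `<=` M `&` [set x | `|x - x0| <= rho] ->
        forall a delta, 0 <= delta -> (forall x, B x -> `|x - a| <= delta) ->
        (mu B <= (C * delta ^+ d)%:E)%E &
      forall t, 0 < t -> t <= r1 -> exists B : set (borelRn R n),
        [/\ measurable B, B `<=` M `&` [set x | `|x - x0| <= t] &
            ((c * t ^+ d)%:E <= mu B)%E]].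
Proof.
move=> Mx0; have [U [f [u0 [s [c [C [g1 [g2 [lp fu0 [s0 c0 C0 g10 g20] bil gram]]]]]]]]] := chart_at Mx0.
have [oU sf inj fr op] := lp.
pose Q t := [set u : 'rV[R]_d | `|u - u0| <= t].
have cfQ t : t <= s -> compact (f @` Q t).
  move=> ts; apply: continuous_compact; last exact: compact_norm_ball.
  apply: continuous_in_subspaceT => u; rewrite inE => uQ.
  by have [] := sf [::] u (gram u (le_trans uQ ts)).1.
have QU : [set u | `|u - u0| < s] `<=` U by move=> u /= /ltW us; exact: (gram u us).1.
have oQ : open [set u : 'rV[R]_d | `|u - u0| < s].
  have -> : [set u : 'rV[R]_d | `|u - u0| < s] = ball u0 s.
    by apply/seteqP; split=> u; rewrite -ball_normE /ball_ /= distrC.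
  exact: ball_open.
(* A chart is open onto its image in [M]: near [x0] no point of [M] lies outside the image, so other
   sheets cannot accumulate there. *)
have [W oW fQW] := op _ oQ QU.
have Wx0 : W x0.
  suff : (M `&` W) x0 by case.
  by rewrite -fQW; exists u0 => //=; rewrite subrr normr0.
have [r r0 rW] := (nbhs_ballP _ _).1 (open_nbhs_nbhs (conj oW Wx0)).
have rho0 : 0 < r / 2 by rewrite divr_gt0.
have sub : M `&` [set x | `|x - x0| <= r / 2] `<=` f @` Q s.
  move=> x [Mx /= xr]; have : (M `&` W) x.
    split => //; apply: rW; rewrite -ball_normE /ball_ /= distrC (le_lt_trans xr) //.
    by rewrite gtr_pMr // invf_lt1 // ltr1n.
  by rewrite -fQW => -[u /= /ltW us <-]; exists u.
have fM t : t <= s -> f @` Q t `<=` M.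
  move=> ts _ [u uQ <-]; have Uu : U u := (gram u (le_trans uQ ts)).1.
  have [W' _ e] := op U oU (fun u h => h).
  suff : (M `&` W') (f u) by case.
  by rewrite -e; exists u.
(* The preimage of a set of radius [delta] lies in a cube of side [4 delta / c], and a cube of side
   [2 t / C] maps into the ball of radius [t]; [t <= s C] keeps that cube inside the chart. *)
exists (r / 2), (s * C), (g2 * (4 / c) ^+ d), (g1 * (2 / C) ^+ d); split.
- split => //; first exact: mulr_gt0.
    by rewrite mulr_ge0 ?(ltW g20) // exprn_ge0 // divr_ge0 // ltW.
  by rewrite mulr_gt0 // exprn_gt0 // divr_gt0.
- have -> : M `&` [set x | `|x - x0| <= r / 2] = f @` Q s `&` [set x | `|x - x0| <= r / 2].
    apply/seteqP; split=> x [h1 h2]; split=> //; first exact: sub.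
    exact: (fM s).
  by apply: compact_closedI; [exact: cfQ | exact: closed_norm_ball].
- move=> B mB BM a delta d0 Ba.
  have BQ : B `<=` f @` Q s by move=> x /BM /sub.
  have BU : B `<=` f @` U.
    by move=> x /BQ[u uQ <-]; exists u => //; exact: (gram u uQ).1.
  have [->|/set0P[b Bb]] := eqVneq B set0.
    by rewrite measure0 lee_fin mulr_ge0 ?exprn_ge0 // mulr_ge0 ?(ltW g20) // exprn_ge0 // divr_ge0 // ltW.
  rewrite (hmu.2 U f lp B mB BU).
  have [v vQ fvb] := BQ b Bb.
  have d1 : 0 <= 2 * delta / c by rewrite divr_ge0 ?(ltW c0) // mulr_ge0.
  apply: (le_trans (y := iterated_integral (fun u => (if `|u - v| <= 2 * delta / c then g2 else 0)%:E))).
    apply: le_iterated_integral => u.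
      by rewrite lee_fin mulr_ge0 // sqrtr_ge0.
    rewrite lee_fin indicE; case: (boolP (u \in _)) => [|_]; last first.
      by rewrite mul0r; case: ifP => // _; exact: ltW.
    rewrite inE => -[Uu /= Bfu]; have [u' u'Q fu'] := BQ _ Bfu.
    have uu : u' = u by apply: inj => //; rewrite inE //; exact: (gram u' u'Q).1.
    rewrite {}uu in u'Q fu'.
    rewrite mul1r ifT; first by have [_ /andP[]] := gram u u'Q.
    rewrite ler_pdivlMr // mulrC; apply: le_trans (bil u v u'Q vQ).1 _.
    rewrite fvb -(subrKA a) (le_trans (ler_normD _ _)) // mulr_natl mulr2n lerD //.
      exact: Ba.
    by rewrite distrC; exact: Ba.
  rewrite iterated_integral_cube // ?(ltW g20) // lee_fin -[leRHS]mulrA -exprMn.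
  by have -> : 2 * (2 * delta / c) = 4 / c * delta by field; exact: lt0r_neq0.
- move=> t t0 ts; have tCs : t / C <= s by rewrite ler_pdivrMr.
  have tC0 : 0 < t / C by rewrite divr_gt0.
  exists (f @` Q (t / C)); split.
  + by apply: compact_borel; exact: cfQ.
  + move=> x xQ; split; first exact: fM xQ.
    move: xQ => [u uQ <-] /=; rewrite -fu0.
    have uQs := le_trans uQ tCs.
    have h0 : `|u0 - u0| <= s by rewrite subrr normr0 ltW.
    apply: le_trans (bil u u0 uQs h0).2 _.
    by rewrite -ler_pdivlMl // mulrC.
  + rewrite (hmu.2 U f lp); last 2 first.
    * by apply: compact_borel; exact: cfQ.
    * by move=> _ [u uQ <-]; exists u => //; exact: (gram u (le_trans uQ tCs)).1.
    apply: (le_trans (y := iterated_integral (fun u => (if `|u - u0| <= t / C then g1 else 0)%:E))).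
      rewrite iterated_integral_cube ?(ltW tC0) ?(ltW g10) // lee_fin -[leLHS]mulrA -exprMn.
      by have -> : 2 / C * t = 2 * (t / C) by field; exact: lt0r_neq0.
    apply: le_iterated_integral => u; first by rewrite lee_fin; case: ifP => // _; exact: ltW.
    rewrite lee_fin; case: ifP => [uQ|_]; last by rewrite mulr_ge0 // sqrtr_ge0.
    have [Uu /andP[h _]] := gram u (le_trans uQ tCs).
    rewrite indicE mem_set ?mul1r //; split => //; by exists u.
Qed.

Lemma submanifold_borel : measurable (M : set (borelRn R n)).
Proof.
(* [M] is locally closed. *)
pose W := \bigcup_(W in [set W : set 'rV[R]_n | open W /\ closure M `&` W `<=` M]) W.
have -> : M = closure M `&` W.
  apply/seteqP; split=> [x Mx|x [cx [W' [_ h] W'x]]]; last exact: h.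
  split; first exact: subset_closure.
  have [rho [_ [_ [_ [[rho0 _ _ _] cM _ _]]]]] := local_geometry Mx.
  exists (ball x rho); last exact: ballxx.
  split; first exact: ball_open.
  move=> y [cy xy]; suff : (M `&` [set z | `|z - x| <= rho]) y by case.
  apply: (compact_closed (@norm_hausdorff _ _) cM).
  move=> V Vy; have := cy (V `&` ball x rho) (filterI Vy (open_nbhs_nbhs (conj (ball_open _ _) xy))).
  move=> [z [Mz [Vz]]]; rewrite -ball_normE /ball_ /= distrC => /ltW xz.
  by exists z.
apply: measurableI; first by apply: closed_borel; exact: closed_closure.
by apply: open_borel; apply: bigcup_open => W' [].
Qed.

End LocalGeometry.

(** * Hausdorff dimension *)

Section HausdorffUpper.
Variables (R : realType) (n p : nat) (D : {set 'rV['I_p]_n}).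
Hypotheses (p2 : (1 < p)%N) (D0 : (0 < #|D|)%N).

Lemma diam_bound (A : set 'rV[R]_n) b : 0 <= b ->
  (forall x y, A x -> A y -> enorm (x - y) <= b) -> 0 <= diam A <= b.
Proof.
move=> b0 h; rewrite /diam; have [->|/set0P[x Ax]] := eqVneq A set0.
  by rewrite setX0 image_set0 sup0 lexx.
have ub : ubound [set enorm (z.1 - z.2) | z in A `*` A] b by move=> _ [[y z] [Ay Az] <-]; exact: h.
have mem : [set enorm (z.1 - z.2) | z in A `*` A] (enorm (x - x)) by exists (x, x).
apply/andP; split.
  apply: le_trans (enorm_ge0 (x - x)) _; apply: sup_ubound => //.
  by exists b.
by apply: ge_sup => //; exists (enorm (x - x)).
Qed.

Lemma nneseries_le (u : nat -> \bar R) (x : \bar R) : (forall i, 0 <= u i)%E ->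
  (forall N, \sum_(0 <= i < N) u i <= x)%E -> (\sum_(0 <= i <oo) u i <= x)%E.
Proof.
by move=> u0 ux; apply: lime_le; [exact: is_cvg_nneseries | apply: nearW => N; exact: ux].
Qed.

Lemma nneseries_pairs (f : nat * nat -> \bar R) (e : nat -> nat * nat) :
  (forall q, 0 <= f q)%E -> set_bij setT setT e ->
  (\sum_(0 <= i <oo) f (e i) = \sum_(0 <= k <oo) \sum_(0 <= j <oo) f (k, j))%E.
Proof.
move=> f0 be; rewrite nneseries_esumT // -(@reindex_esum R _ _ setT setT e f be).
rewrite nneseries_esumT; last by move=> k; exact: nneseries_ge0.
under [RHS]eq_esum do rewrite nneseries_esumT //.
rewrite esum_esum //; congr (esum _ _); last by apply/funext => -[].
by apply/seteqP; split => -[].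
Qed.

Definition similarity_dim : R := ln #|D|%:R / ln p%:R.

Let lnp : 0 < ln p%:R :> R.
Proof. by rewrite ln_gt0 // ltr1n. Qed.

(** For [s] above the similarity dimension the ratio [#|D| p^(-s)] is below 1, so the [s]-sum of
    [#|D|^m] sets of size [O(p^-m)] tends to 0. *)
Lemma small_level (s eta delta A : R) : similarity_dim < s -> 0 < eta -> 0 < delta -> 0 <= A ->
  exists m, A * #|D|%:R ^+ m * (4 * n%:R * p%:R ^- m) `^ s <= eta /\
    4 * n%:R * p%:R ^- m <= delta.
Proof.
move=> hs eta0 delta0 A0.
have p0 : 0 < p%:R :> R by rewrite ltr0n ltnW.
have Dr0 : 0 < #|D|%:R :> R by rewrite ltr0n.
pose q : R := #|D|%:R * p%:R `^ (- s).
have q0 : 0 <= q by rewrite mulr_ge0 // powR_ge0.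
have q1 : q < 1.
  rewrite /q powRN ltr_pdivrMr ?powR_gt0 // mul1r.
  rewrite -[ltLHS]lnK ?posrE // /powR gt_eqF // ltr_expR.
  by rewrite -ltr_pdivrMr.
have E m : A * #|D|%:R ^+ m * (4 * n%:R * p%:R ^- m) `^ s = A * (4 * n%:R) `^ s * q ^+ m.
  have a0 : 0 <= 4 * n%:R :> R by rewrite mulr_ge0.
  have b0 : 0 <= p%:R ^- m :> R by rewrite invr_ge0 exprn_ge0.
  rewrite (powRM s a0 b0) powR_exprV ?ler0n //.
  by rewrite /q exprMn; ring.
pose B := A * (4 * n%:R) `^ s + 4 * n%:R + 1.
have B0 : 0 < B.
  by rewrite /B ltr_wpDl // addr_ge0 // mulr_ge0 // powR_ge0.
have e0 : 0 < Num.min eta delta / B by rewrite divr_gt0 // lt_min eta0.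
have c1 : q ^+ m @[m --> \oo] --> (0 : R) by apply: cvg_expr; rewrite ger0_norm.
have c2 : (p%:R^-1 : R) ^+ m @[m --> \oo] --> (0 : R).
  by apply: cvg_expr; rewrite ger0_norm ?invr_ge0 // invf_lt1 // ltr1n.
have [m [h1 h2]] : exists m, `|q ^+ m| < Num.min eta delta / B /\
    `|p%:R^-1 ^+ m : R| < Num.min eta delta / B.
  have [N _ hN] := filterI (cvgr0_norm_lt _ c1 _ e0) (cvgr0_norm_lt _ c2 _ e0).
  by exists N; exact: hN (leqnn N).
exists m; rewrite E.
rewrite ger0_norm ?exprn_ge0 // ltr_pdivlMr // lt_min in h1.
rewrite ger0_norm ?exprn_ge0 ?invr_ge0 // ltr_pdivlMr // lt_min exprVn in h2.
have qm := exprn_ge0 m q0; have pm : 0 <= p%:R ^- m :> R by rewrite invr_ge0 exprn_ge0.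
case/andP: h1 => h1 _; case/andP: h2 => _ h2.
split; [apply: le_trans (ltW h1) | apply: le_trans (ltW h2)]; rewrite mulrC ler_wpM2l //.
  by rewrite /B -addrA lerDl addr_ge0 // mulr_ge0.
by rewrite /B -addrA [leRHS]addrC -addrA lerDl addr_ge0 // mulr_ge0 // powR_ge0.
Qed.

Definition shift3 (f : {ffun 'I_n -> 'I_3}) : 'rV[int]_n := \row_i ((f i : nat)%:Z - 1).

(** A point of the closure may only be approximated from a neighbouring unit
    cell, hence the shifts. *)
Definition fat_centers (z : 'rV[int]_n) m : seq 'rV[R]_n :=
  [seq ivec R (z + shift3 f) + wpoint R p m w | f <- enum {ffun 'I_n -> 'I_3}, w <- words D m].

Lemma size_fat_centers z m : size (fat_centers z m) = (3 ^ n * #|D| ^ m)%N.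
Proof. by rewrite size_allpairs size_words // -cardE card_ffun !card_ord. Qed.

Lemma floor_near (x y : R) : `|x - y| < 1 ->
  exists a : 'I_3, Num.floor y = Num.floor x + ((a : nat)%:Z - 1).
Proof.
move=> h; set a := Num.floor y - Num.floor x.
have : -1 <= a <= 1.
  have := ge_floor x; have := floorD1_gt x; have := ge_floor y; have := floorD1_gt y.
  rewrite /a; move: (Num.floor x) (Num.floor y) => u v; rewrite !intrD /= => h1 h2 h3 h4.
  move: h; rewrite ltr_norml => /andP[h5 h6].
  have l : (u%:~R - 2 : R) < v%:~R by lra.
  have r : (v%:~R : R) < u%:~R + 2 by lra.
  have l' : u - 2 < v by rewrite -(ltr_int R) intrD.
  have r' : v < u + 2 by rewrite -(ltr_int R) intrD.
  lia.
move=> ha; have lt : (absz (a + 1)%R < 3)%N by lia.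
exists (Ordinal lt) => /=; rewrite /a in ha *; lia.
Qed.

(** Two errors of [p^-m]: one for replacing [x] by a point [y] of the digit set, one for truncating
    [y] after [m] digits. The integer parts of [x] and [y] may differ by 1 in each coordinate. *)
Lemma fat_cover (x : 'rV[R]_n) m : missing_digit_set R D 0 x ->
  exists2 c, c \in fat_centers (intpart x) m & `|x - c| <= 2 * p%:R ^- m.
Proof.
move=> cx; have p0 : 0 < p%:R :> R by rewrite ltr0n ltnW.
have pm0 : 0 < p%:R ^- m :> R by rewrite invr_gt0 exprn_gt0.
have pm1 : p%:R ^- m <= 1 :> R.
  by rewrite invf_le1 ?exprn_gt0 // exprn_ege1 // ler1n; lia.
have [y [hy]] := cx (ball x (p%:R ^- m)) (nbhsx_ballx x _ pm0).
rewrite -ball_normE /ball_ /= => xy.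
have /choice[a ha] : forall i, exists a : 'I_3, Num.floor (y 0 i) = Num.floor (x 0 i) + ((a : nat)%:Z - 1).
  move=> i; apply: floor_near; apply: lt_le_trans pm1; apply: le_lt_trans xy.
  by have := coord_le_norm (x - y) i; rewrite !mxE.
have iy : intpart y = intpart x + shift3 (finfun a).
  by apply/rowP => i; rewrite !mxE ffunE ha.
have hf : digit_set D 0 (fracpart y).
  rewrite /fracpart -/(ivec R _) -ivecN; exact: digit_setDz.
have [w wm hw] := digit_set_prefix m (fracpart01 y) hf.
exists (ivec R (intpart y) + wpoint R p m w).
  by rewrite iy; apply/allpairsP; exists (finfun a, w); split=> //=; rewrite mem_enum.
have -> : x - (ivec R (intpart y) + wpoint R p m w) = (x - y) + (fracpart y - wpoint R p m w).
  by rewrite /fracpart -/(ivec R _); apply/rowP => i; rewrite !mxE; ring.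
rewrite (le_trans (ler_normD _ _)) // mulr_natl mulr2n lerD ?(ltW xy) //.
apply: row_norm_le => [|i]; first exact: ltW.
have -> : (fracpart y - wpoint R p m w) 0 i = p%:R ^- m * (p%:R ^+ m *: fracpart y - ivec R w) 0 i.
  by rewrite /wpoint !mxE mulrBr mulKf // expf_neq0 // lt0r_neq0.
rewrite normrM ger0_norm ?(ltW pm0) // ger_pMr //.
by have /andP[h0 h1] := hw i; rewrite ger0_norm // ltW.
Qed.

(** The set is [Z^n]-periodic, hence unbounded: its unit cells are enumerated, and the cell numbered
    [k] is covered at a level that costs at most [eps / 2^(k+1)]. *)
Lemma hausdorff_measure_similarity s : 0 < s -> similarity_dim < s ->
  hausdorff_measure s (missing_digit_set R D 0) = 0%E.
Proof.
move=> s0 hs.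
have p0 : 0 < p%:R :> R by rewrite ltr0n ltnW.
suff H delta : 0 < delta -> hausdorff_premeasure s delta (missing_digit_set R D 0) = 0%E.
  rewrite /hausdorff_measure; apply/le_anti/andP; split.
    by apply: ge_ereal_sup => _ [delta d0 <-]; rewrite H.
  by apply: ereal_sup_ubound; exists (1 : R); [exact: ltr01 | exact: H].
move=> d0; apply/le_anti/andP; split; last first.
  by apply: le_ereal_inf_tmp => _ [U _ <-]; apply: nneseries_ge0 => i _ _; rewrite lee_fin powR_ge0.
apply/lee_addgt0Pr => eps eps0; rewrite add0e.
have /choice[m hm] : forall k : nat, exists m, (3 ^ n)%:R * #|D|%:R ^+ m * (4 * n%:R * p%:R ^- m) `^ s <= eps / (2 ^ k.+1)%:R /\ 4 * n%:R * p%:R ^- m <= delta.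
  by move=> k; apply: small_level => //; rewrite divr_gt0 // ltr0n expn_gt0.
have /card_esym/card_set_bijP[e be] := card_nat2.
(* [q] encodes a cell and a position in its list of centres; the remaining pairs get the empty set,
   of diameter 0, which adds nothing as [s > 0]. *)
pose V (q : nat * nat) : set 'rV[R]_n :=
  if (choice.unpickle q.1 : option 'rV[int]_n) is Some z then
    if (q.2 < size (fat_centers z (m q.1)))%N then
      [set x | `|x - nth 0 (fat_centers z (m q.1)) q.2| <= 2 * p%:R ^- m q.1]
    else set0
  else set0.
have Vd q x y : V q x -> V q y -> enorm (x - y) <= 4 * n%:R * p%:R ^- m q.1.
  rewrite /V; case: choice.unpickle => // z; case: ifP => // _ /= hx hy.
  apply: le_trans (enorm_le_row _) _; rewrite [4 * _]mulrC -mulrA ler_wpM2l //.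
  have -> : 4 * p%:R ^- m q.1 = 2 * p%:R ^- m q.1 + 2 * p%:R ^- m q.1 :> R by ring.
  rewrite -(subrKA (nth 0 (fat_centers z (m q.1)) q.2)) (le_trans (ler_normD _ _)) // lerD //.
  by rewrite distrC.
have b0 q : 0 <= 4 * n%:R * p%:R ^- m q :> R by rewrite mulr_ge0 // invr_ge0 exprn_ge0.
have Vdiam q : 0 <= diam (V q) <= 4 * n%:R * p%:R ^- m q.1 by apply: diam_bound => //; exact: Vd.
have V0 k j : ((3 ^ n * #|D| ^ m k)%N <= j)%N -> diam (V (k, j)) = 0.
  move=> hj; rewrite /V /=; case: choice.unpickle => [z|]; rewrite ?size_fat_centers ?ltnNge ?hj /=;
  by rewrite /diam setX0 image_set0 sup0.
apply: (le_trans (y := (\sum_(0 <= i <oo) (diam (V (e i)) `^ s)%:E)%E)).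
  apply: ereal_inf_lbound; exists (V \o e) => //; split=> [x Kx|i x y Vx Vy].
    have [c cL xc] := fat_cover (m (choice.pickle (intpart x))) Kx.
    pose q := (choice.pickle (intpart x), index c (fat_centers (intpart x) (m (choice.pickle (intpart x))))).
    have [i _ eq] : [set e i | i in setT] q by case: be => _ _; apply.
    exists i => //=; rewrite eq /V /= choice.pickleK index_mem cL /=.
    by rewrite nth_index.
  by apply: le_trans (Vd _ _ _ Vx Vy) _; case: (hm (e i).1).
rewrite (nneseries_pairs (f := fun q => (diam (V q) `^ s)%:E)) //; last first.
  by move=> q; rewrite lee_fin powR_ge0.
have inner k : (\sum_(0 <= j <oo) (diam (V (k, j)) `^ s)%:E <= (eps / (2 ^ k.+1)%:R)%:E)%E.
  apply: nneseries_le => [j|N]; first by rewrite lee_fin powR_ge0.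
  rewrite sumEFin lee_fin; apply: le_trans (hm k).1.
  rewrite -natrX -natrM.
  apply: (le_trans (y := \sum_(0 <= j < N | (j < 3 ^ n * #|D| ^ m k)%N) (4 * n%:R * p%:R ^- m k) `^ s)).
    rewrite [leRHS]big_mkcond /=; apply: ler_sum => j _; case: ifP => hj.
      by have /andP[h0 h1] := Vdiam (k, j); apply: ge0_ler_powR; rewrite ?nnegrE // ltW.
    by rewrite V0 ?powR0 ?gt_eqF // leqNgt hj.
  rewrite big_const_seq iter_addr addr0 [leRHS]mulr_natl ler_wpMn2l ?powR_ge0 //.
  rewrite -size_filter -[leqRHS](size_iota 0); apply: uniq_leq_size.
    by rewrite filter_uniq // iota_uniq.
  by move=> j; rewrite mem_filter mem_iota => /andP[].
apply: nneseries_le => [k|N]; first by apply: nneseries_ge0 => j _ _; rewrite lee_fin powR_ge0.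
apply: (le_trans (y := (\sum_(0 <= k < N) (eps / (2 ^ k.+1)%:R)%:E)%E)); first exact: lee_sum.
rewrite sumEFin lee_fin.
suff -> : \sum_(0 <= k < N) eps / (2 ^ k.+1)%:R = eps * (1 - (2 ^ N)%:R^-1).
  by rewrite ger_pMr // gerBl invr_ge0.
elim: N => [|N IH]; first by rewrite big_geq // expn0 invr1 subrr mulr0.
rewrite big_nat_recr //= IH expnS natrM; field.
by rewrite pnatr_eq0 expn_eq0.
Qed.

Lemma hausdorff_dim_le_similarity : hausdorff_dim (missing_digit_set R D 0) <= similarity_dim.
Proof.
have sD0 : 0 <= similarity_dim by rewrite divr_ge0 ?(ltW lnp) // ln_ge0 // ler1n.
apply/ler_addgt0Pr => eps eps0; apply: ge_inf.
  by exists 0 => s [/ltW].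
have h : similarity_dim < similarity_dim + eps by rewrite ltrDl.
have h0 := le_lt_trans sD0 h.
by split=> //; exact: hausdorff_measure_similarity.
Qed.

End HausdorffUpper.

(** * Points where the Fejer kernel is large *)

Section KernelNear.
Variable R : realType.
Implicit Types (x t : R) (n N : nat).

Lemma cos_ge_half x : `|x| <= 1 -> 1 / 2 <= cos x.
Proof.
move=> x1; have -> : x = (x / 2) *+ 2 by rewrite -mulr_natr divfK.
rewrite cos_mulr2n; have := cos2Dsin2 (x / 2); have := sin_lip (x / 2) 0.
rewrite sin0 !subr0 normrM [ `|2^-1|]ger0_norm // => h1.
have h2 : `|sin (x / 2)| <= 1 / 2 by apply: le_trans h1 _; rewrite mulrC; lra.
have : sin (x / 2) ^+ 2 <= (1 / 2) ^+ 2.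
  by rewrite -real_normK ?num_real // ler_pXn2r ?nnegrE.
move: (sin _) (cos _) => s c; lra.
Qed.

(** The sharp slope [2 / pi] is not sought: the mean value theorem gives slope 1/2 on [[0, 1]], and
    beyond 1 monotonicity suffices because [y / pi <= 1 / 2 <= sin 1]. *)
Lemma sin_ge_lin (y : R) : 0 <= y -> y <= pi / 2 -> y / pi <= sin y.
Proof.
move=> y0 yp; have p2 := pi_ge2 R; have p0 := pi_gt0 R.
have small (z : R) : 0 <= z -> z <= 1 -> z / 2 <= sin z.
  move=> z0 z1; have [|c] := @MVT_segment R (@sin R) (@cos R) 0 z z0.
    by apply: continuous_subspaceT; exact: continuous_sin.
  rewrite in_itv /= sin0 !subr0 => /andP[c0 cz] ->.
  rewrite mulrC ler_wpM2r // -[2^-1]mul1r; apply: cos_ge_half.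
  by rewrite ger0_norm // (le_trans cz).
have [y1|y1] := leP y 1.
  apply: le_trans (small y y0 y1); rewrite ler_wpM2l // lef_pV2 // posrE //.
apply: (le_trans (y := 1 / 2)).
  by rewrite ler_pdivrMr // mulrC mulrA mulr1.
apply: le_trans (small 1 ler01 (lexx _)) _; apply: ltW.
by rewrite ltr_sin // in_itv /=; lra.
Qed.

Lemma abs_sinDpi_int (x : R) (k : int) : `|sin (x + k%:~R * pi)| = `|sin x|.
Proof.
have H (m : nat) (y : R) : `|sin (y + m%:R * pi)| = `|sin y|.
  elim: m => [|m IH]; first by rewrite mul0r addr0.
  by rewrite -natr1 mulrDl mul1r addrA sinDpi normrN.
case: k => m; first exact: H.
by rewrite NegzE -(H m.+1 (x + _)) -addrA intrN mulNr addNr addr0.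
Qed.

Lemma Re_le_normc (z : R[i]) : complex.Re z <= normc z.
Proof.
case: z => a b; rewrite /normc /=; apply: le_trans (ler_norm a) _.
by rewrite -sqrtr_sqr ler_wsqrtr // lerDl sqr_ge0.
Qed.

Lemma dirichlet_near N t : 2 * pi * N%:R * `|t| <= 1 -> N%:R / 2 <= normc (dirichlet N t).
Proof.
move=> h; apply: le_trans (Re_le_normc _); rewrite /dirichlet Re_sum.
apply: (le_trans (y := \sum_(j < N) (1 / 2 : R))).
  by rewrite sumr_const card_ord -mulr_natr; lra.
apply: ler_sum => j _ /=; apply: cos_ge_half; apply: le_trans h.
have p0 := pi_ge0 R; have jN : (j%:R : R) <= N%:R by rewrite ler_nat ltnW.
rewrite !normrM [ `|2|]ger0_norm // [ `|pi|]ger0_norm // [ `|j%:R|]ger0_norm //.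
by rewrite -[leRHS]mulrA ler_wpM2l ?mulr_ge0 // ler_wpM2r.
Qed.

(** All angles in the Dirichlet sums are at most 1, so each term has real part at least 1/2. *)
Lemma fejer_near n N (t : 'rV[R]_n) : (0 < N)%N ->
  (forall i, 2 * pi * N%:R * `|t 0 i| <= 1) -> 4 ^- n <= fejer N t.
Proof.
move=> N0 h; rewrite /fejer -exprVn.
have -> : 4^-1 ^+ n = \prod_(i < n) (4^-1 : R) by rewrite prodr_const card_ord.
apply: ler_prod => i _; rewrite invr_ge0 ler0n /=.
have -> : (4^-1 : R) = (1 / 2) ^+ 2 by field.
rewrite ler_pXn2r ?nnegrE ?divr_ge0 ?normc_ge0 // ler_pdivlMr ?ltr0n //.
by rewrite mul1r mulrC; exact: dirichlet_near.
Qed.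

Lemma nearest_int (x : R) : exists k : int, `|x - k%:~R| <= 1 / 2.
Proof.
exists (Num.floor (x + 1 / 2)); have := ge_floor (x + 1 / 2); have := floorD1_gt (x + 1 / 2).
by rewrite intrD /= ler_norml => h1 h2; apply/andP; split; lra.
Qed.

(** Contrapositive of [fejer_far], with [|sin (pi u)| >= |u|] for the offset [u] from a nearest
    integer. *)
Lemma fejer_gt_near n N (t : 'rV[R]_n) (A : R) : (0 < N)%N -> 0 < A -> A ^- 2 < fejer N t ->
  exists w : 'rV[int]_n, forall i, `|t 0 i - (w 0 i)%:~R| <= A / N%:R.
Proof.
move=> N0 A0 h; have N0R : 0 < N%:R :> R by rewrite ltr0n.
have /choice[w hw] i := nearest_int (t 0 i).
exists (\row_i w i) => i; rewrite mxE ler_pdivlMr //.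
have hs : N%:R * `|sin (pi * t 0 i)| < A.
  rewrite ltNge; apply/negP => hA; move: h; apply/negP; rewrite -leNgt.
  exact: fejer_far hA.
apply: le_trans (ltW hs); rewrite mulrC ler_wpM2l ?(ltW N0R) //.
have p0 := pi_gt0 R.
have -> : pi * t 0 i = pi * (t 0 i - (w i)%:~R) + (w i)%:~R * pi by ring.
rewrite abs_sinDpi_int; move: (hw i); move: (t 0 i - _) => u hu.
wlog u0 : u hu / 0 <= u.
  move=> W; have [|/ltW u0] := leP 0 u; first exact: W.
  by rewrite -normrN -[X in _ <= X]normrN -sinN -mulrN; apply: W; rewrite ?normrN // oppr_ge0.
rewrite ger0_norm // in hu *.
have hp : 0 <= pi * u by rewrite mulr_ge0 // ltW.
have hq : pi * u <= pi / 2 by rewrite ler_wpM2l ?(ltW p0) // -[2^-1]mul1r.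
have := sin_ge_lin hp hq.
by rewrite mulrAC mulfV ?lt0r_neq0 // mul1r => /le_trans; apply; exact: ler_norm.
Qed.

End KernelNear.

(** * Localisation *)

Section PairingSets.
Variables (R : realType) (n : nat) (mu : {measure set (borelRn R n) -> \bar R}).
Variables (M : set 'rV[R]_n) (phi : 'rV[R]_n -> R).
Hypothesis cphi : continuous phi.
Hypothesis phi0 : forall x, 0 <= phi x.
Hypothesis phiB : forall x, phi x <= 1.
Hypothesis mu_tsupp : (mu (tsupp phi) < +oo)%E.
Hypothesis mM : measurable (M : set (borelRn R n)).
Hypothesis muM : mu (~` M) = 0%E.

Lemma EFin_pairing g : adm g ->
  (pairing mu phi g)%:E = (\int[mu]_(x in setT) (phi x * g x)%:E)%E.
Proof.
move=> ag; rewrite /pairing /Rintegral fineK //.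
exact: integrable_fin_num (adm_integrable cphi phi0 phiB mu_tsupp ag).
Qed.

Lemma pairing_ge_set g (B : set (borelRn R n)) c : adm g -> (forall x, 0 <= g x) ->
  measurable B -> 0 <= c -> (forall x, B x -> c <= phi x * g x) ->
  (c%:E * mu B <= (pairing mu phi g)%:E)%E.
Proof.
move=> ag g0 mB c0 h; rewrite EFin_pairing //.
have mf : measurable_fun setT (fun x : borelRn R n => (phi x * g x)%:E).
  apply/measurable_EFinP; apply: measurable_funM; first exact: continuous_borel.
  exact: (continuous_borel ag.1).
have f0 x : (0 <= (phi x * g x)%:E)%E by rewrite lee_fin mulr_ge0.
rewrite -integral_cst //.
apply: (le_trans (y := (\int[mu]_(x in B) (phi x * g x)%:E)%E)).
  by apply: ge0_le_integral => //=; exact: measurable_funTS.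
exact: ge0_subset_integral.
Qed.

Lemma pairing_le_set g (B : set (borelRn R n)) : adm g -> (forall x, 0 <= g x) -> measurable B ->
  (forall x, M x -> tsupp phi x -> g x <= \1_B x) ->
  ((pairing mu phi g)%:E <= mu B)%E.
Proof.
move=> ag g0 mB h; rewrite EFin_pairing //.
have mM' : measurable (~` M : set (borelRn R n)) by apply: measurableC.
have mf : measurable_fun setT (fun x : borelRn R n => (phi x * g x)%:E).
  apply/measurable_EFinP; apply: measurable_funM; first exact: continuous_borel.
  exact: (continuous_borel ag.1).
rewrite (negligible_integral mM' measurableT (adm_integrable cphi phi0 phiB mu_tsupp ag) muM).
rewrite setTD setCK.
apply: (le_trans (y := (\int[mu]_(x in M) (\1_B x)%:E)%E)).
  apply: ge0_le_integral => //=.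
  - by move=> x _; rewrite lee_fin mulr_ge0.
  - exact: measurable_funTS.
  - by apply/measurable_EFinP; exact: measurable_indic.
  move=> x Mx; rewrite lee_fin; have [ht|ht] := pselect (tsupp phi x).
    by rewrite -[leRHS]mul1r ler_pM // h.
  by rewrite phi_out // mul0r indicE.
rewrite integral_indic //; apply: le_measure; rewrite ?inE //.
  exact: measurableI.
Qed.

End PairingSets.

(** A cover of the exact intersection must also serve points of [X] that are merely close to [K].
    The part of [X] outside [O] is compact and misses the closed set [K], hence stays at positive
    distance; this distance dictates how fine the kernel must be in [local_cover]. *)
Lemma compact_separation (R : realType) (n : nat) (X K O : set 'rV[R]_n) :
  compact X -> closed K -> open O -> X `&` K `<=` O ->
  exists2 eta, 0 < eta & forall x y, X x -> K y -> `|x - y| <= eta -> O x.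
Proof.
move=> cX cK oO XKO; have cX' : compact (X `&` ~` O).
  by apply: compact_closedI => //; exact: open_closedC.
have /compact_near_coveringP nc := cX'.
have := nc R 0^'+ (fun eta x => forall y, K y -> `|x - y| <= eta -> False) _ _.
case=> [x [Xx nOx]|eta0 /= e0 heta].
  have nKx : ~ K x by move=> Kx; exact: nOx (XKO x (conj Xx Kx)).
  have [eps /= eps0 he] := (nbhs_ballP _ _).1 (open_nbhs_nbhs (conj (closed_openC cK) nKx)).
  near=> x' eta => y Ky xy; have etae : eta <= eps / 2.
    by near: eta; apply: nbhs_right_le; exact: divr_gt0.
  have xx : `|x - x'| < eps / 2 by near: x'; exact/cvgr_dist_lt/divr_gt0.
  apply: (he y) => //.
  rewrite -ball_normE /ball_ /= -(subrKA x') (le_lt_trans (ler_normD _ _)) //.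
  by rewrite (splitr eps) ltr_leD // (le_trans xy).
have e2 : 0 < eta0 / 2 by exact: divr_gt0.
exists (eta0 / 2) => // x y Xx Ky xy; apply: contrapT => nOx.
apply: (heta (eta0 / 2) _ e2 x (conj Xx nOx) y Ky xy).
by rewrite /ball_ /= sub0r normrN gtr0_norm // gtr_pMr // invf_lt1 // ltr1n.
Unshelve. all: by end_near. Qed.

Lemma fejer_le1 (R : realType) n N (t : 'rV[R]_n) : fejer N t <= 1.
Proof.
suff /andP[] : 0 <= fejer N t <= 1 by [].
apply: (big_ind (fun x : R => 0 <= x <= 1)) => [|x y /andP[x0 x1] /andP[y0 y1]|j _].
- by rewrite ler01 lexx.
- by rewrite mulr_ge0 //= mulr_ile1.
- exact: fejer_factor01.
Qed.

Lemma pow_between (R : realType) (p : nat) (x : R) : (1 < p)%N -> 1 <= x ->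
  exists k, p%:R ^+ k <= x < p%:R ^+ k.+1.
Proof.
move=> p2 x1; have h : exists k, x < p%:R ^+ k.
  have [N hN] := exists_pow2 x; exists N; apply: lt_le_trans hN _.
  by rewrite lerXn2r ?nnegrE // ler_nat.
case: (ex_minnP h) => -[|k] hk hmin; first by move: hk; rewrite expr0 ltNge x1.
exists k; rewrite hk andbT leNgt; apply/negP => /hmin; by rewrite ltnn.
Qed.

(** * Pieces on which the kernel can be large near a given centre *)

Section Windows.
Variables (R : realType) (n p : nat) (D : {set 'rV['I_p]_n}).
Hypothesis p2 : (1 < p)%N.

Let p0 : 0 < p%:R :> R. Proof. by rewrite ltr0n ltnW. Qed.

(** The constant makes the kernel at most [kappa] elsewhere. *)
Definition near_lattice (t : 'rV[R]_n) (N : nat) : Prop :=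
  exists w : 'rV[int]_n, forall i, `|t 0 i - (w 0 i)%:~R| <= (2 ^ n.+2)%:R / N%:R.

(** The main term for [F_N^2] is [2^-n N^-n] times the mass, while the pairing with [F_N] is only
    bounded by about [4 N^-n] times it; the 8 preserves half of the main term. Away from the lattice
    the kernel is at most [2^(-2n-4)], which is below [kappa]. *)
Definition kappa : R := 2 ^- n / 8.

Lemma fejer_sqr_far N t : (0 < N)%N -> ~ near_lattice t N ->
  fejer N t ^+ 2 <= kappa * fejer N t.
Proof.
move=> N0 nt; rewrite expr2 ler_wpM2r ?fejer_ge0 // leNgt; apply/negP => h; apply: nt.
have A0 : 0 < (2 ^ n.+2)%:R :> R by rewrite ltr0n expn_gt0.
apply: (fejer_gt_near N0 A0).
apply: le_lt_trans h; rewrite /kappa natrX -exprM.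
have -> : (n.+2 * 2 = n + (n + 4))%N by lia.
rewrite exprD invfM ler_wpM2l ?invr_ge0 ?exprn_ge0 //.
have -> : (8 : R) = 2 ^+ 3 by rewrite !exprS expr0; ring.
by rewrite lef_pV2 ?posrE ?exprn_gt0 // ler_weXn2l ?ler1n //; lia.
Qed.

Lemma fejer_sqr_le N (t : 'rV[R]_n) : fejer N t ^+ 2 <= kappa * fejer N t + fejer N t.
Proof.
apply: (le_trans (y := fejer N t)); first by rewrite expr2 ler_piMl ?fejer_ge0 ?fejer_le1.
by rewrite lerDr mulr_ge0 ?fejer_ge0 // /kappa divr_ge0 // invr_ge0 exprn_ge0.
Qed.

(** The word [z] is completed by the tail [y0] to a point of the digit set, translated by [w] and
    contracted by [p^-l], which leaves the digits before position [l] unconstrained. *)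
Lemma near_lattice_point l m N (x y0 : 'rV[R]_n) z : (forall i, 0 <= y0 0 i < 1) ->
  digit_set D 0 y0 -> z \in words D m -> (0 < N)%N ->
  near_lattice (p%:R ^+ l *: x - wpoint R p m z) N ->
  exists2 y, digit_set D l y & `|x - y| <= p%:R ^- l * ((2 ^ n.+2)%:R / N%:R + p%:R ^- m).
Proof.
move=> y01 hy zm N0 [w hw].
have pl0 : 0 < p%:R ^- l :> R by rewrite invr_gt0 exprn_gt0.
have pm0 : 0 < p%:R ^- m :> R by rewrite invr_gt0 exprn_gt0.
have A0 : 0 <= (2 ^ n.+2)%:R / N%:R :> R by rewrite divr_ge0.
have [_ hd] := digit_set_word p2 y01 hy zm.
exists (p%:R ^- l *: (wpoint R p m z + p%:R ^- m *: y0 + ivec R w)).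
  by apply: digit_set_scale => //; exact: digit_setDz.
apply: row_norm_le => [|i]; first by rewrite mulr_ge0 ?(ltW pl0) // addr_ge0 // ltW.
set y := _ *: _.
have -> : (x - y) 0 i = p%:R ^- l *
    (((p%:R ^+ l *: x - wpoint R p m z) 0 i - (w 0 i)%:~R) - p%:R ^- m * y0 0 i).
  rewrite /y !mxE; move: (p%:R ^- m * _) (p%:R ^- m * _) => u v.
  have := lt0r_neq0 (exprn_gt0 l p0); move: (p%:R ^+ l) => a an; field; exact: an.
rewrite normrM ger0_norm ?(ltW pl0) // ler_wpM2l ?(ltW pl0) //.
apply: le_trans (ler_normB _ _) _; rewrite lerD // normrM ger0_norm ?(ltW pm0) //.
have /andP[h0 h1] := y01 i; rewrite ger_pMr // ger0_norm //; exact: ltW.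
Qed.

(** Three errors at scale [p^(-k-l)]: [B] for [x - c], [A2] for the width of the kernel, 1 for the
    digits after the first [k]. *)
Lemma near_lattice_word l k m N (x c : 'rV[R]_n) v z (B A2 : nat) : z \in words D m ->
  (0 < N)%N -> (p ^ k * 2 ^ n.+2 <= N * A2)%N -> p%:R ^+ (k + l) * `|x - c| <= B%:R ->
  near_lattice (p%:R ^+ l *: x - wpoint R p (k + m) ((p ^ m)%:Z *: v + z)) N ->
  near_word p k (p%:R ^+ l *: c) (B + A2 + 1) v.
Proof.
move=> zm N0 hN hB [w hw]; exists w => i.
have N0R : 0 < N%:R :> R by rewrite ltr0n.
have pk0 : 0 < p%:R ^+ k :> R by rewrite exprn_gt0.
have pm0 : 0 < p%:R ^+ m :> R by rewrite exprn_gt0.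
have := hw i; rewrite wpointD //; set u := wpoint R p m z.
have u01 : `|u 0 i| <= 1.
  rewrite /u /wpoint !mxE normrM ger0_norm ?invr_ge0 ?(ltW pm0) // mulrC ler_pdivrMr // mul1r.
  have /andP[z0 z1] := words_bound p2 i zm; rewrite ger0_norm ?ler0z //.
  by rewrite -natrX -[X in _ <= X]/((p ^ m)%:Z%:~R) ler_int ltW.
have vE : wpoint R p k v 0 i = p%:R ^- k * (v 0 i)%:~R by rewrite !mxE.
have E (a b : R) (f g h : 'rV[R]_n) :
  (a *: f - (g + b *: h)) 0 i = a * f 0 i - (g 0 i + b * h 0 i) by rewrite !mxE.
have E' : (p%:R ^+ l *: c) 0 i = p%:R ^+ l * c 0 i by rewrite mxE.
rewrite E vE E' => hi.
have xc : p%:R ^+ (k + l) * `|x 0 i - c 0 i| <= B%:R.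
  apply: le_trans hB; rewrite ler_wpM2l ?exprn_ge0 ?(ltW p0) //.
  by have := coord_le_norm (x - c) i; rewrite !mxE.
have hA : p%:R ^+ k * ((2 ^ n.+2)%:R / N%:R) <= A2%:R :> R.
  by rewrite mulrA ler_pdivrMr // -natrX -!natrM ler_nat mulnC [X in (_ <= X)%N]mulnC mulnC.
have -> : p%:R ^+ k * (p%:R ^+ l * c 0 i) - (v 0 i)%:~R - p%:R ^+ k * (w 0 i)%:~R =
  - (p%:R ^+ (k + l) * (x 0 i - c 0 i)) +
  p%:R ^+ k * (p%:R ^+ l * x 0 i - (p%:R ^- k * (v 0 i)%:~R + p%:R ^- k * u 0 i) - (w 0 i)%:~R) +
  u 0 i.
  rewrite exprD; have := lt0r_neq0 pk0; move: (p%:R ^+ k) (p%:R ^+ l) => a b an.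
  field; exact: an.
rewrite !natrD; apply: le_trans (ler_normD _ _) _; apply: lerD => //.
apply: le_trans (ler_normD _ _) _; apply: lerD.
  by rewrite normrN normrM ger0_norm // exprn_ge0 // ltW.
rewrite normrM ger0_norm ?(ltW pk0) //; apply: le_trans hA.
by rewrite ler_wpM2l ?(ltW pk0).
Qed.

Definition window_words k l (c : 'rV[R]_n) (A : nat) :=
  [seq v <- words D k | `[< near_word p k (p%:R ^+ l *: c) A v >]].

(** Outside the window [F_N^2 <= kappa F_N]; inside it [F_N^2 <= F_N] is enough. So near [c] a
    positive excess can come only from the pieces in the window of [c], whose number is bounded. *)
Lemma window_le l k m N (x c : 'rV[R]_n) (B A2 : nat) :
  (0 < N)%N -> (p ^ k * 2 ^ n.+2 <= N * A2)%N -> p%:R ^+ (k + l) * `|x - c| <= B%:R ->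
  \sum_(z <- words D (k + m)) fejer N (p%:R ^+ l *: x - wpoint R p (k + m) z) ^+ 2 <=
  kappa * (\sum_(z <- words D (k + m)) fejer N (p%:R ^+ l *: x - wpoint R p (k + m) z)) +
  \sum_(v <- window_words k l c (B + A2 + 1)) \sum_(z <- words D m)
    fejer N (p%:R ^+ l *: x - wpoint R p (k + m) ((p ^ m)%:Z *: v + z)).
Proof.
move=> N0 hN hB; rewrite !sum_wordsD /window_words big_filter mulr_sumr.
rewrite [X in _ + X]big_mkcond -big_split /=; apply: ler_sum => v _.
have -> : (if `[< near_word p k (p%:R ^+ l *: c) (B + A2 + 1) v >] then
    \sum_(z <- words D m) fejer N (p%:R ^+ l *: x - wpoint R p (k + m) ((p ^ m)%:Z *: v + z)) else 0) =
  \sum_(z <- words D m) (if `[< near_word p k (p%:R ^+ l *: c) (B + A2 + 1) v >] then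
    fejer N (p%:R ^+ l *: x - wpoint R p (k + m) ((p ^ m)%:Z *: v + z)) else 0).
  by case: ifP => // _; rewrite big1.
rewrite mulr_sumr -big_split big_seq [leRHS]big_seq /=; apply: ler_sum => z zm.
case: ifP => [_|/asboolPn h]; first exact: fejer_sqr_le.
by rewrite addr0; apply: fejer_sqr_far => // hn; apply: h; exact: near_lattice_word hn.
Qed.

Lemma window_far l m N (x : 'rV[R]_n) : (0 < N)%N ->
  (forall z, z \in words D m -> ~ near_lattice (p%:R ^+ l *: x - wpoint R p m z) N) ->
  \sum_(z <- words D m) fejer N (p%:R ^+ l *: x - wpoint R p m z) ^+ 2 <=
  kappa * (\sum_(z <- words D m) fejer N (p%:R ^+ l *: x - wpoint R p m z)).
Proof.
move=> N0 h; rewrite mulr_sumr big_seq [leRHS]big_seq; apply: ler_sum => z zm.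
by apply: fejer_sqr_far => //; exact: h.
Qed.

End Windows.

(** * Lower bounds for covers near a point *)

Lemma sum3_le k a b c : [/\ a <= k + (a + b + c), b <= a + b + c & c <= k + (a + b + c)]%N.
Proof. by split; lia. Qed.

Section LocalLower.
Variables (R : realType) (n p : nat) (D : {set 'rV['I_p]_n}).
Hypothesis p2 : (1 < p)%N.
Hypothesis n0 : (0 < n)%N.
Hypothesis D0 : (0 < #|D|)%N.
Variable y0 : 'rV[R]_n.
Hypotheses (y01 : forall i, 0 <= y0 0 i < 1) (dy0 : digit_set D 0 y0).
Variable (mu : {measure set (borelRn R n) -> \bar R}).
Variables (M : set 'rV[R]_n) (phi : 'rV[R]_n -> R).
Hypothesis cphi : continuous phi.
Hypothesis phi0 : forall x, 0 <= phi x.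
Hypothesis phiB : forall x, phi x <= 1.
Hypothesis mu_tsupp : (mu (tsupp phi) < +oo)%E.
Hypothesis mM : measurable (M : set (borelRn R n)).
Hypothesis muM : mu (~` M) = 0%E.
Hypothesis cX : compact (M `&` tsupp phi).
Let X := M `&` tsupp phi.
Let mphi := pairing mu phi (cst 1).
Hypothesis mphi_gt0 : 0 < mphi.
Variable l : nat.
Hypothesis main : forall N, (0 < N)%N -> exists m0, forall m, (m0 <= m)%N ->
  mphi * 2 ^- n / 4 * N%:R ^- n <=
  pairing mu phi (fun x => #|D|%:R ^- m * \sum_(z <- words D m)
    fejer N (p%:R ^+ l *: x - wpoint R p m z) ^+ 2) -
  2 ^- n / 8 * pairing mu phi (fun x => #|D|%:R ^- m * \sum_(z <- words D m)
    fejer N (p%:R ^+ l *: x - wpoint R p m z)).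

Let p0 : 0 < p%:R :> R. Proof. by rewrite ltr0n ltnW. Qed.
Let Dr0 : 0 < #|D|%:R :> R. Proof. by rewrite ltr0n. Qed.

Definition covers (r : R) (s : seq 'rV[R]_n) (F : set 'rV[R]_n) :=
  F `<=` [set x | exists2 c, c \in s & enorm (x - c) <= r].

Lemma pairing_window N m (G : 'rV[R]_n -> R) : adm G ->
  (forall x, X x -> \sum_(z <- words D m) fejer N (p%:R ^+ l *: x - wpoint R p m z) ^+ 2 <=
    kappa R n * (\sum_(z <- words D m) fejer N (p%:R ^+ l *: x - wpoint R p m z)) + G x) ->
  pairing mu phi (fun x => #|D|%:R ^- m * \sum_(z <- words D m)
    fejer N (p%:R ^+ l *: x - wpoint R p m z) ^+ 2) -
  2 ^- n / 8 * pairing mu phi (fun x => #|D|%:R ^- m * \sum_(z <- words D m)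
    fejer N (p%:R ^+ l *: x - wpoint R p m z)) <= #|D|%:R ^- m * pairing mu phi G.
Proof.
move=> aG h; have w0 : 0 <= #|D|%:R ^- m :> R by rewrite invr_ge0 exprn_ge0.
have a1 : adm (fun x => #|D|%:R ^- m * \sum_(z <- words D m) fejer N (p%:R ^+ l *: x - wpoint R p m z)).
  by apply: admM; [exact: adm_cst|apply: adm_sum => z; exact: adm_fejer].
have a2 : adm (fun x => #|D|%:R ^- m * \sum_(z <- words D m) fejer N (p%:R ^+ l *: x - wpoint R p m z) ^+ 2).
  by apply: admM; [exact: adm_cst|apply: adm_sum => z; exact: adm_fejer2].
rewrite -(pairingZ cphi phi0 phiB mu_tsupp _ a1) -(pairingZ cphi phi0 phiB mu_tsupp _ aG).
rewrite lerBlDl -(pairingD cphi phi0 phiB mu_tsupp); last 2 first.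
  by apply: admM; [exact: adm_cst|].
  by apply: admM; [exact: adm_cst|].
apply: (pairing_le cphi phi0 phiB mu_tsupp mM muM) => //.
  by apply: admD; apply: admM => //; exact: adm_cst.
move=> x Mx tx; rewrite mulrCA -mulrDr ler_wpM2l //; exact: h.
Qed.

Lemma mem_le_sum (T : eqType) (s : seq T) (F : T -> R) c : (forall i, 0 <= F i) -> c \in s ->
  F c <= \sum_(i <- s) F i.
Proof. by move=> F0 cs; rewrite (big_rem c) //= lerDl sumr_ge0. Qed.

Lemma sum_const_seq (T : Type) (s : seq T) (a : R) : \sum_(i <- s) a = (size s)%:R * a.
Proof. by rewrite big_const_seq count_predT iter_addr addr0 mulr_natl. Qed.

Lemma card_powR k : #|D|%:R ^+ k = (p%:R ^+ k) `^ similarity_dim R D :> R.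
Proof.
have lnp : ln p%:R != 0 :> R by rewrite gt_eqF // ln_gt0 // ltr1n.
rewrite powR_exprn ?(ltW p0) //; congr (_ ^+ k).
by rewrite /powR gt_eqF // /similarity_dim divfK // lnK // posrE.
Qed.

(** A ball of radius [r] meets at most [10^n] pieces of level [k], where
    [p^(-k-l)] is comparable to [r]. *)
Lemma local_cover (CB sigma : R) : 0 <= CB -> 0 < similarity_dim R D - (n%:R - sigma) ->
  (forall k N, (0 < N)%N -> exists m0, forall m v, (m0 <= m)%N ->
    pairing mu phi (fun x => #|D|%:R ^- m *
      \sum_(y <- piece_cloud R D k v m) fejer N (p%:R ^+ l *: x - y)) <=
    CB * N%:R ^- n * (p%:R ^+ k) `^ (n%:R - sigma)) ->
  exists c r0 : R, [/\ 0 < c, 0 < r0 & forall r s, 0 < r -> r < r0 ->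
    covers r s (X `&` missing_digit_set R D l) ->
    c * r `^ (- (similarity_dim R D - (n%:R - sigma))) <= (size s)%:R].
Proof.
move=> CB0 tau0 piece; set tau := _ - (_ - _) in tau0 *.
have pl0 : 0 < p%:R ^+ l :> R by rewrite exprn_gt0.
pose K1 : R := mphi * 2 ^- n / 4.
have K10 : 0 < K1 by rewrite divr_gt0 // mulr_gt0 // invr_gt0 exprn_gt0.
(* [10 = 2 * 4 + 2] is the window count for the radius [4 = 2 + 1 + 1]; the power of [p^(l+1)] pays
   for rounding [r] to [p^(-k-l)]. *)
pose K2 : R := (10 ^ n)%:R * (CB + 1) * (p%:R ^+ l.+1) `^ tau.
have K20 : 0 < K2.
  by rewrite !mulr_gt0 ?powR_gt0 ?exprn_gt0 // ?ltr0n ?expn_gt0 // ltr_wpDl.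
exists (K1 / K2), (p%:R ^- l); split; [exact: divr_gt0|by rewrite invr_gt0|].
move=> r s r0 rl cov.
(* Each [a] is within [r] of a centre of the cover, so every point of this open set is within [2r]
   of one. *)
have oO : open (\bigcup_(a in X `&` missing_digit_set R D l) ball a r).
  by apply: bigcup_open => a _; exact: ball_open.
have XKO : X `&` missing_digit_set R D l `<=` \bigcup_(a in X `&` missing_digit_set R D l) ball a r.
  by move=> a Xa; exists a => //; exact: ballxx.
have [eta eta0 sep] := compact_separation cX (@closed_closure _ _) oO XKO.
have x1 : 1 <= (p%:R ^+ l * r)^-1.
  rewrite invf_ge1 ?mulr_gt0 // mulrC -ler_pdivlMr // mul1r; exact: ltW.
have [k /andP[k1 k2]] := pow_between p2 x1.
have [N1 hN1] : exists N1 : nat, 2 / eta <= N1.+1%:R.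
  by exists (Num.trunc (2 / eta)); apply/ltW/truncnS_gt.
(* [N] is chosen after the cover: it must resolve both the scale [p^-k] and the separation [eta],
   over which there is no a priori control. *)
pose N := (p ^ k * 2 ^ n.+2 * N1.+1)%N.
have N0 : (0 < N)%N.
  have a1 : (0 < p ^ k)%N by rewrite expn_gt0 (ltnW p2).
  have a2 : (0 < 2 ^ n.+2)%N by rewrite expn_gt0.
  by rewrite /N (muln_gt0 (_ * _)) (muln_gt0 (p ^ k)) a1 a2.
have N0R : 0 < N%:R :> R by rewrite ltr0n.
have [m0 hm0] := main N0; have [m1 hm1] := piece k N N0.
have [m2 hm2] := @expr_lt_eps R p p2 (eta / 2) (divr_gt0 eta0 (ltr0Sn _ _)).
pose m := (m0 + m1 + m2)%N; have [mm0 mm1 mm2] := sum3_le k m0 m1 m2.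
have hA : (2 ^ n.+2)%:R / N%:R <= eta / 2 :> R.
  have e1 : 1 <= eta / 2 * N1.+1%:R by move: hN1; rewrite ler_pdivrMr // mulrAC ler_pdivlMr // mul1r mulrC.
  rewrite ler_pdivrMr // /N natrM mulrCA -[leLHS]mulr1; apply: ler_pM => //.
  by rewrite ler_nat leq_pmull // expn_gt0 (ltnW p2).
pose G x := \sum_(c <- s) \sum_(v <- window_words D k l c 4) \sum_(z <- words D m)
    fejer N (p%:R ^+ l *: x - wpoint R p (k + m) ((p ^ m)%:Z *: v + z)).
have term_adm v : adm (fun x => \sum_(z <- words D m)
    fejer N (p%:R ^+ l *: x - wpoint R p (k + m) ((p ^ m)%:Z *: v + z))).
  by apply: adm_sum => z; exact: adm_fejer.
have aG : adm G by apply: adm_sum => c; apply: adm_sum => v; exact: term_adm.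
have point x : X x -> \sum_(z <- words D (k + m)) fejer N (p%:R ^+ l *: x - wpoint R p (k + m) z) ^+ 2 <=
    kappa R n * (\sum_(z <- words D (k + m)) fejer N (p%:R ^+ l *: x - wpoint R p (k + m) z)) + G x.
  move=> Xx.
  have G0 (c : 'rV[R]_n) : 0 <= \sum_(v <- window_words D k l c 4) \sum_(z <- words D m)
      fejer N (p%:R ^+ l *: x - wpoint R p (k + m) ((p ^ m)%:Z *: v + z)).
    by apply: sumr_ge0 => v _; apply: sumr_ge0 => z _; exact: fejer_ge0.
  have [[z [zm zn]]|far] := pselect (exists z, z \in words D (k + m) /\
      near_lattice (p%:R ^+ l *: x - wpoint R p (k + m) z) N); last first.
    have far' z : z \in words D (k + m) ->
        ~ near_lattice (p%:R ^+ l *: x - wpoint R p (k + m) z) N.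
      by move=> zm zn; apply: far; exists z.
    apply: le_trans (window_far p2 N0 far') _.
    by rewrite lerDl; apply: sumr_ge0.
  have [y dy xy] := near_lattice_point p2 y01 dy0 zm N0 zn.
  have xye : `|x - y| <= eta.
    have pl1 : p%:R ^- l <= 1 :> R by rewrite invf_le1 // exprn_ege1 // ler1n ltnW.
    have s0 : 0 <= (2 ^ n.+2)%:R / N%:R + p%:R ^- (k + m) :> R.
      by rewrite addr_ge0 ?divr_ge0 // invr_ge0 exprn_ge0 // ltW.
    apply: le_trans xy _; apply: le_trans (ler_wpM2r s0 pl1) _.
    by rewrite mul1r (splitr eta) lerD //; exact: hm2.
  have Ky : missing_digit_set R D l y by exact: subset_closure.
  have [a aF] := sep x y Xx Ky xye; rewrite -ball_normE /ball_ /= => ax.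
  have [c cs ac] := cov a aF.
  have xc : p%:R ^+ (k + l) * `|x - c| <= 2%:R.
    have xc2 : `|x - c| <= 2 * r.
      rewrite -(subrKA a) (le_trans (ler_normD _ _)) // mulr_natl mulr2n lerD //.
        by rewrite distrC ltW.
      by rewrite (le_trans (norm_le_enorm _)).
    apply: (le_trans (y := p%:R ^+ (k + l) * (2 * r))); first by rewrite ler_wpM2l // exprn_ge0 // ltW.
    rewrite exprD; have -> : p%:R ^+ k * p%:R ^+ l * (2 * r) = 2 * (p%:R ^+ k * (p%:R ^+ l * r)) by ring.
    by rewrite ger_pMr // -ler_pdivlMr ?mulr_gt0 // mul1r.
  have hN : (p ^ k * 2 ^ n.+2 <= N * 1)%N by rewrite muln1 leq_pmulr.
  apply: le_trans (window_le D p2 m N0 hN xc) _; rewrite lerD2l.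
  by rewrite (_ : (2 + 1 + 1 = 4)%N) //; exact: (mem_le_sum G0 cs).
have := le_trans (hm0 (k + m)%N mm0) (pairing_window aG point); rewrite -/K1 => lower.
have upper : #|D|%:R ^- (k + m) * pairing mu phi G <=
    (size s)%:R * ((10 ^ n)%:R * (#|D|%:R ^- k * (CB * N%:R ^- n * (p%:R ^+ k) `^ (n%:R - sigma)))).
  rewrite /G (pairing_sum cphi phi0 phiB mu_tsupp); last first.
    by move=> c; apply: adm_sum => v; exact: term_adm.
  have w0 : 0 <= #|D|%:R ^- k :> R by rewrite invr_ge0 exprn_ge0.
  rewrite mulr_sumr; apply: (le_trans (y := \sum_(c <- s) ((10 ^ n)%:R * (#|D|%:R ^- k *
       (CB * N%:R ^- n * (p%:R ^+ k) `^ (n%:R - sigma)))))); last first.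
    by rewrite sum_const_seq.
  apply: ler_sum => c _; rewrite (pairing_sum cphi phi0 phiB mu_tsupp) //.
  have B0 : 0 <= #|D|%:R ^- k * (CB * N%:R ^- n * (p%:R ^+ k) `^ (n%:R - sigma)).
    by rewrite mulr_ge0 // mulr_ge0 ?powR_ge0 // mulr_ge0 // invr_ge0 exprn_ge0.
  apply: (le_trans (y := \sum_(v <- window_words D k l c 4) (#|D|%:R ^- k *
       (CB * N%:R ^- n * (p%:R ^+ k) `^ (n%:R - sigma))))); last first.
    by rewrite sum_const_seq ler_wpM2r // ler_nat; exact: count_words_near.
  rewrite mulr_sumr; apply: ler_sum => v _.
  rewrite exprD invfM -[leLHS]mulrA; apply: (ler_wpM2l w0).
  apply: le_trans (hm1 m v mm1).
  rewrite -(pairingZ cphi phi0 phiB mu_tsupp) //.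
  rewrite le_eqVlt; apply/orP; left; apply/eqP; congr (pairing mu phi _).
  apply/funext => x; rewrite /piece_cloud big_map; congr (_ * _).
  by apply: eq_bigr => z _; rewrite wpointD.
have := le_trans lower upper.
have -> : (size s)%:R * ((10 ^ n)%:R * (#|D|%:R ^- k * (CB * N%:R ^- n * (p%:R ^+ k) `^ (n%:R - sigma)))) =
  (size s)%:R * ((10 ^ n)%:R * CB * (#|D|%:R ^- k * (p%:R ^+ k) `^ (n%:R - sigma))) * N%:R ^- n by ring.
(* The two factors [N^-n] cancel, so the uncontrolled size of [N] leaves no trace. *)
rewrite ler_pM2r ?invr_gt0 ?exprn_gt0 // => H.
have pk0 : 0 < p%:R ^+ k :> R by rewrite exprn_gt0.
have E : #|D|%:R ^- k * (p%:R ^+ k) `^ (n%:R - sigma) = (p%:R ^+ k) `^ (- tau).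
  by rewrite card_powR -powRN -powRD_gt0 // /tau; congr (_ `^ _); ring.
have small : (p%:R ^+ k) `^ (- tau) <= (p%:R ^+ l.+1) `^ tau * r `^ tau.
  rewrite -powRM ?exprn_ge0 ?(ltW p0) ?(ltW r0) // -powRV ?(ltW pk0) //.
  apply: ge0_ler_powR; rewrite ?nnegrE ?(ltW tau0) ?invr_ge0 ?(ltW pk0) //.
    by rewrite mulr_ge0 ?exprn_ge0 // ltW.
  have plr : 0 < p%:R ^+ l * r by rewrite mulr_gt0.
  move: k2; rewrite -[ltRHS]invrK ltf_pV2 ?posrE ?invr_gt0 ?exprn_gt0 // => /ltW.
  rewrite !exprS invfM ler_pdivrMl // mulrA; exact.
rewrite mulrAC ler_pdivrMr // powRN ler_pdivrMr ?powR_gt0 //.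
apply: le_trans H _; rewrite E /K2 -[leRHS]mulrA ler_wpM2l // -!mulrA ler_wpM2l //.
by apply: ler_pM; rewrite ?powR_ge0 ?lerDl.
Qed.

Lemma adm_bump (delta : R) (c : 'rV[R]_n) :
  adm (fun x => smooth_bump 0 2 (delta^-1 *: (x - c))).
Proof.
split; last by exists 1 => x; rewrite ger0_norm ?bump_ge0 // bump_le1.
move=> x; apply: (@continuous_comp _ _ _ (fun x : 'rV[R]_n => delta^-1 *: (x - c)) (smooth_bump 0 2)); last exact: bump_continuous.
apply: (@cvgZl_tmp _ _ _ (nbhs x)).
by apply: (@cvgB _ _ _ (nbhs x)); [exact: cvg_id|exact: cvg_cst].
Qed.

(** The thickenings already contain the nearby points, so [N] of order [1 / (p^l delta)] is enough
    and no separation distance intervenes. Each ball of the cover counts through its surface mass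
    [O(delta^d)], with a smooth bump in place of its indicator because pairings are taken with
    continuous functions. *)
Lemma local_thick_cover (d : nat) (CM : R) : 0 <= CM -> similarity_dim R D <= n%:R ->
  (forall B : set (borelRn R n), measurable B -> B `<=` X -> forall a delta, 0 <= delta ->
    (forall x, B x -> `|x - a| <= delta) -> (mu B <= (CM * delta ^+ d)%:E)%E) ->
  exists c r0 : R, [/\ 0 < c, 0 < r0 & forall delta s, 0 < delta -> delta < r0 ->
    covers delta s (thickening delta M `&` thickening delta (missing_digit_set R D l)) ->
    c * delta^-1 `^ (similarity_dim R D + d%:R - n%:R) <= (size s)%:R].
Proof.
move=> CM0 sn muX.
have pl0 : 0 < p%:R ^+ l :> R by rewrite exprn_gt0.
(* [B0] makes [n p^-l (A2 + 1) p^-k < delta], so that the point found near [x] puts [x] in the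
   thickening. [B] bounds [p^(k+l) delta], with a factor [p] lost in rounding to a power of [p]. *)
pose A2 := (2 ^ n.+2)%N; pose B0 := (n * (A2 + 1))%N; pose B := (p * B0)%N.
have A20 : (0 < A2)%N by rewrite expn_gt0.
have B00 : (0 < B0)%N by rewrite muln_gt0 n0 addn1.
pose Q := ((2 * (B + A2 + 1) + 2) ^ n)%N.
have Q0 : (0 < Q)%N by rewrite expn_gt0 addn2.
pose K1 : R := mphi * 2 ^- n / 4.
have K10 : 0 < K1 by rewrite divr_gt0 // mulr_gt0 // invr_gt0 exprn_gt0.
(* Inverse of the lower bound that the bump of radius 2 satisfies on the unit ball. *)
pose E : R := expR (2 / 2 ^+ 2).
pose K2 : R := Q%:R * E * (CM + 1) * 2 ^+ d.
have K20 : 0 < K2.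
  by rewrite !mulr_gt0 ?expR_gt0 ?exprn_gt0 // ?ltr0n // ltr_wpDl.
have Bl0 : 0 < B%:R / p%:R ^+ l :> R by rewrite divr_gt0 // ltr0n /B muln_gt0 B00 (ltnW p2).
pose K3 : R := (B%:R / p%:R ^+ l) `^ (similarity_dim R D - n%:R).
have K30 : 0 < K3 by rewrite powR_gt0.
exists (K1 / K2 * K3), (B0%:R / p%:R ^+ l); split.
- by rewrite mulr_gt0 // divr_gt0.
- by rewrite divr_gt0 // ltr0n.
move=> delta s delta0 dr cov.
have x1 : 1 <= B0%:R / (p%:R ^+ l * delta).
  by rewrite ler_pdivlMr ?mulr_gt0 // mul1r mulrC -ler_pdivlMr // ltW.
have [k' /andP[k1 k2]] := pow_between p2 x1.
pose k := k'.+1; pose N := (p ^ k)%N.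
have N0 : (0 < N)%N by rewrite /N expn_gt0 (ltnW p2).
have NE : N%:R = p%:R ^+ k :> R by rewrite natrX.
have pk0 : 0 < p%:R ^+ k :> R by rewrite exprn_gt0.
have [m0 hm0] := main N0.
have hN : (p ^ k * 2 ^ n.+2 <= N * A2)%N by [].
pose m := m0; have mm : (m0 <= k + m)%N by rewrite /m leq_addl.
(* At most [Q] pieces of [#|D|^m] words each, with kernel at most 1; [E] compensates for the bump
   being smaller than 1. *)
pose Wt : R := Q%:R * #|D|%:R ^+ m * E.
have Wt0 : 0 <= Wt by rewrite mulr_ge0 ?expR_ge0 // mulr_ge0 // exprn_ge0 // ltW.
pose G x := \sum_(c <- s) Wt * smooth_bump 0 2 (delta^-1 *: (x - c)).
have hG0 x (c : 'rV[R]_n) : 0 <= Wt * smooth_bump 0 2 (delta^-1 *: (x - c)).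
  by rewrite mulr_ge0 ?bump_ge0.
have aT (c : 'rV[R]_n) : adm (fun x => Wt * smooth_bump 0 2 (delta^-1 *: (x - c))).
  by apply: admM; [exact: adm_cst | exact: adm_bump].
have aG : adm G by exact: adm_sum.
have kl : p%:R ^+ (k + l) * delta <= B%:R.
  rewrite exprD exprS -!mulrA natrM ler_wpM2l ?(ltW p0) //.
  by move: k1; rewrite ler_pdivlMr ?mulr_gt0.
have lk : n%:R * (p%:R ^- l * ((2 ^ n.+2)%:R / N%:R + p%:R ^- (k + m))) < delta.
  have h1 : p%:R ^- (k + m) <= p%:R ^- k :> R.
    by rewrite exprD invfM ger_pMr ?invr_gt0 // invf_le1 ?exprn_gt0 // exprn_ege1 // ler1n ltnW.
  have h2 : (2 ^ n.+2)%:R / N%:R + p%:R ^- (k + m) <= (A2 + 1)%:R / p%:R ^+ k :> R.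
    by rewrite NE natrD mulrDl mul1r lerD2l.
  apply: (le_lt_trans (y := B0%:R / p%:R ^+ l / p%:R ^+ k)).
    by rewrite /B0 natrM -!mulrA ler_wpM2l // mulrCA ler_wpM2l ?invr_ge0 ?(ltW pl0) //.
  by rewrite ltr_pdivrMr // [delta * _]mulrC -ltr_pdivrMr // -mulrA -invfM; exact: k2.
have point x : X x -> \sum_(z <- words D (k + m)) fejer N (p%:R ^+ l *: x - wpoint R p (k + m) z) ^+ 2 <=
    kappa R n * (\sum_(z <- words D (k + m)) fejer N (p%:R ^+ l *: x - wpoint R p (k + m) z)) + G x.
  move=> Xx.
  have [[z [zm zn]]|far] := pselect (exists z, z \in words D (k + m) /\
      near_lattice (p%:R ^+ l *: x - wpoint R p (k + m) z) N); last first.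
    have far' z : z \in words D (k + m) ->
        ~ near_lattice (p%:R ^+ l *: x - wpoint R p (k + m) z) N.
      by move=> zm zn; apply: far; exists z.
    apply: le_trans (window_far p2 N0 far') _.
    by rewrite lerDl; apply: sumr_ge0.
  have [y dy xy] := near_lattice_point p2 y01 dy0 zm N0 zn.
  have Fx : (thickening delta M `&` thickening delta (missing_digit_set R D l)) x.
    split; first by exists x; [case: Xx | rewrite subrr /enorm dotp0l sqrtr0].
    exists y; first exact: subset_closure.
    apply: le_lt_trans (enorm_le_row _) _; apply: le_lt_trans lk.
    by rewrite ler_wpM2l.
  have [c cs xc] := cov x Fx.
  have xcB : p%:R ^+ (k + l) * `|x - c| <= B%:R.
    apply: le_trans kl; rewrite ler_wpM2l ?exprn_ge0 ?(ltW p0) //.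
    exact: le_trans (norm_le_enorm _) xc.
  apply: le_trans (window_le D p2 m N0 hN xcB) _; rewrite lerD2l.
  apply: le_trans (mem_le_sum (hG0 x) cs).
  have b1 : 1 <= E * smooth_bump 0 2 (delta^-1 *: (x - c)).
    have hb : enorm (delta^-1 *: (x - c) - 0) <= 2 / 2.
      rewrite subr0 enormZ ger0_norm ?invr_ge0 ?(ltW delta0) // divff //.
      by rewrite ler_pdivrMl // mulr1.
    have := bump_lb (ltr0Sn _ 1) hb; rewrite expRN -/E -[_^-1]mulr1 ler_pdivrMl ?expR_gt0 //.
  apply: (le_trans (y := Q%:R * #|D|%:R ^+ m)); last first.
    rewrite /Wt -mulrA ler_peMr // mulr_ge0 // exprn_ge0 // ltW.
  apply: (le_trans (y := \sum_(v <- window_words D k l c (B + A2 + 1)) #|D|%:R ^+ m)).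
    apply: ler_sum => v _; apply: (le_trans (y := \sum_(z <- words D m) (1 : R))).
      by apply: ler_sum => u _; exact: fejer_le1.
    by rewrite sum_const_seq size_words mulr1 natrX.
  rewrite sum_const_seq ler_wpM2r ?exprn_ge0 ?(ltW Dr0) // ler_nat.
  exact: count_words_near.
have := le_trans (hm0 (k + m)%N mm) (pairing_window aG point); rewrite -/K1 => lower.
have upper : pairing mu phi G <= (size s)%:R * (Wt * (CM * (2 * delta) ^+ d)).
  rewrite /G (pairing_sum cphi phi0 phiB mu_tsupp) // -sum_const_seq.
  apply: ler_sum => c _; rewrite (pairingZ cphi phi0 phiB mu_tsupp); last exact: adm_bump.
  rewrite ler_wpM2l // -lee_fin.
  pose Bc := X `&` [set x | `|x - c| <= 2 * delta].
  have mBc : measurable (Bc : set (borelRn R n)).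
    by apply: compact_borel; apply: compact_closedI => //; exact: closed_norm_ball.
  apply: (le_trans (y := mu Bc)); last first.
    apply: (muX Bc mBc _ c) => [x []//||x []//]; by rewrite mulr_ge0 // ltW.
  apply: (pairing_le_set cphi phi0 phiB mu_tsupp mM muM) => //.
  - exact: adm_bump.
  - by move=> x; exact: bump_ge0.
  move=> x Mx tx; have [h|h] := eqVneq (smooth_bump 0 2 (delta^-1 *: (x - c))) 0.
    by rewrite h indicE.
  have := bump_supp (ltr0Sn _ 1) h; rewrite subr0 enormZ ger0_norm ?invr_ge0 ?(ltW delta0) //.
  rewrite ltr_pdivrMl // mulrC => h2.
  rewrite indicE mem_set ?bump_le1 //; split => //=.
  exact: le_trans (norm_le_enorm _) (ltW h2).
pose W : R := #|D|%:R ^- k * delta ^+ d.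
have W0 : 0 < W by rewrite mulr_gt0 // ?invr_gt0 exprn_gt0.
have H : K1 * N%:R ^- n <= (size s)%:R * (K2 * (#|D|%:R ^- k * delta ^+ d)).
  apply: le_trans lower _; apply: le_trans (ler_wpM2l _ upper) _.
    by rewrite invr_ge0 exprn_ge0 // ltW.
  have -> : #|D|%:R ^- (k + m) * ((size s)%:R * (Wt * (CM * (2 * delta) ^+ d))) =
    (size s)%:R * (Q%:R * E * CM * 2 ^+ d * (#|D|%:R ^- k * delta ^+ d)).
    rewrite exprD exprMn /Wt; have := lt0r_neq0 (exprn_gt0 m Dr0); have := lt0r_neq0 (exprn_gt0 k Dr0).
    move: (_ ^+ m) (_ ^+ k) => a b an bn; field; by rewrite an bn.
  rewrite ler_wpM2l //; apply: (ler_wpM2r (ltW W0)).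
  rewrite /K2; apply: ler_wpM2r; first exact: exprn_ge0.
  apply: ler_wpM2l; last by rewrite lerDl.
  by rewrite mulr_ge0 // expR_ge0.
have low : K3 * delta^-1 `^ (similarity_dim R D + d%:R - n%:R) <= N%:R ^- n / W.
  have di0 : 0 < delta^-1 by rewrite invr_gt0.
  have -> : similarity_dim R D + d%:R - n%:R = (similarity_dim R D - n%:R) + d%:R by ring.
  rewrite (powRD_gt0 _ _ di0) (powR_mulrn _ (ltW di0)) mulrA -(powRM _ (ltW Bl0) (ltW di0)).
  have -> : N%:R ^- n / W = (p%:R ^+ k) `^ (similarity_dim R D - n%:R) * delta^-1 ^+ d.
    rewrite (powRD_gt0 _ _ pk0) -card_powR powRN (powR_mulrn _ (ltW pk0)) NE exprVn /W.
    by rewrite invfM invrK mulrA [_ ^- n * _]mulrC.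
  apply: ler_wpM2r; first by rewrite exprn_ge0 // ltW.
  have -> : similarity_dim R D - n%:R = - (n%:R - similarity_dim R D) by ring.
  apply: powRN_le => //; first by rewrite subr_ge0.
  by rewrite -mulrA -invfM ler_pdivlMr ?mulr_gt0 // mulrA -exprD.
apply: (le_trans (y := K1 / K2 * (N%:R ^- n / W))).
  by rewrite -mulrA ler_wpM2l // divr_ge0 // ltW.
rewrite mulrACA -[K2^-1 * W^-1]invfM ler_pdivrMr; last exact: mulr_gt0.
exact: H.
Qed.

End LocalLower.

(** * Comparison of the exponents *)

Lemma two_pi_le8 (R : realType) : 2 * pi <= 8 :> R.
Proof. by have := @pihalf_lt2 R; lra. Qed.

Lemma powR_unbounded (R : realType) (g C : R) : 0 < g -> exists2 x0 : R, 0 < x0 &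
  forall x, x0 <= x -> C < x `^ g.
Proof.
move=> g0; pose C1 : R := `|C| + 1.
have C10 : 0 < C1 by rewrite /C1 ltr_wpDl.
exists (C1 `^ g^-1); first by rewrite powR_gt0.
move=> x hx; apply: (lt_le_trans (y := C1)); first by rewrite /C1 ltr_pwDr // ler_norm.
have -> : C1 = (C1 `^ g^-1) `^ g by rewrite -powRrM mulVf ?lt0r_neq0 // powRr1 // ltW.
apply: ge0_ler_powR; rewrite ?nnegrE ?powR_ge0 ?(ltW g0) //.
by apply: le_trans hx; exact: powR_ge0.
Qed.

Section SimilarityLower.
Variables (R : realType) (n p : nat) (D : {set 'rV['I_p]_n}).
Hypothesis p3 : (3 <= p)%N.
Hypothesis n0 : (0 < n)%N.
Hypothesis D0 : (0 < #|D|)%N.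

Let p2 : (1 < p)%N. Proof. exact: ltnW. Qed.
Let p0 : 0 < p%:R :> R. Proof. by rewrite ltr0n ltnW. Qed.

(** At scale [N = p^k] a piece of level [k + 2] lies where the kernel is at least [4^-n], so
    [words_local] bounds its share [#|D|^-(k+2)] by [O(N^(e - n))]. If the conclusion failed, a
    large [k] would contradict this. *)
Lemma similarity_dim_ge (e C : R) : 0 <= e -> 0 <= C -> l1_bound D e C ->
  n%:R - e <= similarity_dim R D.
Proof.
move=> e0 C0 hl1; have Dr0 : 0 < #|D|%:R :> R by rewrite ltr0n.
rewrite leNgt; apply/negP => hlt.
pose g := n%:R - e - similarity_dim R D.
have g0 : 0 < g by rewrite subr_gt0.
pose C' : R := #|D|%:R ^+ 2 * 4 ^+ n * (2 * C * n%:R `^ e).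
have [x0 x00 hx0] := powR_unbounded C' g0.
have [k hk] : exists k, x0 <= p%:R ^+ k.
  have [[k /andP[_ h]]|h] : (exists k, p%:R ^+ k <= Num.max x0 1 < p%:R ^+ k.+1) \/ False.
    by left; apply: pow_between => //; rewrite le_max lexx orbT.
    by exists k.+1; apply: le_trans (ltW h); rewrite le_max lexx.
  by [].
have := hx0 _ hk; rewrite ltNge => /negP; apply.
pose N := (p ^ k)%N; have N0 : (0 < N)%N by rewrite expn_gt0 (ltnW p2).
have NE : N%:R = p%:R ^+ k :> R by rewrite natrX.
have pk0 : 0 < p%:R ^+ k :> R by rewrite exprn_gt0.
have [m0 hm0] := words_local n0 e0 C0 hl1 N0.
have [v vw] : exists v, v \in words D k.+2.
  have : (0 < size (words D k.+2))%N by rewrite size_words expn_gt0 D0.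
  by case: (words D k.+2) => // v s _; exists v; rewrite inE eqxx.
have := hm0 (k.+2 + m0)%N (leq_addl _ _) (wpoint R p k.+2 v).
rewrite sum_wordsD => up.
have low : #|D|%:R ^- k.+2 * 4 ^- n <= N%:R ^- n * (2 * C * (n%:R * N%:R) `^ e).
  have Di : 0 <= #|D|%:R ^- k.+2 :> R by rewrite invr_ge0 exprn_ge0.
  apply: le_trans up; rewrite exprD (invfM (#|D|%:R ^+ k.+2)) -[leRHS]mulrA; apply: (ler_wpM2l Di).
  rewrite ler_pdivlMl ?exprn_gt0 //.
  apply: (le_trans (y := \sum_(z <- words D m0)
      fejer N (wpoint R p k.+2 v - wpoint R p (k.+2 + m0) ((p ^ m0)%:Z *: v + z)))); last first.
    apply: (mem_le_sum (F := fun v' => \sum_(z <- words D m0)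
      fejer N (wpoint R p k.+2 v - wpoint R p (k.+2 + m0) ((p ^ m0)%:Z *: v' + z)))) => // v'.
    by apply: sumr_ge0 => z _; exact: fejer_ge0.
  rewrite -natrX -(size_words D m0) -sum_const_seq.
  rewrite big_seq [leRHS]big_seq; apply: ler_sum => z zm.
  apply: fejer_near => // i.
  rewrite wpointD // opprD addrA subrr add0r.
  have e1 : `|(- (p%:R ^- k.+2 *: wpoint R p m0 z)) 0 i| <= p%:R ^- k.+2.
    rewrite !mxE normrN normrM ger0_norm ?invr_ge0 ?exprn_ge0 ?(ltW p0) //.
    rewrite ger_pMr ?invr_gt0 ?exprn_gt0 // normrM ger0_norm ?invr_ge0 ?exprn_ge0 ?(ltW p0) //.
    rewrite ler_pdivrMl ?exprn_gt0 // mulr1.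
    have /andP[z0 z1] := words_bound p2 i zm; rewrite ger0_norm ?ler0z //.
    by rewrite -natrX -[X in _ <= X]/((p ^ m0)%:Z%:~R) ler_int ltW.
  (* The two extra digits bring the piece within [1 / (2 pi N)] of its corner, since [p^2 >= 9]
     exceeds [2 pi]. *)
  have pp : 9 <= p%:R ^+ 2 :> R.
    have -> : (9 : R) = 3 ^+ 2 by ring.
    by rewrite ler_pXn2r ?nnegrE // ler_nat.
  apply: (le_trans (y := 8 * N%:R * p%:R ^- k.+2)).
    by apply: ler_pM => //; [rewrite !mulr_ge0 // pi_ge0 | rewrite ler_wpM2r // two_pi_le8].
  rewrite NE -(addn2 k) exprD ler_pdivrMr ?mulr_gt0 ?exprn_gt0 // mul1r mulrC ler_wpM2l ?(ltW pk0) //.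
  by apply: le_trans pp; lra.
have Ne0 : 0 < N%:R `^ e :> R by rewrite powR_gt0 // NE.
have Nn0 : 0 < N%:R ^+ n :> R by rewrite exprn_gt0 // NE.
have Dk0 : 0 < #|D|%:R ^+ k :> R by rewrite exprn_gt0.
have -> : (p%:R ^+ k) `^ g = N%:R ^+ n / (N%:R `^ e * #|D|%:R ^+ k).
  have cp : #|D|%:R ^+ k = (p%:R ^+ k) `^ similarity_dim R D :> R by exact: card_powR.
  rewrite cp NE /g invfM -(powRN _ e) -(powRN _ (similarity_dim R D)) mulrA.
  by rewrite -(powR_mulrn n (ltW pk0)) -!powRD_gt0.
rewrite ler_pdivrMr ?mulr_gt0 //.
move: low; rewrite (powRM _ (ler0n _ n) (ler0n _ N)) -(addn2 k) exprD invfM.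
have a0 : 0 < 4 ^+ n :> R by rewrite exprn_gt0.
have c0 : 0 < #|D|%:R ^+ 2 :> R by rewrite exprn_gt0.
rewrite /C'; move: Dk0 a0 c0 Nn0.
move: (4 ^+ n) (#|D|%:R ^+ k) (#|D|%:R ^+ 2) (N%:R ^+ n) (N%:R `^ e) (n%:R `^ e) => a b c f g' h b0 a0 c0 f0.
move=> /(ler_wpM2l (ltW (mulr_gt0 (mulr_gt0 (mulr_gt0 b0 c0) a0) f0))).
have -> : b * c * a * f * (b^-1 / c / a) = f by field; rewrite !lt0r_neq0.
suff -> : b * c * a * f * (f^-1 * (2 * C * (h * g'))) = c * a * (2 * C * h) * (g' * b) by [].
by field; rewrite lt0r_neq0.
Qed.

End SimilarityLower.

(** * Surface mass against the decay exponent *)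

Section SigmaLess.
Variables (R : realType) (n d : nat) (mu : {measure set (borelRn R n) -> \bar R}).
Variables (M : set 'rV[R]_n) (phi : 'rV[R]_n -> R).
Hypothesis n0 : (0 < n)%N.
Hypothesis cphi : continuous phi.
Hypothesis phi0 : forall x, 0 <= phi x.
Hypothesis phiB : forall x, phi x <= 1.
Hypothesis mu_tsupp : (mu (tsupp phi) < +oo)%E.
Hypothesis mM : measurable (M : set (borelRn R n)).
Hypothesis muM : mu (~` M) = 0%E.
Variables (CF sigma : R).
Hypothesis CF0 : 0 <= CF.
Hypothesis decay : forall xi : 'rV[R]_n, 1 <= enorm xi ->
  normc (fourier mu phi xi) <= CF * enorm xi `^ (- sigma).

Lemma decay_exponent_lt (x1 : 'rV[R]_n) (c1 r1 cM : R) : (d < n)%N ->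
  0 < c1 -> 0 < r1 -> 0 < cM -> (forall x, `|x - x1| <= r1 -> c1 <= phi x) ->
  (forall t, 0 < t -> t <= r1 -> exists B : set (borelRn R n),
    [/\ measurable B, B `<=` M `&` [set x | `|x - x1| <= t] & ((cM * t ^+ d)%:E <= mu B)%E]) ->
  sigma < n%:R.
Proof.
move=> dn c10 r10 cM0 hphi hB; rewrite ltNge; apply/negP => sn.
(* The mass near [x1] is at least of order [N^-d], whereas decay with exponent
   [n - 1/2] bounds it by [O(N^(-n + 1/2))]. *)
pose s' : R := n%:R - 1 / 2.
have n1 : 1 <= n%:R :> R by rewrite ler1n.
have s'0 : 0 <= s' by rewrite /s'; lra.
have decay' xi : 1 <= enorm xi -> normc (fourier mu phi xi) <= CF * enorm xi `^ (- s').
  move=> h; apply: le_trans (decay h) _; rewrite ler_wpM2l // ler_powR //.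
  by rewrite lerN2 /s'; lra.
have s'n : s' < n%:R by rewrite /s'; lra.
have [CP CP0 hCP] := point_upper n0 cphi phi0 phiB mu_tsupp mM muM CF0 s'0 decay' s'n.
pose K : R := c1 * 4 ^- n * cM * 8 ^- d.
have K0 : 0 < K by rewrite !mulr_gt0 ?invr_gt0 ?exprn_gt0.
pose L : R := CP * n%:R `^ (1 / 2) / K.
have L0 : 0 <= L by rewrite divr_ge0 ?(ltW K0) // mulr_ge0 ?powR_ge0.
(* [N > L^2] lets the square root of [N] beat the constants, and [N > 1 / r1] keeps the radius [t]
   in the range of the hypotheses. *)
have [N1 hN1] : exists N : nat, L ^+ 2 + r1^-1 < N.+1%:R.
  by exists (Num.trunc (L ^+ 2 + r1^-1)); apply: truncnS_gt.
pose N := N1.+1; have N0 : (0 < N)%N by [].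
have NR : 1 <= N%:R :> R by rewrite ler1n.
have NR0 : 0 < N%:R :> R by rewrite ltr0n.
pose t : R := (8 * N%:R)^-1.
have t0 : 0 < t by rewrite invr_gt0 mulr_gt0.
have tr : t <= r1.
  have ri : 0 < r1^-1 by rewrite invr_gt0.
  rewrite /t -[r1]invrK lef_pV2 ?posrE ?mulr_gt0 //.
  have := sqr_ge0 L; rewrite -/N in hN1; lra.
have [B [mB Bt muB]] := hB t t0 tr.
have ag : adm (fun x : 'rV[R]_n => fejer N (x - x1)).
  by have := adm_fejer N 1 x1; under eq_fun do rewrite scale1r.
have := hCP N N0 x1; apply/negP; rewrite -ltNge.
have c40 : 0 <= c1 * 4 ^- n by rewrite mulr_ge0 ?(ltW c10) // invr_ge0 exprn_ge0.
have pw x : B x -> c1 * 4 ^- n <= phi x * fejer N (x - x1).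
  move=> /Bt[_ /= xt]; apply: ler_pM; rewrite ?(ltW c10) ?invr_ge0 ?exprn_ge0 //.
    by apply: hphi; exact: le_trans tr.
  apply: fejer_near => // i.
  have := coord_le_norm (x - x1) i; move: (_ 0 i) => u hu.
  have u1 : `|u| <= t by exact: le_trans xt.
  apply: (le_trans (y := 8 * N%:R * t)); last by rewrite /t mulfV // lt0r_neq0 // mulr_gt0.
  apply: ler_pM => //; first by rewrite !mulr_ge0 // pi_ge0.
  by rewrite ler_wpM2r ?(ltW NR0) // two_pi_le8.
have low := pairing_ge_set cphi phi0 phiB mu_tsupp ag (fun x => fejer_ge0 _ _) mB c40 pw.
have low2 : K * N%:R ^- d <= pairing mu phi (fun x => fejer N (x - x1)).
  rewrite -lee_fin; apply: le_trans low.
  have -> : K * N%:R ^- d = c1 * 4 ^- n * (cM * t ^+ d).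
    by rewrite /K /t exprVn exprMn invfM; ring.
  by rewrite EFinM lee_wpmul2l // lee_fin.
apply: lt_le_trans low2.
have -> : n%:R - s' = 1 / 2 :> R by rewrite /s'; ring.
rewrite powRM ?ler0n //.
pose b : R := N%:R `^ (1 / 2).
have b0 : 0 < b by rewrite powR_gt0.
have bb : b * b = N%:R.
  by rewrite /b -powRD_gt0 // (_ : 1 / 2 + 1 / 2 = 1) ?powRr1 ?(ltW NR0) //; lra.
have Lb : L < b.
  rewrite -(ltr_pXn2r (_ : 0 < 2)%N) ?nnegrE ?(ltW b0) // [ltRHS]expr2 bb.
  by apply: le_lt_trans hN1; rewrite lerDl invr_ge0 ltW.
have nd : N%:R ^+ d.+1 <= N%:R ^+ n :> R by rewrite ler_weXn2l.
have h1 : CP * n%:R `^ (1 / 2) < K * b by rewrite [ltRHS]mulrC -ltr_pdivrMr // -/L.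
have -> : CP / N%:R ^+ n * (n%:R `^ (1 / 2) * b) = CP * n%:R `^ (1 / 2) * b / N%:R ^+ n by ring.
rewrite ltr_pdivrMr ?exprn_gt0 //.
apply: (lt_le_trans (y := K * b * b)); first by rewrite ltr_pM2r.
rewrite -mulrA bb -[leRHS]mulrA ler_wpM2l ?(ltW K0) // ler_pdivlMl ?exprn_gt0 //.
by rewrite -exprSr.
Qed.

End SigmaLess.

(** * The theorem *)

Lemma closure_sub_closed (T : topologicalType) (A B : set T) : closed B -> A `<=` B ->
  closure A `<=` B.
Proof. by move=> cB AB; rewrite (closure_id B).1 //; exact: closureS. Qed.

Lemma digit_set_nonempty (R : realType) (n p : nat) (D : {set 'rV['I_p]_n}) :
  missing_digit_set R D 0 !=set0 ->
  (0 < #|D|)%N /\ exists y0 : 'rV[R]_n, (forall i, 0 <= y0 0 i < 1) /\ digit_set D 0 y0.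
Proof.
move=> [x cx]; have [y [dy _]] := cx setT filterT.
split; last exact: digit_set_unit dy.
by have [e eD _] := dy 0 isT; apply/card_gt0P; exists e.
Qed.

Lemma similarity_dim_le (R : realType) (n p : nat) (D : {set 'rV['I_p]_n}) : (1 < p)%N ->
  (0 < #|D|)%N -> similarity_dim R D <= n%:R.
Proof.
move=> p2 D0; have lnp : 0 < ln p%:R :> R by rewrite ln_gt0 // ltr1n.
rewrite /similarity_dim ler_pdivrMr // -ln_powR powR_mulrn // -natrX.
rewrite ler_ln ?posrE ?ltr0n ?expn_gt0 ?(ltnW p2) // ler_nat.
by apply: leq_trans (max_card _) _; rewrite card_mx card_ord mul1n.
Qed.

Lemma covering_number_ge (R : realType) (n : nat) (r a : R) (F : set 'rV[R]_n) :
  (forall s, covers r s F -> a <= (size s)%:R) -> (a%:E <= covering_number r F)%E.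
Proof. by move=> h; apply: le_ereal_inf_tmp => _ [s cs <-]; rewrite lee_fin h. Qed.

Lemma lower_box_dim_ge (R : realType) (n : nat) (F : set 'rV[R]_n) (tau c r0 : R) :
  0 < c -> 0 < r0 ->
  (forall r s, 0 < r -> r < r0 -> covers r s F -> c * r `^ (- tau) <= (size s)%:R) ->
  (tau%:E <= lower_box_dim F)%E.
Proof.
move=> c0 r00 h; rewrite /lower_box_dim limf_einfE.
apply/lee_subgt0Pr => e e0.
(* The bound 1/2 makes [ln delta] negative, and the exponential makes [|ln c| / (- ln delta)] at
   most [e]. *)
pose r1 := Num.min (Num.min r0 (1 / 2)) (expR (- (`|ln c| / e))).
have r10 : 0 < r1 by rewrite !lt_min r00 expR_gt0 /=; lra.
apply: (le_trans (y := ereal_inf [set (lne (covering_number delta F) * ((- ln delta)^-1)%:E)%E |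
    delta in [set delta | 0 < delta < r1]])); last first.
  apply: ereal_sup_ubound; exists [set delta | 0 < delta < r1] => //.
  exists r1 => //= delta; rewrite /ball_ /= sub0r normrN => hd d0.
  by rewrite d0 (le_lt_trans (ler_norm _)).
apply: le_ereal_inf_tmp => _ [delta /andP[d0 dr] <-].
move: dr; rewrite !lt_min => /andP[/andP[dr dh] de].
have d1 : delta < 1 by rewrite (lt_trans dh) //; lra.
have ln0 : 0 < - ln delta by rewrite oppr_gt0 ln_lt0 // d0.
have cov : ((c * delta `^ (- tau))%:E <= covering_number delta F)%E.
  by apply: covering_number_ge => s; exact: h.
have p0 : 0 < c * delta `^ (- tau) by rewrite mulr_gt0 // powR_gt0.
have : ((ln c - tau * ln delta)%:E <= lne (covering_number delta F))%E.
  have <- : lne (c * delta `^ (- tau))%:E = (ln c - tau * ln delta)%:E.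
    by rewrite lne_EFin // lnM ?posrE ?powR_gt0 // ln_powR mulNr.
  rewrite lee_lne // in_itv /= leey andbT.
    by rewrite lee_fin ltW.
  by apply: le_trans cov; rewrite lee_fin ltW.
have i0 : (0 <= ((- ln delta)^-1)%:E)%E by rewrite lee_fin invr_ge0 ltW.
move=> /(lee_wpmul2r i0); apply: le_trans.
rewrite -EFinM -EFinB lee_fin mulrBl.
have lne0 : ln delta != 0 by rewrite -oppr_eq0 lt0r_neq0.
have -> : tau * ln delta / - ln delta = - tau by field.
rewrite opprK addrC lerD2r lerNl -mulNr ler_pdivrMr //.
have : ln delta <= - (`|ln c| / e).
  by rewrite -[leRHS]expRK ler_ln ?posrE ?expR_gt0 // ltW.
rewrite lerNr ler_pdivrMr // mulrC => h1; apply: le_trans h1.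
by rewrite -normrN ler_norm.
Qed.

(** A finite set is covered by its own points at every radius, whereas the required number of balls
    tends to infinity. *)
Lemma infinite_of_cover_growth (R : realType) (n : nat) (F : set 'rV[R]_n) (tau c r0 : R) :
  0 < tau -> 0 < c -> 0 < r0 ->
  (forall r s, 0 < r -> r < r0 -> covers r s F -> c * r `^ (- tau) <= (size s)%:R) ->
  infinite_set F.
Proof.
move=> tau0 c0 r00 h /finite_seqP[s sE].
have [x0 x00 hx] := powR_unbounded ((size s)%:R / c) tau0.
pose r := Num.min (r0 / 2) x0^-1.
have r1 : 0 < r by rewrite lt_min divr_gt0 // invr_gt0.
have rr0 : r < r0 by rewrite gt_min gtr_pMr // invf_lt1 // ltr1n.
have : c * r `^ (- tau) <= (size s)%:R.
  apply: h => // x; rewrite sE => /= xs; exists x => //.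
  by rewrite subrr /enorm dotp0l sqrtr0 ltW.
apply/negP; rewrite -ltNge mulrC -ltr_pdivrMr // -powRV ?(ltW r1) //.
by apply: hx; rewrite -[leLHS]invrK lef_pV2 ?posrE ?invr_gt0 // ge_min lexx orbT.
Qed.

Section LocalMain.
Variables (R : realType) (n d p : nat) (M : set 'rV[R]_n).
Variables (mu : {measure set (borelRn R n) -> \bar R}) (sigma : R).
Variables (D : {set 'rV['I_p]_n}) (lam : probability (borelRn R n) R).
Hypotheses (n0 : (0 < n)%N) (p3 : (3 <= p)%N) (hd : (d < n)%N).
Hypotheses (hM : submanifold d M) (hmu : surface_measure d M mu).
Hypotheses (hsigma0 : 0 < sigma) (hsigma : fourier_decay M mu sigma).
Hypotheses (hK0 : missing_digit_set R D 0 !=set0) (hlam : missing_digit_law D lam).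
Hypothesis hdim : (0 < dim_l1 lam + sigma%:E - n%:R%:E)%E.

Let tau := similarity_dim R D - (n%:R - sigma).

(** All nonzero frequencies in use are integer vectors or multiples of them by [p^l], so decay is
    wanted from norm 1 on; below [r] the trivial bound is absorbed in the constant. *)
Lemma decay_from_one (phi : 'rV[R]_n -> R) (B : R) : 0 <= B ->
  (forall xi, normc (fourier mu phi xi) <= B) ->
  (exists C r : R, forall xi, r <= enorm xi ->
      normc (fourier mu phi xi) <= C * enorm xi `^ (- sigma)) ->
  exists2 CF, 0 <= CF & forall xi, 1 <= enorm xi ->
      normc (fourier mu phi xi) <= CF * enorm xi `^ (- sigma).
Proof.
move=> B0 hB [C [r hC]]; pose r1 := Num.max r 1.
have r1P : 0 < r1 by rewrite lt_max ltr01 orbT.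
exists (`|C| + B * r1 `^ sigma); first by rewrite addr_ge0 // mulr_ge0 ?powR_ge0.
move=> xi h1; have x0 : 0 < enorm xi by rewrite (lt_le_trans ltr01).
have [h|h] := leP r (enorm xi).
  apply: le_trans (hC xi h) _; rewrite ler_wpM2r ?powR_ge0 //.
  by apply: le_trans (ler_norm C) _; rewrite lerDl mulr_ge0 ?powR_ge0.
apply: le_trans (hB xi) _; rewrite powRN ler_pdivlMr ?powR_gt0 //.
apply: (le_trans (y := B * r1 `^ sigma)); last by rewrite lerDr.
rewrite ler_wpM2l //; apply: ge0_ler_powR; rewrite ?nnegrE ?enorm_ge0 ?(ltW hsigma0) ?(ltW r1P) //.
by rewrite le_max (ltW h).
Qed.

(** [l] comes from the mass and decay constants of a bump at [x1] of radius at most [eps], and [X]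
    is the part of [M] in its support. Both counts hold for the same [l]; keeping [X] within [eps]
    of [x1] serves the density claim. *)
Lemma local_main x1 eps : M x1 -> 0 < eps -> exists (l : nat) (X : set 'rV[R]_n),
  [/\ 0 < tau, X `<=` M `&` [set x | `|x - x1| <= eps],
    exists c r0 : R, [/\ 0 < c, 0 < r0 & forall r s, 0 < r -> r < r0 ->
      covers r s (X `&` missing_digit_set R D l) -> c * r `^ (- tau) <= (size s)%:R] &
    exists c r0 : R, [/\ 0 < c, 0 < r0 & forall delta s, 0 < delta -> delta < r0 ->
      covers delta s (thickening delta M `&` thickening delta (missing_digit_set R D l)) ->
      c * delta^-1 `^ (similarity_dim R D + d%:R - n%:R) <= (size s)%:R]].
Proof.
move=> Mx1 eps0.
have p2 : (1 < p)%N by exact: ltnW.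
have [D0 [y0 [y01 dy0]]] := digit_set_nonempty hK0.
have [rho [rM [CM [cM [[rho0 rM0 CM0 cM0] cMr upM lowM]]]]] := local_geometry hM hmu Mx1.
have mM : measurable (M : set (borelRn R n)) by exact: submanifold_borel hM hmu.
have muM := hmu.1.
pose rad := Num.min rho eps.
have rad0 : 0 < rad by rewrite lt_min rho0.
pose phi := smooth_bump x1 rad.
have cphi : continuous phi by exact: bump_continuous.
have phi0 x : 0 <= phi x by exact: bump_ge0.
have phiB x : phi x <= 1 by exact: bump_le1.
have ts : tsupp phi `<=` [set x | `|x - x1| <= rad].
  apply: closure_sub_closed; first exact: closed_norm_ball.
  by move=> x /= /(bump_supp rad0) /ltW; exact: le_trans (norm_le_enorm _).
have cts : compact (tsupp phi).
  by apply: subclosed_compact ts; [exact: closed_closure | exact: compact_norm_ball].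
pose X := M `&` tsupp phi.
have Xrho : X `<=` M `&` [set x | `|x - x1| <= rho].
  by move=> x [Mx /ts /= h]; split=> //=; apply: le_trans h _; rewrite ge_min lexx.
have Xeps : X `<=` M `&` [set x | `|x - x1| <= eps].
  by move=> x [Mx /ts /= h]; split=> //=; apply: le_trans h _; rewrite ge_min lexx orbT.
have cX : compact X.
  have -> : X = M `&` [set x | `|x - x1| <= rho] `&` tsupp phi.
    by apply/seteqP; split=> [x Xx|x [[Mx _] tx]] //; split; [exact: Xrho | case: Xx].
  by apply: compact_closedI => //; exact: closed_closure.
have mX : measurable (X : set (borelRn R n)) by exact: compact_borel.
have mts : measurable (tsupp phi : set (borelRn R n)) by exact: compact_borel.
(* The support is not contained in [M]: its mass is bounded by that of [X] plus that of the null
   complement of [M]. *)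
have mu_tsupp : (mu (tsupp phi) < +oo)%E.
  have mM' : measurable (~` M : set (borelRn R n)) by exact: measurableC.
  apply: (le_lt_trans (y := (mu X + mu (~` M))%E)).
    apply: (le_trans (y := mu (X `|` ~` M))); last exact: measureU2.
    apply: le_measure; rewrite ?inE //; first exact: measurableU.
    by move=> x tx; have [Mx|nMx] := pselect (M x); [left | right].
  rewrite muM adde0; apply: le_lt_trans (ltry (CM * rho ^+ d)).
  by apply: (upM X mX Xrho x1 rho (ltW rho0)) => x /Xrho[].
have nr0 : 0 < n%:R :> R by rewrite ltr0n.
(* The bump is bounded below on half its Euclidean radius; dividing by [n] expresses this in the sup
   norm. *)
pose r2 := rad / 2 / n%:R.
have r20 : 0 < r2 by rewrite !divr_gt0.
pose c1 : R := expR (- (2 / rad ^+ 2)).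
have philow x : `|x - x1| <= r2 -> c1 <= phi x.
  move=> h; apply: (bump_lb rad0); apply: le_trans (enorm_le_row _) _.
  by rewrite mulrC -ler_pdivlMr.
have lowM' t : 0 < t -> t <= Num.min rM r2 -> exists B : set (borelRn R n),
    [/\ measurable B, B `<=` M `&` [set x | `|x - x1| <= t] & ((cM * t ^+ d)%:E <= mu B)%E].
  by move=> t0; rewrite le_min => /andP[tr _]; exact: lowM.
have rm0 : 0 < Num.min rM r2 by rewrite lt_min rM0.
have mphi_gt0 : 0 < pairing mu phi (cst 1).
  have [B [mB BM muB]] := lowM' _ rm0 (lexx _).
  have pw x : B x -> c1 <= phi x * cst 1 x.
    move=> /BM[_ /= h]; rewrite mulr1; apply: philow.
    by apply: le_trans h _; rewrite ge_min lexx orbT.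
  have a1 : adm (cst 1 : 'rV[R]_n -> R) by exact: adm_cst.
  have := pairing_ge_set cphi phi0 phiB mu_tsupp a1 (fun _ => ler01) mB (expR_ge0 _) pw.
  move=> h; rewrite -lte_fin; apply: lt_le_trans h.
  apply: (lt_le_trans (y := (c1%:E * (cM * Num.min rM r2 ^+ d)%:E)%E)).
    by rewrite -EFinM lte_fin mulr_gt0 ?expR_gt0 // mulr_gt0 // exprn_gt0.
  by rewrite lee_wpmul2l // lee_fin expR_ge0.
have [CF CF0 decay] : exists2 CF, 0 <= CF & forall xi, 1 <= enorm xi ->
    normc (fourier mu phi xi) <= CF * enorm xi `^ (- sigma).
  apply: (decay_from_one (B := 2 * pairing mu phi (cst 1))).
  - by rewrite mulr_ge0 // ltW.
  - exact: (normc_fourier_le cphi phi0 phiB mu_tsupp mM muM).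
  - by apply: hsigma => //; exact: bump_smooth.
have [e [C [e0 es C0 hl1]]] := l1_words p2 hlam hsigma0 hdim.
have sn : sigma < n%:R.
  apply: (decay_exponent_lt n0 cphi phi0 phiB mu_tsupp mM muM CF0 decay hd (expR_gt0 _) rm0 cM0 _ lowM').
  by move=> x h; apply: philow; apply: le_trans h _; rewrite ge_min lexx orbT.
have tau0 : 0 < tau.
  have := similarity_dim_ge p3 n0 D0 e0 C0 hl1; rewrite /tau; lra.
have [l hl] := main_lower p2 n0 D0 cphi phi0 phiB mu_tsupp mM muM CF0 (ltW hsigma0) decay e0 es C0 hl1 mphi_gt0.
have main := hl l (leqnn l).
have [CB CB0 piece] := piece_upper p2 n0 D0 cphi phi0 phiB mu_tsupp mM muM CF0 (ltW hsigma0) decay e0 es C0 hl1 sn.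
exists l, X; split => //.
  by apply: (local_cover p2 D0 y01 dy0 cphi phi0 phiB mu_tsupp mM muM cX mphi_gt0 main CB0 tau0); exact: piece.
apply: (local_thick_cover p2 n0 D0 y01 dy0 cphi phi0 phiB mu_tsupp mM muM cX mphi_gt0 main CM0).
  exact: similarity_dim_le.
by move=> B mB BX a delta d0 h; apply: (upM B mB _ a delta d0 h); exact: subset_trans BX Xrho.
Qed.

End LocalMain.

Theorem theorem2p8 (R : realType) (n d p : nat) (M : set 'rV[R]_n)
    (mu : {measure set (borelRn R n) -> \bar R}) (sigma : R)
    (D : {set 'rV['I_p]_n}) (lam : probability (borelRn R n) R)
    (hn : (2 <= n)%N) (hp : (3 <= p)%N)
    (hM0 : M !=set0) (hd : (d < n)%N)
    (hM : submanifold d M) (hft : finite_type d M)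
    (hmu : surface_measure d M mu)
    (hsigma0 : 0 < sigma) (hsigma : fourier_decay M mu sigma)
    (hK0 : missing_digit_set R D 0 !=set0)
    (hlam : missing_digit_law D lam)
    (hdim : (0 < dim_l1 lam + sigma%:E - n%:R%:E)%E) :
  (exists l : nat,
    [/\ infinite_set (M `&` missing_digit_set R D l),
        exists2 c : R, 0 < c &
          \forall delta \near 0^'+,
            ((c * (delta^-1) `^
               (hausdorff_dim (missing_digit_set R D 0) + d%:R - n%:R))%:E <=
             covering_number delta
               (thickening delta M `&`
                thickening delta (missing_digit_set R D l)))%E &
        ((hausdorff_dim (missing_digit_set R D 0) - (n%:R - sigma))%:E <=
         lower_box_dim (M `&` missing_digit_set R D l))%E]) /\
  M `<=` closure (\bigcup_l (missing_digit_set R D l `&` M)).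
Proof.
have n0 : (0 < n)%N by exact: ltnW.
have p2 : (1 < p)%N by exact: ltnW.
have [D0 _] := digit_set_nonempty hK0.
have hH := hausdorff_dim_le_similarity R p2 D0.
have loc x eps := @local_main R n d p M mu sigma D lam n0 hp hd hM hmu hsigma0 hsigma hK0 hlam hdim x eps.
split.
  have [x1 Mx1] := hM0.
  have [l [X [tau0 XM [c [r0 [c0 r00 cov]]] [c' [r0' [c'0 r0'0 thick]]]]]] := loc x1 1 Mx1 ltr01.
  have covM r s : 0 < r -> r < r0 -> covers r s (M `&` missing_digit_set R D l) ->
      c * r `^ (- (similarity_dim R D - (n%:R - sigma))) <= (size s)%:R.
    move=> r1 r2 h; apply: cov => // x [/XM[Mx _] Kx]; exact: h.
  exists l; split.
  - exact: infinite_of_cover_growth covM.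
  - exists c' => //; near=> delta.
    have d0 : 0 < delta by [].
    have d1 : delta < r0' by near: delta; exact: nbhs_right_lt.
    have d2 : delta < 1 by near: delta; exact: nbhs_right_lt.
    apply: covering_number_ge => s /(thick _ _ d0 d1); apply: le_trans.
    (* The count holds with the similarity dimension; as [1 / delta >= 1], the Hausdorff dimension,
       which is no larger, gives a power that is no larger. *)
    rewrite ler_wpM2l ?(ltW c'0) // ler_powR ?invf_ge1 ?(ltW d2) //.
    by rewrite lerD2r lerD2r.
  - apply: le_trans (lower_box_dim_ge c0 r00 covM).
    by rewrite lee_fin lerD2r.
move=> x Mx V /nbhs_ballP[eps /= eps0 epsV].
have e2 : 0 < eps / 2 by rewrite divr_gt0.
have [l [X [_ XM [c [r0 [c0 r00 cov]]] _]]] := loc x (eps / 2) Mx e2.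
have [[y [Xy Ky]]|empty] := pselect ((X `&` missing_digit_set R D l) !=set0).
  exists y; split; first by exists l => //; split=> //; case: (XM _ Xy).
  apply: epsV; rewrite -ball_normE /ball_ /= distrC.
  have [_ /= h] := XM _ Xy; apply: le_lt_trans h _.
  by rewrite gtr_pMr // invf_lt1 // ltr1n.
have r2 : 0 < r0 / 2 by rewrite divr_gt0.
have rr : r0 / 2 < r0 by rewrite gtr_pMr // invf_lt1 // ltr1n.
(* An empty intersection would be covered by no ball at all, against the positive lower bound. *)
have : c * (r0 / 2) `^ (- (similarity_dim R D - (n%:R - sigma))) <= (size (Nil 'rV[R]_n))%:R.
  by apply: cov => // y Xy; case: empty; exists y.
by rewrite leNgt mulr_gt0 // powR_gt0.
Unshelve. all: by end_near. Qed.
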